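(* Let $\operatorname{PSL}(2,\mathbb{F}_{11})$ be the projective special linear group of $2\times 2$ matrices over the field with $11$ elements, and let $\operatorname{RD}(G)$ denote the resolvent degree over $\mathbb{C}$ of a finite group $G$. Then $$\operatorname{RD}\left(\operatorname{PSL}(2,\mathbb{F}_{11})\right)\leq 2.$$
   Context: The base field is $\mathbb{C}$ throughout. All fields below are finitely generated field extensions of $\mathbb{C}$, and all field extensions and embeddings are over $\mathbb{C}$. Essential dimension of an extension: for a finite field extension $L/K$, $\operatorname{ed}(L/K)$ is the least integer $d\ge 0$ such that there exist a subfield $\mathbb{C}\subseteq K_0\subseteq K$ with $\operatorname{trdeg}_{\mathbb{C}}(K_0)=d$ and a finite field extension $L_0/K_0$ with $L\cong L_0\otimes_{K_0}K$ as $K$-algebras. Resolvent degree of an extension: for a finite field extension $L/K$, $\operatorname{RD}(L/K)$ is the least integer $d\ge 0$ such that there exists a finite tower of finite field extensions $K=E_0\subseteq E_1\subseteq\cdots\subseteq E_r$ for which $L$ embeds in $E_r$ over $K$ and $\operatorname{ed}(E_i/E_{i-1})\leq d$ for all $1\leq i\leq r$. Resolvent degree of a finite group: for a finite group $G$, $\operatorname{RD}(G)$ is the supremum of $\operatorname{RD}(L/K)$ over all Galois field extensions $L/K$ with $\operatorname{Gal}(L/K)\cong G$, where $K$ is a finitely generated field extension of $\mathbb{C}$. (Equivalently, $\operatorname{RD}(G)=\operatorname{RD}(\mathbb{C}(V)/\mathbb{C}(V)^G)$ for any faithful finite-dimensional complex linear representation $V$ of $G$.) *)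

(* Defs.v *)
From HB Require Import structures.
From mathcomp Require Import all_boot all_order all_algebra all_fingroup all_solvable all_field.
From mathcomp Require Import boolp classical_sets reals ereal.
From mathcomp Require Import complex.
From mathcomp Require Import -(notations) mpoly.

Set Implicit Arguments.
Unset Strict Implicit.
Unset Printing Implicit Defensive.

Import Order.TTheory GRing.Theory Num.Theory.
Local Open Scope classical_set_scope.
Local Open Scope ring_scope.

(* A field extension of the complex numbers [R[i]].  An inclusion of such
   fields is a ring morphism commuting with the embeddings of [R[i]]; a finite
   extension L/K is an [L : fieldExtType K], which becomes an extension of the
   complex numbers through K (see [extC_over]). *)
Record extC (R : realType) := ExtC {
  extC_field :> fieldType;
  embC : {rmorphism R[i] -> extC_field}
}.
Arguments ExtC {R} _ _.
Arguments embC {R} _.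

Definition extC_over (R : realType) (K : extC R) (L : fieldExtType K) : extC R :=
  ExtC (L : fieldType) (in_alg L \o embC K : {rmorphism R[i] -> L}).

Section TranscendenceDegree.
Variables (R : realType) (K : extC R).

Definition evalC n (a : 'I_n -> K) (p : mpoly n R[i]) : K :=
  mmap (embC K) a p.

(* The subfield C(a_0, ..., a_{n-1}) of K. *)
Definition adjoinC n (a : 'I_n -> K) : set K :=
  [set x | exists p q, evalC a q != 0 /\ x = evalC a p / evalC a q].

Definition finitely_generatedC : Prop :=
  exists n (a : 'I_n -> K), forall x, adjoinC a x.

Definition alg_independent n (a : 'I_n -> K) : Prop :=
  forall p, evalC a p = 0 -> p = 0.

Definition algebraic_over (S : set K) (x : K) : Prop :=
  exists2 p : {poly K}, p != 0 & (forall i, S p`_i) /\ root p x.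

Definition transcendence_basis n (a : 'I_n -> K) : Prop :=
  alg_independent a /\ forall x, algebraic_over (adjoinC a) x.

Definition trdeg_is (d : nat) : Prop :=
  exists a : 'I_d -> K, transcendence_basis a.

End TranscendenceDegree.

Section TensorProduct.
Variables (K0 K : fieldType) (j : {rmorphism K0 -> K}).
Variables (L0 : fieldExtType K0).

Definition bilinear_over (V : zmodType) (sc : K0 -> V -> V)
    (b : L0 -> K -> V) : Prop :=
  [/\ forall x y a, b (x + y) a = b x a + b y a,
      forall x a a', b x (a + a') = b x a + b x a',
      forall c x a, b (c *: x) a = sc c (b x a)
    & forall c x a, b x (j c * a) = sc c (b x a)].

(* The K-algebra T, with (x, a) |-> t x a in the role of the pure tensors, is
   the tensor product of L0 and K over K0 (K being a K0-algebra through j): t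
   is the universal K0-bilinear map out of L0 x K, and the ring and K-algebra
   structures of T are the usual ones on pure tensors. *)
Definition is_tensor_product (T : algType K) (t : L0 -> K -> T) : Prop :=
  [/\ bilinear_over (fun c v => j c *: v) t,
      forall (V : lmodType K0) (b : L0 -> K -> V),
        bilinear_over (fun c v => c *: v) b ->
        exists! h : T -> V,
          [/\ forall u v, h (u + v) = h u + h v,
              forall c v, h (j c *: v) = c *: h v
            & forall x a, h (t x a) = b x a],
      t 1 1 = 1,
      forall x a y a', t x a * t y a' = t (x * y) (a * a')
    & forall c x a, c *: t x a = t x (c * a)].

(* L is isomorphic, as a K-algebra, to the tensor product of L0 and K. *)
Definition iso_tensor (L : fieldExtType K) : Prop :=
  exists (T : algType K) (t : L0 -> K -> T),
    is_tensor_product t /\ exists f : {lrmorphism T -> L}, bijective f.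

End TensorProduct.

(* The least element of a set of natural numbers (+oo for the empty set); see
   [least_le]. *)
Definition least (R : realType) (P : set nat) : \bar R :=
  ereal_inf [set n%:R%:E | n in P].

Lemma least_le (R : realType) (P : set nat) (d : nat) :
  (least R P <= d%:R%:E)%E <-> exists2 e, (e <= d)%N & P e.
Proof.
split=> [le_d | [e le_ed Pe]]; last first.
  apply: (@le_trans _ _ e%:R%:E); last by rewrite lee_fin ler_nat.
  by apply: ereal_inf_lbound; exists e.
apply: contrapT => nP.
have : (d.+1%:R%:E <= least R P)%E.
  apply: le_ereal_inf_tmp => _ [n Pn <-]; rewrite lee_fin ler_nat ltnNge.
  by apply/negP => le_nd; apply: nP; exists n.
by move=> /le_trans /(_ le_d); rewrite lee_fin ler_nat ltnn.
Qed.

Section ResolventDegree.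
Variable R : realType.

Definition defined_over_trdeg (K : extC R) (L : fieldExtType K) : set nat :=
  [set d | exists (K0 : extC R) (j : {rmorphism K0 -> K}),
     [/\ forall z, j (embC K0 z) = embC K z,
         trdeg_is K0 d
       & exists L0 : fieldExtType K0, iso_tensor j L0 L]].

Definition ed (K : extC R) (L : fieldExtType K) : \bar R :=
  least R (defined_over_trdeg L).

(* [ed_tower d f] : there are finite extensions K = E_0 <= ... <= E_r = E with
   ed(E_i/E_(i-1)) <= d for all i, and f is the inclusion of K in E. *)
Inductive ed_tower (d : nat) (K : extC R) :
    forall E : extC R, {rmorphism K -> E} -> Prop :=
| ed_tower_base : ed_tower d (E := K) idfun
| ed_tower_step (E : extC R) (f : {rmorphism K -> E}) (E' : fieldExtType E) :
    ed_tower d f -> (ed E' <= d%:R%:E)%E ->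
    ed_tower d (E := extC_over E') (in_alg E' \o f : {rmorphism K -> E'}).

Definition resolvable_in (K : extC R) (L : fieldExtType K) : set nat :=
  [set d | exists (E : extC R) (f : {rmorphism K -> E}),
     ed_tower d f /\
     exists h : {rmorphism L -> E}, forall c : K, h c%:A = f c].

Definition RD_ext (K : extC R) (L : fieldExtType K) : \bar R :=
  least R (resolvable_in L).

(* A [splittingFieldType K] is a normal finite extension of K. *)
Definition RD (gT : finGroupType) (G : {group gT}) : \bar R :=
  ereal_sup [set r | exists (K : extC R) (L : splittingFieldType K),
    [/\ finitely_generatedC K,
        galois 1%VS {:L},
        'Gal({:L} / 1%VS)%g \isog G
      & r = RD_ext L]].

End ResolventDegree.

Section ProjectiveSpecialLinear.
Variables (n : nat) (F : finFieldType).

Definition SL : {set {'GL_n[F]}} := [set A | \det (GLval A) == 1]%SET.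

Lemma SL_group_set : group_set SL.
Proof.
apply/group_setP; split=> [|A B]; first by rewrite inE det1.
by rewrite !inE => /eqP dA /eqP dB; rewrite GL_MxE det_mulmx dA dB mulr1.
Qed.
Canonical SL_group := Group SL_group_set.

Definition PSL := (SL / 'Z(SL))%g.
Canonical PSL_group := [group of PSL].

End ProjectiveSpecialLinear.

(* Main.v *)
Require Import Defs.
From HB Require Import structures.
From mathcomp Require Import all_boot all_order all_algebra all_fingroup all_solvable all_field.
From mathcomp Require Import boolp classical_sets filter reals ereal.
From mathcomp Require Import complex ring zify.
From mathcomp Require Import -(notations) mpoly.
Set Implicit Arguments.
Unset Strict Implicit.
Unset Printing Implicit Defensive.
Import GRing.Theory.
Local Open Scope ring_scope.

(** Let L/K be a Galois extension with group G = PSL(2,11) and let E be an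
algebraic closure of L.  Let M ([hull]) be the smallest subfield of E that
contains K and contains with any two elements a, b every element of E that is
algebraic over C(a,b).  Adjoining such an element y to a field F containing a
and b is a base change of an extension of the field of those elements of F that
are algebraic over C(a,b), a field of transcendence degree at most 2; hence
each element of M lies at the top of a tower of extensions of essential
dimension at most 2 ([step_extension], [tower_of_hull]), and it suffices to
show that L is contained in M ([resolvable_of_hull]).

The field M has many solvable equations.  A Tschirnhaus transformation brings
a polynomial of degree at most 6 to the form X^n + a X^2 + b X + c, and scaling
X leaves two parameters; so polynomials of degree at most 6 over M have roots
in M ([hull_solvable]).  It follows that a cubic form in five variables over M
vanishes on a line defined over M, hence has a common nontrivial zero with any
quintic form ([cubic_quintic]).

The odd part of the Weil representation of SL(2,11) has dimension 5, is trivial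
on -1, and preserves the Klein cubic
x0^2 x1 + x1^2 x2 + x2^2 x3 + x3^2 x4 + x4^2 x0 ([tri_rho]); the Hessian of
the cubic is then an invariant quintic.  The common zeros of the two forms are
a surface: two ratios of coordinates determine the others algebraically
([klein_rank2]).

Let S be the subgroup of G that is the Galois group of LM/M, and let U be the
sum of the nontrivial S-subrepresentations of C^5.  By Galois descent the
S-equivariant vectors of U with coordinates in LM form an M-vector space of
dimension dim U, on which the S-invariant forms have coefficients in M.  If U is
not zero, this space contains a nonzero vector x whose ratios of coordinates
are all algebraic over two of them: any x if dim U is at most 3, a zero of an
invariant form of degree 2 or 3 if dim U = 4, a common zero of the cubic and the
quintic if U = C^5 ([prj_eq0]).  Rescale x by a root so that some nonconstant
invariant takes the value 1 at x; then the coordinates of x themselves are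
algebraic over two elements.  They are also algebraic over the values at x of
the invariants of S, which lie in M, so by Steinitz exchange they are algebraic
over two of those values, and x has coordinates in M.  Then S fixes x, against
the choice of U ([no_rank2_vector]).  So U = 0; as G acts faithfully S is
trivial, and a primitive element of L/K lies in M ([faithful_hull]). *)

(** * Algebraic closures *)

Lemma irreducible_factor (F : fieldType) (p : {poly F}) :
  (1 < size p)%N -> exists2 q : {poly F}, irreducible_poly q & q %| p.
Proof.
have [m] := ubnP (size p); elim: m p => // m IHm p.
rewrite ltnS => lepm p_n1.
have [p_irr|] := pselect (irreducible_poly p); first by exists p.
move=> /not_andP[//|/existsNP[q /not_implyP[q_n1 /not_implyP[q_dv /negP q_ne]]]].
have nz_p : p != 0 by apply: contraTneq p_n1 => ->; rewrite size_poly0.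
have nz_q : q != 0 by apply: contraNneq nz_p => q0; move: q_dv; rewrite q0 dvd0p.
have q_gt1 : (1 < size q)%N by rewrite ltn_neqAle eq_sym q_n1 lt0n size_poly_eq0.
have qlt : (size q < size p)%N.
  by rewrite ltn_neqAle dvdp_leq // andbT; apply: contraNneq q_ne => e; rewrite -dvdp_size_eqp ?e.
have [r r_irr r_dv] := IHm q (leq_trans qlt lepm) q_gt1.
by exists r => //; apply: dvdp_trans q_dv.
Qed.

Lemma exists_splitting_field (F : fieldType) (p : {poly F}) :
  exists (E : fieldType) (f : {rmorphism F -> E}) (rs : seq E),
    map_poly f p %= \prod_(x <- rs) ('X - x%:P) \/ p = 0.
Proof.
have [n] := ubnP (size p); elim: n F p => // n IHn F p; rewrite ltnS => lepn.
have [p1|p_n1] := leqP (size p) 1.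
  exists F, idfun, [::]; rewrite big_nil map_poly_id //.
  have [->|nz_p] := eqVneq p 0; [by right | left].
  by rewrite -size_poly_eq1 eqn_leq p1 lt0n size_poly_eq0.
have [q q_irr q_dv] := irreducible_factor p_n1.
have [L _ [z qz _]] := irredp_FAdjoin q_irr.
have pz : root (map_poly (in_alg L) p) z.
  by apply: root_dvdp qz; rewrite dvdp_map.
have /factor_theorem [r Dr] := pz.
have nz_p : p != 0 by apply: contraTneq p_n1 => ->; rewrite size_poly0.
have nz_r : r != 0.
  by apply: contraNneq nz_p => r0; move/eqP: Dr; rewrite r0 mul0r map_poly_eq0.
have szr : (size r < n)%N.
  have := congr1 (fun u : {poly L} => size u) Dr.
  by rewrite size_map_poly size_Mmonic ?monicXsubC // size_XsubC addn2 /= => <-.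
have [E [f [rs [Hrs|//]]]] := IHn L r szr; last by move=> r0; rewrite r0 eqxx in nz_r.
exists E, (f \o in_alg L : {rmorphism F -> E}), (f z :: rs); left.
rewrite big_cons mulrC map_poly_comp /= Dr rmorphM /= map_polyXsubC.
by rewrite eqp_mulr.
Qed.

(** An alias of the product type, so that it carries the ring structure of the
product of the fields without clashing with other structures on functions. *)
Definition prod_ring (I : Type) (E : I -> fieldType) : Type := forall i, E i.

Section ProdRing.
Variables (I : Type) (E : I -> fieldType) (i0 : I).
Local Notation P := (prod_ring E).
HB.instance Definition _ := gen_eqMixin P.
HB.instance Definition _ := gen_choiceMixin P.
Let ext (f g : P) : (forall i, f i = g i) -> f = g.
Proof. by move=> fg; apply: functional_extensionality_dep. Qed.
Definition prod_zero : P := fun i => 0.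
Definition prod_one : P := fun i => 1.
Definition prod_add (f g : P) : P := fun i => f i + g i.
Definition prod_opp (f : P) : P := fun i => - f i.
Definition prod_mul (f g : P) : P := fun i => f i * g i.
Fact prod_addA : associative prod_add. Proof. by move=> f g h; apply: ext => i; apply: addrA. Qed.
Fact prod_addC : commutative prod_add. Proof. by move=> f g; apply: ext => i; apply: addrC. Qed.
Fact prod_add0 : left_id prod_zero prod_add. Proof. by move=> f; apply: ext => i; apply: add0r. Qed.
Fact prod_addN : left_inverse prod_zero prod_opp prod_add.
Proof. by move=> f; apply: ext => i; apply: addNr. Qed.
HB.instance Definition _ := GRing.isZmodule.Build P prod_addA prod_addC prod_add0 prod_addN.
Fact prod_mulA : associative prod_mul. Proof. by move=> f g h; apply: ext => i; apply: mulrA. Qed.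
Fact prod_mulC : commutative prod_mul. Proof. by move=> f g; apply: ext => i; apply: mulrC. Qed.
Fact prod_mul1 : left_id prod_one prod_mul. Proof. by move=> f; apply: ext => i; apply: mul1r. Qed.
Fact prod_mulD : left_distributive prod_mul +%R.
Proof. by move=> f g h; apply: ext => i; apply: mulrDl. Qed.
End ProdRing.

Section Ultraproduct.
Variables (I : pointedType) (E : I -> fieldType).
Local Notation P := (prod_ring E).
Fact prod_1neq0 : @prod_one I E != 0.
Proof. by apply/eqP => /(congr1 (fun f => f point)) /eqP; rewrite oner_eq0. Qed.
HB.instance Definition _ := GRing.Zmodule_isComNzRing.Build P
  (@prod_mulA I E) (@prod_mulC I E) (@prod_mul1 I E) (@prod_mulD I E) prod_1neq0.

Definition proj i (f : P) : E i := f i.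
Fact proj_is_zmod i : zmod_morphism (proj i). Proof. by []. Qed.
Fact proj_is_monoid i : monoid_morphism (proj i). Proof. by []. Qed.
HB.instance Definition _ i := GRing.isZmodMorphism.Build P (E i) (proj i) (proj_is_zmod i).
HB.instance Definition _ i := GRing.isMonoidMorphism.Build P (E i) (proj i) (proj_is_monoid i).

Variables (F : fieldType) (j : forall i, {rmorphism F -> E i}).
Definition diag (x : F) : P := fun i => j i x.
Fact diag_is_zmod : zmod_morphism diag.
Proof. by move=> x y; apply: functional_extensionality_dep => i; apply: rmorphB. Qed.
Fact diag_is_monoid : monoid_morphism diag.
Proof.
split=> [|x y]; apply: functional_extensionality_dep => i; [exact: rmorph1 | exact: rmorphM].
Qed.
HB.instance Definition _ := GRing.isZmodMorphism.Build F P diag diag_is_zmod.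
HB.instance Definition _ := GRing.isMonoidMorphism.Build F P diag diag_is_monoid.

Variable G : set_system I.
(** The ideal of the families that vanish almost everywhere. *)
Definition null of UltraFilter G : pred P := fun f => `[< G [set i | f i = 0]%classic >].
Variable UG : UltraFilter G.
Fact null_ideal : idealr_closed (null UG).
Proof.
split=> [||a f g].
- by apply/asboolP; apply: filterS filterT.
- apply/asboolP => G1; apply: (@filter_not_empty _ G _).
  by apply: filterS G1 => i /= /eqP; rewrite oner_eq0.
move=> /asboolP Gf /asboolP Gg; apply/asboolP.
apply: filterS (filterI Gf Gg) => i [/= f0 g0].
by rewrite -[LHS]/(a i * f i + g i) f0 g0 mulr0 addr0.
Qed.
HB.instance Definition _ := isIdealr.Build P (null UG) null_ideal.
Definition null_id : idealr P := null UG.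
Definition uprod := {ideal_quot null_id}.
HB.instance Definition _ := GRing.ComNzRing.on uprod.
Definition to_uprod : P -> uprod := (\pi_(uprod))%qT.
HB.instance Definition _ := GRing.RMorphism.on to_uprod.

Lemma to_uprod_eq f g : (to_uprod f = to_uprod g) <-> G [set i | f i = g i]%classic.
Proof.
have E0 : (f - g \in null UG) = (to_uprod f == to_uprod g) by exact: Quotient.idealrBE.
split=> [/eqP|Gfg].
  rewrite -E0 => /asboolP; apply: filterS => i /= /eqP.
  by rewrite -[X in X == _]/(f i - g i) subr_eq0 => /eqP.
apply/eqP; rewrite -E0; apply/asboolP; apply: filterS Gfg => i /= fg.
by rewrite -[LHS]/(f i - g i) fg subrr.
Qed.

(** By maximality of the filter, a family that does not vanish almost everywhere
is nonzero, hence invertible, almost everywhere. *)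
Fact uprod_inv_ex (x : uprod) : exists y, (x != 0) ==> (y * x == 1).
Proof.
have [f ->] : exists f, x = to_uprod f by exists (generic_quotient.repr x); rewrite /to_uprod reprK.
exists (to_uprod (fun i => (f i)^-1)); apply/implyP => f_nz; apply/eqP.
rewrite -rmorphM -[RHS](rmorph1 to_uprod); apply/to_uprod_eq.
have [f0|] := in_ultra_setVsetC [set i | f i = 0]%classic UG.
  case/eqP: f_nz; rewrite -(rmorph0 to_uprod); exact/to_uprod_eq.
by apply: filterS => i /= /eqP; apply: mulVf.
Qed.
Definition uprod_inv (x : uprod) := if x == 0 then 0 else xchoose (uprod_inv_ex x).
Fact uprod_mulVf x : x != 0 -> uprod_inv x * x = 1.
Proof.
move=> nz_x; rewrite /uprod_inv ifN //.
exact: (eqP (implyP (xchooseP (uprod_inv_ex x)) nz_x)).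
Qed.
Fact uprod_inv0 : uprod_inv 0 = 0. Proof. by rewrite /uprod_inv ifT. Qed.
HB.instance Definition _ := GRing.ComNzRing_isField.Build uprod uprod_mulVf uprod_inv0.
End Ultraproduct.

Lemma dvdp_prod_seq (F : fieldType) (s : seq {poly F}) p :
  p \in s -> p != 0 -> p %| \prod_(q <- s | q != 0) q.
Proof. by move=> ps nz_p; rewrite (big_rem p) //= nz_p dvdp_mulr. Qed.

(** The ultraproduct, over finite lists of polynomials, of splitting fields of
their products: almost all lists contain a given p, so p splits in it. *)
Lemma exists_total_splitting_field (F : fieldType) :
  exists (E : fieldType) (f : {rmorphism F -> E}), forall p : {poly F}, p != 0 ->
    exists rs : seq E, map_poly f p %= \prod_(x <- rs) ('X - x%:P).
Proof.
pose I : pointedType := HB.pack (seq {poly F}) (isPointed.Build (seq {poly F}) [::]).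
have HE (s : I) : exists E : fieldType, exists (f : {rmorphism F -> E}),
   forall p, p \in (s : seq {poly F}) -> p != 0 ->
   exists rs, map_poly f p %= \prod_(x <- rs) ('X - x%:P).
  have [E [f [rs [Hrs|/eqP]]]] := exists_splitting_field (\prod_(p <- (s : seq {poly F}) | p != 0) p); last first.
    by rewrite prodf_seq_eq0 => /hasP[p _ /andP[/negP]].
  exists E, f => p ps nz_p.
  have : map_poly f p %| \prod_(x <- rs) ('X - x%:P).
    by rewrite -(eqp_dvdr _ Hrs) dvdp_map dvdp_prod_seq.
  by case/dvdp_prod_XsubC => m Hm; exists (mask m rs).
have [E HE1] := choice HE.
have [j Hj] : exists j : forall s : I, {rmorphism F -> E s}, forall s p,
   p \in (s : seq {poly F}) -> p != 0 -> exists rs, map_poly (j s) p %= \prod_(x <- rs) ('X - x%:P).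
  exists (fun s => projT1 (cid (HE1 s))) => s; exact: (projT2 (cid (HE1 s))).
pose G0 : set_system I := fun A => exists t : seq {poly F},
  forall s : seq {poly F}, {subset t <= s} -> A s.
have PG0 : ProperFilter G0.
  split; first by case=> t /(_ t (fun _ h => h)).
  split; first by exists [::].
    move=> A B [t tA] [u uB]; exists (t ++ u) => s sub; split.
      by apply: tA => x xt; apply: sub; rewrite mem_cat xt.
    by apply: uB => x xu; apply: sub; rewrite mem_cat xu orbT.
  by move=> A B AB [t tA]; exists t => s /tA /AB.
have [G [UG G0G]] := ultraFilterLemma PG0.
exists (@uprod I E G UG : fieldType), (@to_uprod I E G UG \o diag j : {rmorphism F -> _}) => p nz_p.
pose n := (size p).-1.
have Hs (s : I) : exists r : n.-tuple (E s), p \in (s : seq {poly F}) ->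
    map_poly (j s) p = (j s (lead_coef p)) *: \prod_(i < n) ('X - (tnth r i)%:P).
  have [ps|] := boolP (p \in (s : seq {poly F})); last by exists [tuple 0 | i < n].
  have [rs Hrs] := Hj s p ps nz_p.
  have szr : size rs == n.
    by have /eqP := eqp_size Hrs; rewrite size_map_poly size_prod_XsubC /n => /eqP ->.
  exists (Tuple szr) => _.
  rewrite -(big_tuple _ _ (Tuple szr) xpredT (fun x => 'X - x%:P)) /=.
  have /eqpP[[a b] /= /andP[nz_a nz_b] Hab] := Hrs.
  have := congr1 lead_coef Hab; rewrite !lead_coefZ lead_coef_map.
  rewrite (monicP (monic_prod_XsubC _ _ _)) mulr1 => Eb.
  by apply: (scalerI nz_a); rewrite Hab scalerA Eb.
pose r s := projT1 (cid (Hs s)); have Hr s := projT2 (cid (Hs s)).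
pose rr (i : 'I_n) : prod_ring E := fun s => tnth (r s) i.
exists [seq @to_uprod I E G UG (rr i) | i <- enum 'I_n].
rewrite big_map big_enum /=.
suff -> : map_poly (@to_uprod I E G UG \o diag j) p =
    @to_uprod I E G UG (diag j (lead_coef p)) *: \prod_(i < n) ('X - (@to_uprod I E G UG (rr i))%:P).
  rewrite eqp_scale //; have := fmorph_eq0 (@to_uprod I E G UG \o diag j : {rmorphism F -> _}) (lead_coef p).
  by rewrite /= => ->; rewrite lead_coef_eq0.
pose q : {poly prod_ring E} := diag j (lead_coef p) *: \prod_(i < n) ('X - (rr i)%:P).
have -> : @to_uprod I E G UG (diag j (lead_coef p)) *: \prod_(i < n) ('X - (@to_uprod I E G UG (rr i))%:P)
   = map_poly (@to_uprod I E G UG) q.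
  rewrite map_polyZ rmorph_prod; congr (_ *: _).
  by apply: eq_bigr => i _; rewrite /= map_polyXsubC.
apply/polyP=> k; rewrite !coef_map /=; apply/to_uprod_eq.
apply: G0G; exists [:: p] => s /(_ p); rewrite inE eqxx => /(_ isT) ps /=.
have E1 : @proj I E s (diag j p`_k) = (map_poly (j s) p)`_k by rewrite coef_map.
have E2 : @proj I E s q`_k = (map_poly (@proj I E s) q)`_k by rewrite coef_map.
rewrite -[LHS]/(@proj I E s (diag j p`_k)) -[RHS]/(@proj I E s q`_k) E1 E2.
congr (_`_k); rewrite (Hr s ps) /q map_polyZ rmorph_prod.
under [in RHS]eq_bigr => i _ do rewrite /= map_polyXsubC.
by [].
Qed.

(** Subfields are predicates, as the fields below may have infinite degree over each other
and cannot be handled as finite-dimensional subspaces. *)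
Record subfieldP (E : fieldType) (S : E -> Prop) : Prop := SubfieldP {
  subf1 : S 1;
  subfB : forall x y, S x -> S y -> S (x - y);
  subfM : forall x y, S x -> S y -> S (x * y);
  subfV : forall x, S x -> S x^-1 }.

Section SubfieldType.
Variables (E : fieldType) (S : E -> Prop).
Definition subf_pred (_ : subfieldP S) : pred E := fun x => `[< S x >].
Variable HS : subfieldP S.
Fact subf_divring : divring_closed (subf_pred HS).
Proof.
split=> [|x y /asboolP Sx /asboolP Sy|x y /asboolP Sx /asboolP Sy]; apply/asboolP.
- exact: subf1 HS.
- exact: subfB.
- by apply: (subfM HS) => //; apply: (subfV HS).
Qed.
HB.instance Definition _ := GRing.isDivringClosed.Build E (subf_pred HS) subf_divring.
Definition subf : Type := {x : E | x \in subf_pred HS}.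
HB.instance Definition _ := [isSub for (@sval _ _ : subf -> E)].
HB.instance Definition _ := [Choice of subf by <:].
HB.instance Definition _ := [SubChoice_isSubIntegralDomain of subf by <:].
HB.instance Definition _ := [SubIntegralDomain_isSubField of subf by <:].
Definition subf_val : subf -> E := val.
HB.instance Definition _ := GRing.RMorphism.on subf_val.
Lemma subf_valP x : S (subf_val x). Proof. exact/asboolP/(valP x). Qed.
Lemma subf_ex x : S x -> exists y, subf_val y = x.
Proof. by move=> Sx; exists (Sub x (introT (asboolP _) Sx)). Qed.
End SubfieldType.

Lemma lift_poly (A B : fieldType) (f : {rmorphism A -> B}) (p : {poly B}) :
  (forall i, exists a, f a = p`_i) -> exists q, map_poly f q = p.
Proof.
move=> /choice[g Hg]; exists (\poly_(i < size p) g i); apply/polyP=> i.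
rewrite coef_map coef_poly; case: ltnP => [_|le_i]; first exact: Hg.
by rewrite raddf0 nth_default.
Qed.

Lemma lift_rmorph (A B E : fieldType) (f : {rmorphism A -> E}) (g : {rmorphism B -> E}) :
  (forall a, exists b, g b = f a) -> exists h : {rmorphism A -> B}, forall a, g (h a) = f a.
Proof.
move=> /choice[h Hh]; have inj_g : injective g := fmorph_inj g.
have h_zmod : zmod_morphism h by move=> a b; apply: inj_g; rewrite rmorphB !Hh rmorphB.
have h_mon : monoid_morphism h.
  by split=> [|a b]; apply: inj_g; rewrite ?rmorph1 ?rmorphM !Hh ?rmorph1 ?rmorphM.
pose hm : {rmorphism A -> B} := HB.pack h (GRing.isZmodMorphism.Build A B h h_zmod)
  (GRing.isMonoidMorphism.Build A B h h_mon).
by exists hm.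
Qed.

Definition imC (C E : fieldType) (iota : {rmorphism C -> E}) x := exists c, iota c = x.

Lemma imC_subfield (C E : fieldType) (iota : {rmorphism C -> E}) : subfieldP (imC iota).
Proof.
split; first by exists 1; rewrite rmorph1.
- by move=> _ _ [a <-] [b <-]; exists (a - b); rewrite rmorphB.
- by move=> _ _ [a <-] [b <-]; exists (a * b); rewrite rmorphM.
- by move=> _ [a <-]; exists a^-1; rewrite fmorphV.
Qed.

Section RelativeClosure.
Variable E : fieldType.
Implicit Types S T : E -> Prop.

Section SubfTheory.
Variables (S : E -> Prop) (HS : subfieldP S).
Lemma subf0 : S 0. Proof. by rewrite -(subrr 1); apply: subfB (subf1 HS) (subf1 HS). Qed.
Lemma subfN x : S x -> S (- x). Proof. by move=> Sx; rewrite -sub0r; apply: subfB subf0 Sx. Qed.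
Lemma subfD x y : S x -> S y -> S (x + y).
Proof. by move=> Sx /subfN Sy; rewrite -[y]opprK; apply: subfB. Qed.
Lemma subf_div x y : S x -> S y -> S (x / y).
Proof. by move=> Sx Sy; apply: (subfM HS) => //; apply: (subfV HS). Qed.
Lemma subfX x n : S x -> S (x ^+ n).
Proof. by move=> Sx; elim: n => [|n IHn]; [exact: subf1 | rewrite exprS; apply: subfM]. Qed.
Lemma subf_sum (I : Type) (r : seq I) (P : pred I) (F : I -> E) :
  (forall i, P i -> S (F i)) -> S (\sum_(i <- r | P i) F i).
Proof. by move=> SF; elim/big_rec: _ => [|i x Pi Sx]; [exact: subf0 | apply: subfD => //; apply: SF]. Qed.
Lemma subf_prod (I : Type) (r : seq I) (P : pred I) (F : I -> E) :
  (forall i, P i -> S (F i)) -> S (\prod_(i <- r | P i) F i).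
Proof. by move=> SF; elim/big_rec: _ => [|i x Pi Sx]; [exact: subf1 | apply: subfM => //; apply: SF]. Qed.
Lemma subf_nat n : S n%:R.
Proof. by elim: n => [|n IHn]; [exact: subf0 | rewrite -natr1; apply: subfD IHn (subf1 HS)]. Qed.
Lemma subf_horner (p : {poly E}) x : (forall i, S p`_i) -> S x -> S p.[x].
Proof.
move=> Sp Sx; rewrite horner_coef; apply: subf_sum => i _.
by apply: (subfM HS) => //; apply: subfX.
Qed.
Lemma subf_polyXsubC_prod (rs : seq E) : (forall x, x \in rs -> S x) ->
  forall i, S (\prod_(x <- rs) ('X - x%:P))`_i.
Proof.
elim: rs => [|x rs IH] Srs i.
  by rewrite big_nil coef1; apply: subf_nat.
have {}IH j := IH (fun y yrs => Srs y (mem_behead (s := x :: rs) yrs)) j.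
rewrite big_cons mulrBl coefB coefXM coefCM; apply: (subfB HS).
  by case: eqP => _; [exact: subf0 | exact: IH].
by apply: (subfM HS); [apply: Srs; rewrite mem_head | exact: IH].
Qed.
End SubfTheory.

(** The Prop-valued form of [algebraicOver], for a subfield given by a predicate. *)
Definition algP S (y : E) := exists p : {poly E}, [/\ p != 0, forall i, S p`_i & root p y].

Lemma algP_sub S T y : (forall x, S x -> T x) -> algP S y -> algP T y.
Proof. by move=> ST [p [nz_p Sp py]]; exists p; split=> // i; apply: ST. Qed.

Lemma algPE S (HS : subfieldP S) y : algP S y <-> algebraicOver (@subf_val E S HS) y.
Proof.
split=> [[p [nz_p Sp py]]|[q nz_q qy]].
  have [q Dq] := lift_poly (f := @subf_val E S HS) (fun i => subf_ex HS (Sp i)).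
  by exists q; rewrite ?Dq // -(map_poly_eq0 (@subf_val E S HS)) Dq.
exists (map_poly (@subf_val E S HS) q); split=> [|i|//]; first by rewrite map_poly_eq0.
by rewrite coef_map; apply: subf_valP.
Qed.

Lemma algP_id S (HS : subfieldP S) x : S x -> algP S x.
Proof. by move=> /(subf_ex HS)[a <-]; apply/(algPE HS)/algebraic_id. Qed.

Lemma algP_subfield S : subfieldP S -> subfieldP (algP S).
Proof.
move=> HS; split.
- exact: algP_id (subf1 HS).
- by move=> x y /(algPE HS) Sx /(algPE HS) Sy; apply/(algPE HS)/algebraic_sub.
- by move=> x y /(algPE HS) Sx /(algPE HS) Sy; apply/(algPE HS)/algebraic_mul.
- by move=> x /(algPE HS) Sx; apply/(algPE HS)/algebraic_inv.
Qed.

Lemma algP_idem S (HS : subfieldP S) y : algP (algP S) y -> algP S y.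
Proof.
case=> p [nz_p Sp py]; apply/(algPE HS)/integral_algebraic.
apply: (integral_root nz_p py) => c /(nthP 0)[i _ <-].
exact/integral_algebraic/(algPE HS).
Qed.
End RelativeClosure.

Definition closedF (E : fieldType) := forall p : {poly E}, (1 < size p)%N -> exists x, root p x.

(** The elements algebraic over F in a field where all polynomials over F split.
A root, in an extension of this field, of an irreducible polynomial over it is
algebraic over F, so it is one of the roots that already lie in the field. *)
Lemma exists_algebraic_closure (F : fieldType) :
  exists (E : fieldType) (f : {rmorphism F -> E}), closedF E.
Proof.
have [E0 [f0 Hf0]] := exists_total_splitting_field F.
pose S := imC f0; have HS : subfieldP S := imC_subfield f0.
have HA := algP_subfield HS; pose E := subf HA; pose v : {rmorphism E -> E0} := @subf_val _ _ HA.
have lift a : exists y : E, v y = f0 a.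
  by apply: (subf_ex HA); apply: (algP_id HS); exists a.
have [gM Hg] := lift_rmorph lift.
exists (E : fieldType), gM => p p_gt1.
have [q q_irr q_dv] := irreducible_factor p_gt1.
have [L _ [y qy _]] := irredp_FAdjoin q_irr.
have algL (c : E) : algebraicOver (in_alg L \o gM) (in_alg L c).
  have [h [nz_h Sh hc]] : algP S (v c) by apply: subf_valP.
  have [h1 Dh1] := lift_poly Sh.
  exists h1; first by rewrite -(map_poly_eq0 f0) Dh1.
  rewrite map_poly_comp /=; apply/(rmorph_root (in_alg L)).
  have : root (map_poly v (map_poly gM h1)) (v c).
    rewrite -map_poly_comp (_ : map_poly _ _ = h) //.
    by rewrite -Dh1; apply: eq_map_poly => a /=; apply: Hg.
  by rewrite fmorph_root.
have [h nz_h hy] : algebraicOver (in_alg L \o gM) y.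
  apply/integral_algebraic.
  have nz_q : map_poly (in_alg L) q != 0 by rewrite map_poly_eq0 irredp_neq0.
  apply: (integral_root nz_q qy) => c /(nthP 0)[i _ <-].
  by rewrite coef_map; apply/integral_algebraic/algL.
have [rs Hrs] := Hf0 h nz_h.
have algrs x : x \in rs -> algP S x.
  move=> xrs; exists (map_poly f0 h); split; first by rewrite map_poly_eq0.
    by move=> i; rewrite coef_map; exists h`_i.
  by rewrite (eqp_root Hrs) root_prod_XsubC.
have [rs' Drs] : exists rs' : seq E, map v rs' = rs.
  elim: rs algrs {Hrs} => [|x rs IH] Hrs; first by exists [::].
  have [r' <-] := IH (fun z zr => Hrs z (mem_behead (s := x :: rs) zr)).
  have [x' <-] := subf_ex HA (Hrs x (mem_head _ _)).
  by exists (x' :: r').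
have Hrs' : map_poly gM h %= \prod_(x <- rs') ('X - x%:P).
  rewrite -(eqp_map v) -map_poly_comp rmorph_prod.
  under eq_bigr => x _ do rewrite /= map_polyXsubC.
  rewrite -(big_map v xpredT (fun x => 'X - x%:P)) Drs.
  by rewrite (@eq_map_poly _ _ _ f0) // => a /=; apply: Hg.
have : root (map_poly (in_alg L) (map_poly gM h)) y by rewrite -map_poly_comp.
move: Hrs'; rewrite -(eqp_map (in_alg L)) => /eqp_root ->.
rewrite rmorph_prod; under eq_bigr => x _ do rewrite /= map_polyXsubC.
rewrite -(big_map (in_alg L) xpredT (fun x => 'X - x%:P)) root_prod_XsubC.
case/mapP => x _ Dy; exists x; apply: (root_dvdp q_dv).
by move: qy; rewrite Dy fmorph_root.
Qed.

(** * Forms over a field of characteristic zero *)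

Definition char_zero (F : nzRingType) := forall n, n.+1%:R != 0 :> F.

Lemma coef_comp_polyZX (F : fieldType) (p : {poly F}) a i : (p \Po (a *: 'X))`_i = a ^+ i * p`_i.
Proof.
elim/poly_ind: p i => [|p c IHp] i; first by rewrite comp_poly0 !coef0 mulr0.
rewrite comp_polyD comp_polyM comp_polyX comp_polyC -scalerAr !coefD coefZ !coefMX !coefC.
by case: i => [|i] /=; rewrite ?IHp ?exprS; ring.
Qed.

Section Interpolation.
Variables (F : fieldType) (F0 : char_zero F).

Lemma natr_inj0 : injective (fun n : nat => n%:R : F).
Proof.
suff H m n : (m < n)%N -> m%:R != n%:R :> F.
  move=> m n /= /eqP Emn; apply/eqP; move: Emn; apply: contraTT.
  by rewrite neq_ltn => /orP[/H//|/H]; rewrite eq_sym.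
move=> lt_mn; rewrite eq_sym -subr_eq0 -natrB ?(ltnW lt_mn) //.
by rewrite -(prednK (n := n - m)) ?subn_gt0.
Qed.

Lemma poly_eq_samples (N : nat) (p q : {poly F}) : (size p <= N)%N -> (size q <= N)%N ->
  (forall j, (j < N)%N -> p.[j.+1%:R] = q.[j.+1%:R]) -> p = q.
Proof.
move=> szp szq Hpq; apply/eqP; rewrite -subr_eq0; apply/negPn/negP => nz.
have /(max_poly_roots nz) : all (root (p - q)) [seq j.+1%:R | j <- iota 0 N].
  apply/allP => x /mapP[j]; rewrite mem_iota add0n => /= ltj ->.
  by rewrite rootE !hornerE Hpq // subrr.
rewrite map_inj_uniq ?iota_uniq; last by move=> i j /natr_inj0[].
rewrite size_map size_iota => /(_ isT); apply/negP; rewrite -leqNgt.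
by rewrite (leq_trans (size_polyD _ _)) // geq_max szp size_polyN.
Qed.

Lemma poly_eq_nonzero (p q : {poly F}) :
  (forall s, s != 0 -> p.[s] = q.[s]) -> p = q.
Proof.
move=> Hpq; apply: (@poly_eq_samples (maxn (size p) (size q))) => [||j _].
- exact: leq_maxl.
- exact: leq_maxr.
- by apply: Hpq; apply: F0.
Qed.

Definition lagr N (j : 'I_N) : {poly F} :=
  \prod_(i < N | i != j) ((j.+1%:R - i.+1%:R)^-1 *: ('X - i.+1%:R%:P)).

Lemma size_lagr N (j : 'I_N) : (size (lagr j) <= N)%N.
Proof.
rewrite /lagr scaler_prod; apply: leq_trans (size_scale_leq _ _) _.
rewrite -(big_filter _ (fun i : 'I_N => i != j)).
rewrite size_prod_XsubC size_filter.
rewrite -sum1_count sum1_card.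
have := cardC1 j; rewrite card_ord => ->.
by rewrite prednK // (leq_ltn_trans (leq0n j)).
Qed.

Lemma lagr_val N (i j : 'I_N) : (lagr j).[i.+1%:R] = (i == j)%:R.
Proof.
rewrite /lagr horner_prod; case: (eqVneq i j) => [->|neq_ij].
  rewrite big1 // => k nkj; rewrite !hornerE mulVf // subr_eq0.
  by apply: contra nkj => /eqP/natr_inj0[] /val_inj ->.
by rewrite (bigD1 i) //= !hornerE subrr mulr0 mul0r.
Qed.

Lemma interpolate N (m : nat -> F) (p : {poly F}) : (size p <= N)%N ->
  (forall j, (j < N)%N -> p.[j.+1%:R] = m j) ->
  p = \sum_(j < N) m j *: lagr j.
Proof.
move=> szp Hp; apply: (@poly_eq_samples N) => // [|i ltiN].
  apply: (leq_trans (size_sum _ _ _)); apply/bigmax_leqP => j _.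
  by apply: leq_trans (size_scale_leq _ _) (size_lagr j).
rewrite Hp // horner_sum (bigD1 (Ordinal ltiN)) //= big1 ?addr0 => [|j nj].
  by rewrite hornerZ (lagr_val (Ordinal ltiN)) eqxx mulr1.
by rewrite hornerZ (lagr_val (Ordinal ltiN)) eq_sym (negPf nj) mulr0.
Qed.
End Interpolation.

(** Lagrange interpolation at the points 1, 2, ..., which lie in F. *)
Lemma poly_descent (F E : fieldType) (f : {rmorphism F -> E}) (F0 : char_zero F) (p : {poly E}) :
  (forall s, exists m, p.[f s] = f m) -> exists q, map_poly f q = p.
Proof.
move=> /choice[g Hg].
have E0 : char_zero E by move=> n; rewrite -(rmorph_nat f) fmorph_eq0.
pose N := size p; exists (\sum_(j < N) g j.+1%:R *: lagr F j).
have -> : p = \sum_(j < N) (fun j => f (g j.+1%:R)) j *: lagr E j.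
  by apply: (@interpolate _ E0 N (fun j => f (g j.+1%:R)) p) => // j _; rewrite -Hg rmorph_nat.
rewrite rmorph_sum; apply: eq_bigr => j _; rewrite /= map_polyZ; congr (_ *: _).
rewrite rmorph_prod; apply: eq_bigr => i _.
by rewrite /= map_polyZ map_polyXsubC fmorphV rmorphB /= !rmorph_nat.
Qed.

Section Forms.
Variables (F : fieldType) (F0 : char_zero F).

(** Polynomial functions on a vector space are described without coordinates: they
are the functions that restrict to a polynomial on each polynomially
parametrized curve.  This makes composition with linear and quadratic maps
immediate, and the values of a function are easier to control than the
coefficients of a multivariate polynomial. *)
Definition pcurve (V : lmodType F) (g : F -> V) :=
  exists m (v : nat -> V), forall s, g s = \sum_(i < m) s ^+ i *: v i.

Definition pfun (V : lmodType F) (G : V -> F) :=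
  forall g, pcurve g -> exists p : {poly F}, forall s, G (g s) = p.[s].

Definition pform d (V : lmodType F) (G : V -> F) :=
  (forall s v, G (s *: v) = s ^+ d * G v) /\ pfun G.

Section Curves.
Variable V : lmodType F.
Implicit Types g h : F -> V.

Lemma pcurve_const v : pcurve (fun _ => v : V).
Proof. by exists 1%N, (fun _ => v) => s; rewrite big_ord1 expr0 scale1r. Qed.

Lemma pcurveD g h : pcurve g -> pcurve h -> pcurve (fun s => g s + h s).
Proof.
move=> [m [v Hv]] [n [w Hw]].
exists (maxn m n), (fun i => (if (i < m)%N then v i else 0) + (if (i < n)%N then w i else 0)) => s.
rewrite Hv Hw; under [RHS]eq_bigr => i _ do rewrite scalerDr.
rewrite big_split /=; congr (_ + _).
  rewrite (big_ord_widen (maxn m n) (fun i => s ^+ i *: v i)) ?leq_maxl // big_mkcond /=.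
  by apply: eq_bigr => i _; case: ifP => // _; rewrite scaler0.
rewrite (big_ord_widen (maxn m n) (fun i => s ^+ i *: w i)) ?leq_maxr // big_mkcond /=.
by apply: eq_bigr => i _; case: ifP => // _; rewrite scaler0.
Qed.

Lemma pcurveZX n g : pcurve g -> pcurve (fun s => s ^+ n *: g s).
Proof.
move=> [m [v Hv]]; exists (n + m)%N, (fun i => if (i < n)%N then 0 else v (i - n)%N) => s.
rewrite Hv [RHS]big_split_ord /= [X in _ = X + _]big1 ?add0r => [|i _].
  rewrite scaler_sumr; apply: eq_bigr => i _.
  by rewrite scalerA -exprD ltnNge leq_addr /= addKn.
by rewrite ltn_ord scaler0.
Qed.

Lemma pcurveZ c g : pcurve g -> pcurve (fun s => c *: g s).
Proof.
move=> [m [v Hv]]; exists m, (fun i => c *: v i) => s.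
by rewrite Hv scaler_sumr; apply: eq_bigr => i _; rewrite !scalerA mulrC.
Qed.

Lemma pcurve_sum n (h : nat -> F -> V) :
  (forall i, pcurve (h i)) -> pcurve (fun s => \sum_(i < n) h i s).
Proof.
move=> Hh; elim: n => [|n IHn].
  exists 0%N, (fun _ => 0) => s; by rewrite !big_ord0.
have [m [v Hv]] := pcurveD IHn (Hh n).
by exists m, v => s; rewrite big_ord_recr /= Hv.
Qed.

Lemma pcurve_poly (p : {poly F}) g : pcurve g -> pcurve (fun s => p.[s] *: g s).
Proof.
move=> Hg; have [m [v Hv]] := pcurve_sum (size p) (fun i => pcurveZ p`_i (pcurveZX i Hg)).
exists m, v => s; rewrite -Hv horner_coef scaler_suml.
by apply: eq_bigr => i _; rewrite scalerA.
Qed.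

Lemma pcurve_line u v : pcurve (fun s => u + s *: v : V).
Proof.
apply: pcurveD; first exact: pcurve_const.
by have [m [w Hw]] := pcurveZX 1 (pcurve_const v); exists m, w => s; rewrite -Hw expr1.
Qed.
End Curves.

Lemma pcurve_linear (V W : lmodType F) (f : {linear V -> W}) g :
  pcurve g -> pcurve (f \o g).
Proof.
move=> [m [v Hv]]; exists m, (f \o v) => s /=.
by rewrite Hv linear_sum; apply: eq_bigr => i _; rewrite linearZ.
Qed.

Section FormOps.
Variable V : lmodType F.
Implicit Types G H : V -> F.

Lemma pform_linear (f : {scalar V}) : pform 1 f.
Proof.
split=> [s v|g [m [v Hv]]]; first by rewrite linearZ.
exists (\sum_(i < m) f (v i) *: 'X^i) => s.
rewrite Hv linear_sum horner_sum; apply: eq_bigr => i _.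
by rewrite linearZ hornerZ hornerXn mulrC.
Qed.

Lemma pform_comp (W : lmodType F) (f : {linear W -> V}) d G :
  pform d G -> pform d (G \o f).
Proof.
move=> [hG pG]; split=> [s v|g Hg] /=; first by rewrite linearZ hG.
exact: pG (pcurve_linear f Hg).
Qed.

(** Homogeneity exchanges s with 1/s, and so u with v: the restriction of G to the
line is a polynomial of degree at most d, with coefficient G v in degree d. *)
Lemma pform_line d G u v : pform d G ->
  exists p : {poly F}, [/\ (size p <= d.+1)%N, forall s, G (u + s *: v) = p.[s],
     p`_0 = G u & p`_d = G v].
Proof.
move=> [hG pG].
have [p Hp] := pG _ (pcurve_line u v); have [q Hq] := pG _ (pcurve_line v u).
have Hpq s : s != 0 -> p.[s] = s ^+ d * q.[s^-1].
  move=> nz_s; rewrite -Hp -Hq -hG scalerDr scalerA divff // scale1r.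
  by rewrite [u + _]addrC.
pose N := size q.
have E : 'X^N * p = 'X^d * \sum_(i < N) q`_i *: 'X^(N - i).
  apply: poly_eq_nonzero => // s nz_s; rewrite !hornerM !hornerXn Hpq // mulrCA.
  congr (_ * _); rewrite horner_coef mulr_sumr horner_sum; apply: eq_bigr => i _.
  rewrite hornerZ hornerXn mulrCA; congr (_ * _).
  by rewrite exprVn -expfB_cond // (negPf nz_s) add0n ltnW.
have szp : (size p <= d.+1)%N.
  apply/leq_sizeP => j ltdj; have := congr1 (fun r : {poly F} => r`_(N + j)) E.
  rewrite coefXnM ltnNge leq_addr /= addKn => ->.
  rewrite coefXnM; case: ifP => // _; rewrite coef_sum big1 // => i _.
  rewrite coefZ coefXn [_ == _]gtn_eqF ?mulr0 //.
  by move: ltdj; clear; lia.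
exists p; split=> //.
  by rewrite -horner_coef0 -Hp scale0r addr0.
have := congr1 (fun r : {poly F} => r`_(N + d)) E.
rewrite coefXnM ltnNge leq_addr /= addKn => ->.
rewrite coefXnM ltnNge leq_addl /= addnK coef_sum.
rewrite -[v]addr0 -(scale0r u) Hq horner_coef; apply: eq_bigr => i _.
rewrite coefZ coefXn expr0n; congr (_ * _%:R); case: (nat_of_ord i) (ltn_ord i) => [|k] ltk.
  by rewrite subn0 eqxx.
by rewrite gtn_eqF //; move: ltk; clear; lia.
Qed.
End FormOps.

Lemma pform1_add (V : lmodType F) (G : V -> F) : pform 1 G -> forall u v, G (u + v) = G u + G v.
Proof.
move=> HG u v; have [p [szp Hp <- <-]] := pform_line u v HG.
rewrite -[v in LHS]scale1r Hp (horner_coef_wide _ szp) !big_ord_recl big_ord0.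
by rewrite /= expr0 mulr1 expr1n mulr1 addr0.
Qed.

(** The coefficients of G(u + s w) in s are, by interpolation, linear combinations
of the values G(u + j w), so they are polynomial functions of w. *)
Lemma pform_polar (V : lmodType F) d (G : V -> F) u : pform d G ->
  exists Q : nat -> V -> F, [/\ forall k, (k <= d)%N -> pform k (Q k),
    forall s w, G (u + s *: w) = \sum_(k < d.+1) s ^+ k * Q k w,
    forall w, Q 0%N w = G u & forall w, Q d w = G w].
Proof.
move=> HG; have [P HP] := choice (fun w => pform_line u w HG).
have HQ w k : (P w)`_k = \sum_(j < d.+1) G (u + j.+1%:R *: w) * (lagr F j)`_k.
  have [szp Hp _ _] := HP w.
  rewrite [P w](@interpolate _ F0 d.+1 (fun j => G (u + j.+1%:R *: w))) //.
  by rewrite coef_sum; apply: eq_bigr => j _; rewrite coefZ.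
exists (fun k w => (P w)`_k); split=> [k lekd|s w|w|w]; last 2 first.
- by case: (HP w).
- by case: (HP w).
- split=> [s v|g Hg].
    have [szp Hp _ _] := HP v; have [szq Hq _ _] := HP (s *: v).
    have -> : P (s *: v) = P v \Po (s *: 'X).
      apply: poly_eq_nonzero => // t _; rewrite -Hq horner_comp hornerZ hornerX -Hp.
      by rewrite scalerA mulrC.
    exact: coef_comp_polyZX.
  have Hj (j : nat) : exists p : {poly F}, forall s, G (u + j.+1%:R *: g s) = p.[s].
    by apply: HG.2; apply: pcurveD; [exact: pcurve_const | exact: pcurveZ].
  have [p Hp] := choice Hj.
  exists (\sum_(j < d.+1) (lagr F j)`_k *: p j) => s; rewrite HQ horner_sum.
  by apply: eq_bigr => j _; rewrite hornerZ -Hp mulrC.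
have [szp Hp _ _] := HP w.
by rewrite Hp (horner_coef_wide _ szp); apply: eq_bigr => i _; rewrite mulrC.
Qed.
End Forms.

(** Used with a form over a closed field whose values at the rational points of a
twisted structure lie in the smaller field F. *)
Lemma pform_descent (F E : fieldType) (f : {rmorphism F -> E}) (F0 : char_zero F)
    m d (G : 'rV[F]_m -> F) (H : 'rV[E]_m -> E) :
  (forall t, f (G t) = H (map_mx f t)) -> pform d H -> pform d G.
Proof.
move=> GH [hH pH]; split=> [s v|g [n [v Hv]]].
  by apply: (fmorph_inj f); rewrite rmorphM rmorphXn !GH map_mxZ hH.
have Hg : pcurve (fun s : E => \sum_(i < n) s ^+ i *: map_mx f (v i)).
  by exists n, (fun i => map_mx f (v i)).
have [p Hp] := pH _ Hg.
have Es s : p.[f s] = f (G (g s)).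
  rewrite GH -Hp Hv; congr H; rewrite raddf_sum; apply: eq_bigr => i _.
  by rewrite /= map_mxZ rmorphXn.
have [q Hq] := poly_descent F0 (fun s => ex_intro _ _ (Es s)).
by exists q => s; apply: (fmorph_inj f); rewrite -Es -Hq horner_map.
Qed.

(** * Zeros of forms of low degree *)

Definition solvable_upto (F : fieldType) d :=
  forall p : {poly F}, (1 < size p <= d.+1)%N -> exists x, root p x.

Lemma solvable_upto_le (F : fieldType) d e : (d <= e)%N -> solvable_upto F e -> solvable_upto F d.
Proof. by move=> le_de He p /andP[p1 pd]; apply: He; rewrite p1 (leq_trans pd). Qed.

Section Zeros.
Variables (F : fieldType) (F0 : char_zero F) (V : vectType F).
Implicit Types (U W : {vspace V}) (G q c : V -> F).

Lemma vpick_ex U : (0 < \dim U)%N -> exists2 x, x \in U & x != 0.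
Proof.
by rewrite lt0n dimv_eq0 => nzU; exists (vpick U); [exact: memv_pick | rewrite vpick0].
Qed.

Lemma vline_compl U u : u != 0 -> u \in U ->
  \dim U = (\dim (U :\: <[u]>)%VS).+1 /\ (forall w, w \in (U :\: <[u]>)%VS -> w != 0 -> w \notin <[u]>%VS).
Proof.
move=> nzu uU; split.
  have := dimv_cap_compl U <[u]>%VS.
  have -> : (U :&: <[u]>)%VS = <[u]>%VS by apply/capv_idPr; rewrite -memvE.
  by rewrite dim_vline nzu add1n.
move=> w wU nzw; apply: contra nzw => wu.
by rewrite -memv0 -(capv_diff U <[u]>%VS) memv_cap wU.
Qed.

Lemma vline_indep (u w : V) a b : u != 0 -> w \notin <[u]>%VS -> a *: u + b *: w = 0 -> a = 0 /\ b = 0.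
Proof.
move=> nzu wu /eqP; rewrite addr_eq0 => /eqP E.
have b0 : b = 0.
  apply/eqP; apply: contraNT wu => nzb; apply/vlineP; exists (- (b^-1 * a)).
  by rewrite scaleNr -scalerA E scalerN opprK scalerA mulVf // scale1r.
split=> //; apply/eqP; move/eqP: E.
by rewrite b0 scale0r oppr0 scaler_eq0 (negPf nzu) orbF.
Qed.

Lemma dim_span2 (u w : V) : u != 0 -> w \notin <[u]>%VS -> \dim (<[u]> + <[w]>)%VS = 2.
Proof.
move=> nzu wu; have nzw : w != 0 by apply: contraNneq wu => ->; exact: mem0v.
rewrite dimv_disjoint_sum ?dim_vline ?nzu ?nzw //.
apply/eqP; rewrite -subv0; apply/subvP => x; rewrite memv_cap memv0.
case/andP => /vlineP[a ->] /vlineP[b E].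
have /(vline_indep nzu wu)[-> _] : a *: u + (- b) *: w = 0 by rewrite E scaleNr subrr.
by rewrite scale0r.
Qed.

Lemma span2_zero d G u w : pform d G -> (forall s, G (u + s *: w) = 0) -> G w = 0 ->
  forall x, x \in (<[u]> + <[w]>)%VS -> G x = 0.
Proof.
move=> [hG _] Gline Gw _ /memv_addP[_ /vlineP[a ->] [_ /vlineP[b ->] ->]].
have [->|nza] := eqVneq a 0; first by rewrite scale0r add0r hG Gw mulr0.
have -> : a *: u + b *: w = a *: (u + (b / a) *: w).
  by rewrite scalerDr scalerA mulrCA divff // mulr1.
by rewrite hG Gline mulr0.
Qed.

(** On a line through two independent vectors, a form of degree d is a binary form:
its zero is a root of a polynomial of degree at most d, or the point at infinity. *)
Lemma form_zero d G U : solvable_upto F d -> (0 < d)%N -> pform d G -> (2 <= \dim U)%N ->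
  exists x, [/\ x \in U, x != 0 & G x = 0].
Proof.
move=> Fd d_gt0 HG dimU; have [u uU nzu] := vpick_ex (ltnW dimU).
have [EU Hind] := vline_compl nzu uU.
have [w wU nzw] : exists2 w, w \in (U :\: <[u]>)%VS & w != 0.
  by apply: vpick_ex; rewrite -ltnS -EU.
have wu := Hind w wU nzw; have {}wU : w \in U by apply: subvP wU; exact: diffvSl.
have [p [szp Hp p0 pd]] := pform_line F0 u w HG.
have [p1|p_gt1] := leqP (size p) 1.
  by exists w; split=> //; rewrite -pd nth_default // (leq_trans p1).
have [s ps] : exists s, root p s by apply: Fd; rewrite p_gt1.
exists (u + s *: w); split; first by rewrite rpredD ?rpredZ.
  apply/eqP => E; have := @vline_indep u w 1 s nzu wu.
  by rewrite scale1r => /(_ E)[/eqP]; rewrite oner_eq0.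
by rewrite Hp; apply/rootP.
Qed.

Lemma form1_kernel G U : pform 1 G ->
  exists W, [/\ (W <= U)%VS, (\dim U <= (\dim W).+1)%N & forall x, x \in W -> G x = 0].
Proof.
move=> HG; have Glin : linear (G : V -> F^o).
  by move=> a u v; rewrite (pform1_add F0 HG) HG.1 expr1.
pose g : {linear V -> F^o} := HB.pack G (GRing.isLinear.Build F V F^o *:%R G Glin).
pose h : 'Hom(V, F^o) := linfun g.
exists (U :&: lker h)%VS; split; first exact: capvSl.
  rewrite -(limg_ker_dim h U) -addn1 leq_add2l.
  apply: leq_trans (dimvS (subvf _)) _; by rewrite dimvf.
by move=> x; rewrite memv_cap memv_ker lfunE => /andP[_ /eqP].
Qed.

Lemma pform2_polar q u : pform 2 q -> exists B,
  pform 1 B /\ forall s w, q (u + s *: w) = q u + s * B w + s ^+ 2 * q w.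
Proof.
move=> Hq; have [Q [HQ Qline Q0 Q2]] := pform_polar F0 u Hq.
exists (Q 1%N); split; first exact: HQ.
move=> s w; rewrite Qline !big_ord_recl big_ord0 /= Q0 addr0 expr0 mul1r expr1 addrA.
by rewrite -(Q2 w).
Qed.

(** A zero e of q, then a zero of q in the space orthogonal to e. *)
Lemma quadric_line q U : solvable_upto F 2 -> pform 2 q -> (5 <= \dim U)%N ->
  exists W, [/\ (W <= U)%VS, \dim W = 2 & forall x, x \in W -> q x = 0].
Proof.
move=> F2 Hq dimU; have [e [eU nze qe]] := form_zero F2 isT Hq (leq_trans (isT : 2 <= 5)%N dimU).
have [B [HB Bq]] := pform2_polar e Hq.
have [U1 [sU1 dU1 BU1]] := form1_kernel U HB.
pose U2 := (U1 :\: <[e]>)%VS.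
have dU2 : (2 <= \dim U2)%N.
  have := dimv_cap_compl U1 <[e]>%VS; have := dimvS (capvSr U1 <[e]>%VS).
  rewrite dim_vline nze -/U2; move: dU1 dimU; clear; lia.
have [w [wU2 nzw qw]] := form_zero F2 isT Hq dU2.
have wU1 : w \in U1 by apply: subvP wU2; exact: diffvSl.
have we : w \notin <[e]>%VS.
  apply: contra nzw => we; by rewrite -memv0 -(capv_diff U1 <[e]>%VS) memv_cap wU2.
exists (<[e]> + <[w]>)%VS; split; last 2 first.
- exact: dim_span2.
- by apply: (span2_zero Hq) => // s; rewrite Bq qe qw BU1 // !mulr0 !addr0.
by rewrite subv_add -!memvE eU (subvP sU1).
Qed.

Lemma quadric_cubic q c U : solvable_upto F 3 -> pform 2 q -> pform 3 c -> (5 <= \dim U)%N ->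
  exists x, [/\ x \in U, x != 0, q x = 0 & c x = 0].
Proof.
move=> F3 Hq Hc dimU; have [W [sW dW qW]] := quadric_line (solvable_upto_le (isT : 2 <= 3)%N F3) Hq dimU.
have [|x [xW nzx cx]] := form_zero (U := W) F3 isT Hc; first by rewrite dW.
by exists x; split=> //; [apply: (subvP sW) | apply: qW].
Qed.

(** Projection of the conic from one of its points e parametrizes it by binary forms
of degree 2, in which the cubic becomes a binary form of degree 6.  When the
parametrization degenerates, the conic contains a line through e. *)
Lemma conic_cubic q c U : solvable_upto F 6 -> pform 2 q -> pform 3 c -> (3 <= \dim U)%N ->
  exists x, [/\ x \in U, x != 0, q x = 0 & c x = 0].
Proof.
move=> F6 Hq Hc dimU.
have F2 := solvable_upto_le (isT : 2 <= 6)%N F6; have F3 := solvable_upto_le (isT : 3 <= 6)%N F6.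
have [e [eU nze qe]] := form_zero F2 isT Hq (ltnW dimU).
have [B [HB Bq]] := pform2_polar e Hq.
have [EU Hind] := vline_compl nze eU.
pose P w := - q w *: e + B w *: w.
have HP : pform 6 (c \o P).
  split=> [s w|g Hg] /=.
    have -> : P (s *: w) = (s ^+ 2) *: P w.
      rewrite /P Hq.1 HB.1 expr1 scalerDr !scalerA mulrN; congr (_ + _ *: w).
      by rewrite -mulrA [B w * s]mulrC mulrA expr2.
    by rewrite Hc.1 -exprM.
  have [p1 Hp1] := Hq.2 g Hg; have [p2 Hp2] := HB.2 g Hg.
  have [m [v Hv]] := pcurveD (pcurve_poly (- p1) (pcurve_const e)) (pcurve_poly p2 Hg).
  have [p Hp] := Hc.2 _ (ex_intro _ m (ex_intro _ v Hv)).
  by exists p => s; rewrite -Hp /P Hp1 Hp2 hornerN.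
have [|w [wW nzw cw]] := form_zero (U := (U :\: <[e]>)%VS) F6 isT HP; first by rewrite -ltnS -EU.
have we := Hind w wW nzw; have wU : w \in U by apply: subvP wW; exact: diffvSl.
have [Pw0|nzPw] := eqVneq (P w) 0; last first.
  exists (P w); split=> //; first by rewrite rpredD ?rpredZ.
  have [qw0|nzqw] := eqVneq (q w) 0.
    by rewrite /P qw0 oppr0 scale0r add0r Hq.1 qw0 mulr0.
  have -> : P w = - q w *: (e + (- (B w / q w)) *: w).
    by rewrite /P scalerDr scalerA mulrNN mulrCA divff // mulr1.
  rewrite Hq.1 Bq qe; apply/eqP; rewrite mulf_eq0; apply/orP; right; apply/eqP.
  by field.
have [/eqP q0 B0] := vline_indep nze we Pw0; rewrite oppr_eq0 in q0; move/eqP in q0.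
have [|x [xW nzx cx]] := form_zero (U := (<[e]> + <[w]>)%VS) F3 isT Hc; first by rewrite dim_span2.
exists x; split=> //.
  by apply: subvP xW; rewrite subv_add -!memvE eU.
by apply: (span2_zero Hq) xW => // s; rewrite Bq qe q0 B0 !mulr0 !addr0.
Qed.

(** At a zero e of c, the restriction of c to the line through e in direction w has
as its coefficients a linear form, a quadratic form and c itself at w; these
three have a common zero independent of e. *)
Lemma cubic_line c U : solvable_upto F 6 -> pform 3 c -> (5 <= \dim U)%N ->
  exists W, [/\ (W <= U)%VS, \dim W = 2 & forall x, x \in W -> c x = 0].
Proof.
move=> F6 Hc dimU; have F3 := solvable_upto_le (isT : 3 <= 6)%N F6.
have [e [eU nze ce]] := form_zero F3 isT Hc (leq_trans (isT : 2 <= 5)%N dimU).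
have [Q [HQ Qline Q0 Q3]] := pform_polar F0 e Hc.
have [U1 [sU1 dU1 BU1]] := form1_kernel U (HQ 1%N isT).
pose U2 := (U1 :\: <[e]>)%VS.
have dU2 : (3 <= \dim U2)%N.
  have := dimv_cap_compl U1 <[e]>%VS; have := dimvS (capvSr U1 <[e]>%VS).
  rewrite dim_vline nze -/U2; move: dU1 dimU; clear; lia.
have [w [wU2 nzw qw cw]] := conic_cubic F6 (HQ 2%N isT) Hc dU2.
have wU1 : w \in U1 by apply: subvP wU2; exact: diffvSl.
have we : w \notin <[e]>%VS.
  apply: contra nzw => we; by rewrite -memv0 -(capv_diff U1 <[e]>%VS) memv_cap wU2.
exists (<[e]> + <[w]>)%VS; split; last 2 first.
- exact: dim_span2.
- apply: (span2_zero Hc) => // s; rewrite Qline; apply: big1 => -[k ltk] _ /=.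
  by case: k ltk => [|[|[|[|//]]]] _; rewrite ?Q0 ?Q3 ?ce ?cw ?qw ?BU1 // mulr0.
by rewrite subv_add -!memvE eU (subvP sU1).
Qed.

Lemma cubic_quintic c f U : solvable_upto F 6 -> pform 3 c -> pform 5 f -> (5 <= \dim U)%N ->
  exists x, [/\ x \in U, x != 0, c x = 0 & f x = 0].
Proof.
move=> F6 Hc Hf dimU; have [W [sW dW cW]] := cubic_line F6 Hc dimU.
have [|x [xW nzx fx]] := form_zero (U := W) (solvable_upto_le (isT : 5 <= 6)%N F6) isT Hf; first by rewrite dW.
by exists x; split=> //; [apply: (subvP sW) | apply: cW].
Qed.
End Zeros.

(** * Solving equations of degree at most six *)

Section CharPolyForms.
Variables (F : fieldType) (V : lmodType F).

Lemma char_polyZ n (B : 'M[F]_n) a k : (k <= n)%N ->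
  (char_poly (a *: B))`_(n - k) = a ^+ k * (char_poly B)`_(n - k).
Proof.
move=> lekn; have [->|nza] := eqVneq a 0.
  have -> : char_poly (0 *: B) = 'X^n by rewrite scale0r /char_poly /char_poly_mx map_mx0 subr0 det_scalar.
  rewrite coefXn expr0n; case: k lekn => [_|k ltkn] /=.
    have /monicP := char_poly_monic B; rewrite /lead_coef size_char_poly /= subn0 eqxx => ->.
    by rewrite mulr1.
  by rewrite mul0r ltn_eqF // -subn_gt0 subKn // ltnW.
have -> : char_poly (a *: B) = a ^+ n *: (char_poly B \Po (a^-1 *: 'X)).
  rewrite /char_poly -(det_map_mx (comp_poly (a^-1 *: 'X))) -mul_polyC rmorphXn -detZ; congr (\det _).
  apply/matrixP => i j; rewrite !mxE rmorphB /= comp_polyC mulrBr -polyCM; congr (_ - _).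
  case: (i == j); rewrite ?mulr0n ?comp_poly0 ?mulr0 // !mulr1n comp_polyX mul_polyC scalerA mulfV //.
  by rewrite scale1r.
rewrite coefZ coef_comp_polyZX mulrA; congr (_ * _).
by rewrite -{1}(subnKC lekn) exprD exprVn mulfK // expf_neq0.
Qed.

(** On a polynomial curve the characteristic polynomial is that of a matrix over F[X],
specialized.  Homogeneity is that of [char_polyZ]. *)
Lemma char_poly_form n (A : V -> 'M[F]_n) k : (forall i j, pform 1 (fun v => A v i j)) -> (k <= n)%N ->
  pform k (fun v => (char_poly (A v))`_(n - k)).
Proof.
move=> HA lekn; split=> [s v|g Hg].
  have -> : A (s *: v) = s *: A v by apply/matrixP => i j; rewrite mxE (HA i j).1 expr1.
  exact: char_polyZ.
have /choice[p Hp] := fun ij : 'I_n * 'I_n => (HA ij.1 ij.2).2 g Hg.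
pose P : 'M_n := \matrix_(i, j) p (i, j); exists (char_poly P)`_(n - k) => s.
have -> : A (g s) = map_mx (horner_eval s) P.
  by apply/matrixP => i j; rewrite !mxE; exact: (Hp (i, j) s).
by rewrite -map_char_poly coef_map.
Qed.
End CharPolyForms.

Lemma pform_scalar (F : fieldType) (V : lmodType F) (f : V -> F) :
  (forall a u v, f (a *: u + v) = a * f u + f v) -> pform 1 f.
Proof.
move=> Hf; pose g : {scalar V} := HB.pack f (GRing.isLinear.Build F V F *%R f Hf).
exact: (pform_linear g).
Qed.

Section Tschirnhaus.
Variables (F : fieldType) (F0 : char_zero F).
Hypothesis quad : forall b c : F, exists x, x ^+ 2 + b * x + c = 0.
Hypothesis trinomial : forall n (a b c : F), exists x, x ^+ n.+3 + a * x ^+ 2 + b * x + c = 0.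

Lemma companion_ex (p : {poly F}) m : p \is monic -> size p = m.+1 ->
  exists C : 'M[F]_m, char_poly C = p.
Proof.
move=> mon_p szp; have -> : m = (size p).-1 by rewrite szp.
by exists (companionmx p); rewrite companionmxK.
Qed.

Lemma tail_root n (A : 'M[F]_n.+3) :
  (forall i, (2 < i < n.+3)%N -> (char_poly A)`_i = 0) -> exists x, root (char_poly A) x.
Proof.
move=> HA; set p := char_poly A in HA *.
have [x Hx] := trinomial n p`_2 p`_1 p`_0; exists x.
have szp : size p = n.+4 := size_char_poly A.
have pn : p`_n.+3 = 1 by have /monicP := char_poly_monic A; rewrite /lead_coef -/p szp.
apply/rootP; rewrite horner_coef szp big_ord_recr /= pn mul1r.
rewrite 3!big_ord_recl big1 => [|i _].
  rewrite /= /bump !add1n /= -[RHS]Hx; ring.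
by rewrite HA ?mul0r //= /bump /=; move: (ltn_ord i); clear; lia.
Qed.

(** If C is the companion matrix of p, the characteristic polynomial of t(C), for a
polynomial t of degree less than deg p, has for roots the values of t at the roots
of p; its coefficients are forms in t.  Choosing t so that those of X^(deg p - k)
vanish for 0 < k <= n makes it X^(n+3) + a X^2 + b X + c, which has a root mu;
then t - mu and p have a common factor, of smaller degree than p.  The forms to
annihilate have degrees 1, ..., n with n at most 3. *)
Lemma tschirnhaus_step n (p : {poly F}) : p \is monic -> size p = n.+4 ->
  solvable_upto F n.+2 -> (n <= 3)%N -> (0 < n)%N -> exists x, root p x.
Proof.
move=> mon_p szp IH le_n n_gt0.
have [C DC] := companion_ex mon_p szp.
pose A (t : 'rV[F]_n.+3) := horner_mx C (rVpoly t).
have HA i j : pform 1 (fun t => A t i j).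
  apply: pform_scalar => a u v.
  by rewrite /A !horner_rVpoly mulmxDl -scalemxAl linearP; rewrite [LHS]mxE [X in X + _]mxE.
have E k : (k <= n.+3)%N -> pform k (fun t => (char_poly (A t))`_(n.+3 - k)).
  exact: char_poly_form HA.
(* Linear, quadratic and cubic forms in n + 3 variables: on the hyperplane where
   the trace vanishes there remain n + 2 variables, that is 5 when n = 3. *)
have [t nzt Ht] : exists2 t, t != 0 & forall k, (0 < k <= n)%N -> (char_poly (A t))`_(n.+3 - k) = 0.
  have [U1 [sU1 dU1 HU1]] := form1_kernel F0 (fullv : {vspace 'rV[F]_n.+3}) (E 1%N isT).
  rewrite dimvf /dim /= mul1n in dU1.
  have [n1|n_gt1] := leqP n 1.
    have [|t tU nzt] := @vpick_ex _ _ U1; first by move: dU1; clear; lia.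
    exists t => // k /andP[k_gt0 lek]; have -> : k = 1%N by move: k_gt0 lek n1; clear; lia.
    exact: HU1.
  have [n2|n_gt2] := leqP n 2.
    have [|t [tU nzt t2]] := form_zero F0 (U := U1) (solvable_upto_le (isT : 2 <= n.+2)%N IH) isT (E 2%N isT).
      by move: dU1 n_gt1; clear; lia.
    exists t => // k /andP[k_gt0 lek]; have [k1|k_gt1] := leqP k 1.
      have -> : k = 1%N by move: k_gt0 k1; clear; lia.
      exact: HU1.
    by have -> : k = 2%N by move: k_gt1 lek n2; clear; lia.
  have [|t [tU nzt t2 t3]] := quadric_cubic F0 (U := U1) (solvable_upto_le (n_gt0 : 3 <= n.+2)%N IH) (E 2%N isT) (E 3%N isT).
    by move: dU1 n_gt2; clear; lia.
  exists t => // k /andP[k_gt0 lek]; have [k1|k_gt1] := leqP k 1.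
    have -> : k = 1%N by move: k_gt0 k1; clear; lia.
    exact: HU1.
  have [k2|k_gt2] := leqP k 2; first by have -> : k = 2%N by move: k_gt1 k2; clear; lia.
  by have -> : k = 3%N by move: k_gt2 lek le_n; clear; lia.
have [mu Hmu] : exists mu, root (char_poly (A t)) mu.
  apply: tail_root => i /andP[i2 iN]; rewrite -(subKn (ltnW iN)) Ht //.
  by move: i2 iN; clear; lia.
pose q := rVpoly t - mu%:P.
have nzq : q != 0.
  (* If t were the constant mu, the trace of t(C) would be (n + 3) mu, so mu = 0. *)
  apply: contraNneq nzt => /eqP; rewrite subr_eq0 => /eqP Dt.
  have At : A t = mu%:M by rewrite /A Dt horner_mx_C.
  have := Ht 1%N n_gt0; rewrite subn1 char_poly_trace // At mxtrace_scalar.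
  move/eqP; rewrite oppr_eq0 -mulr_natl mulf_eq0 (negPf (F0 _)) /= => /eqP mu0.
  by rewrite -[t]rVpolyK Dt mu0 linear0.
have Aq : q != 0 /\ ~~ coprimep p q.
  split=> //; apply/negP => /Bezout_eq1_coprimepP[[u v] /= Euv].
  have := congr1 (horner_mx C) Euv; rewrite rmorphD !rmorphM rmorph1 /=.
  have -> : horner_mx C p = 0 by rewrite -DC Cayley_Hamilton.
  rewrite mulr0 add0r rmorphB /= horner_mx_C => Ev.
  have : eigenvalue (A t) mu by rewrite eigenvalue_root_char.
  case/eigenvalueP => w /eqP Ew; apply/negP; rewrite negbK -[w]mulmx1 -[1%:M]/1 -Ev.
  have Dq : A t - mu%:M = horner_mx C q by rewrite rmorphB /= horner_mx_C.
  have Dcomm : horner_mx C v * (A t - mu%:M) = (A t - mu%:M) * horner_mx C v.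
    by rewrite Dq -!rmorphM mulrC.
  by rewrite Dcomm -[_ * _]/(_ *m _) mulmxA mulmxBr (eqP Ew) mul_mx_scalar subrr mul0mx.
have [_ ncop] := Aq.
have szq : (size q <= n.+3)%N.
  rewrite (leq_trans (size_polyD _ _)) // geq_max size_poly size_polyN.
  by rewrite (leq_trans (size_polyC_leq1 _)).
have [|x Hx] := IH (gcdp p q).
  apply/andP; split; last exact: leq_trans (leq_gcdpr _ nzq) szq.
  have nzg : gcdp p q != 0 by rewrite gcdp_eq0 (negPf nzq) andbF.
  by rewrite ltn_neqAle lt0n size_poly_eq0 nzg andbT eq_sym.
by exists x; apply: root_dvdp Hx; rewrite dvdp_gcdl.
Qed.

Lemma solvable_upto6 : solvable_upto F 6.
Proof.
suff H d : (d <= 6)%N -> solvable_upto F d by apply: H.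
elim: d => [|d IHd] led p /andP[p1 pd].
  by move: p1 pd; clear; lia.
have [pd1|pd1] := leqP (size p) d.+1; first by apply: (IHd (ltnW led)); rewrite p1.
have {pd1}szp : size p = d.+2 by apply/eqP; rewrite eqn_leq pd.
have nzp : p != 0 by rewrite -size_poly_eq0 szp.
pose q := (lead_coef p)^-1 *: p.
have nzl : (lead_coef p)^-1 != 0 by rewrite invr_eq0 lead_coef_eq0.
suff [x Hx] : exists x, root q x by exists x; rewrite -(rootZ _ _ nzl).
have mon_q : q \is monic by rewrite monicE lead_coefZ mulVf // lead_coef_eq0.
have szq : size q = d.+2 by rewrite size_scale.
have qd : q`_d.+1 = 1 by move/monicP: mon_q; rewrite /lead_coef szq.
case: d led IHd szq qd {szp p1 pd} => [|[|[|d]]] led IHd szq qd.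
- exists (- q`_0); apply/rootP; rewrite horner_coef szq !big_ord_recl big_ord0.
  by rewrite /= /bump !add1n /= qd; ring.
- have [x Hx] := quad q`_1 q`_0; exists x.
  apply/rootP; rewrite horner_coef szq !big_ord_recl big_ord0 -[RHS]Hx.
  by rewrite /= /bump !add1n /= qd; ring.
- have [x Hx] := trinomial 0 q`_2 q`_1 q`_0; exists x.
  apply/rootP; rewrite horner_coef szq !big_ord_recl big_ord0 -[RHS]Hx.
  by rewrite /= /bump !add1n /= qd; ring.
apply: (tschirnhaus_step mon_q szq) => //.
by apply: IHd; exact: ltnW.
Qed.
End Tschirnhaus.

(** * Algebraic dependence and the field closed under functions of two variables *)

Section Closure.
Variables (E : fieldType) (k0 : E -> Prop) (Hk0 : subfieldP k0).
Implicit Types A B : E -> Prop.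

Record relclosed (F : E -> Prop) : Prop := RelClosed {
  relc_sub : subfieldP F;
  relc_base : forall x, k0 x -> F x;
  relc_alg : forall y, algP F y -> F y }.

(** The relative algebraic closure of k0(A) in E. *)
Definition cl A (y : E) := forall F, relclosed F -> (forall x, A x -> F x) -> F y.

Lemma cl_gen A x : A x -> cl A x. Proof. by move=> Ax F HF; apply. Qed.

Lemma cl_closed A : relclosed (cl A).
Proof.
split.
- split=> [F HF _|x y Hx Hy F HF AF|x y Hx Hy F HF AF|x Hx F HF AF].
  + exact: subf1 (relc_sub HF).
  + by apply: (subfB (relc_sub HF)); [apply: Hx | apply: Hy].
  + by apply: (subfM (relc_sub HF)); [apply: Hx | apply: Hy].
  + by apply: (subfV (relc_sub HF)); apply: Hx.
- by move=> x kx F HF _; apply: (relc_base HF).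
- move=> y Hy F HF AF; apply: (relc_alg HF); apply: algP_sub Hy => x Hx.
  exact: Hx.
Qed.

Lemma cl_sub A B : (forall x, A x -> cl B x) -> forall y, cl A y -> cl B y.
Proof. by move=> AB y Ay; apply: Ay => //; apply: cl_closed. Qed.

(** The subfield k(a). *)
Definition adj (k : E -> Prop) (a x : E) := exists p q : {poly E},
  [/\ forall i, k p`_i, forall i, k q`_i, q.[a] != 0 & x = p.[a] / q.[a]].

Section Adj.
Variables (k : E -> Prop) (Hk : subfieldP k) (a : E).

Lemma coefs_mul (p q : {poly E}) : (forall i, k p`_i) -> (forall i, k q`_i) -> forall i, k (p * q)`_i.
Proof. by move=> kp kq i; rewrite coefM; apply: subf_sum => // j _; apply: (subfM Hk). Qed.

Lemma coefs_sub (p q : {poly E}) : (forall i, k p`_i) -> (forall i, k q`_i) -> forall i, k (p - q)`_i.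
Proof. by move=> kp kq i; rewrite coefB; apply: (subfB Hk). Qed.

Lemma coefs_C c : k c -> forall i, k c%:P`_i.
Proof. by move=> kc i; rewrite coefC; case: eqP => // _; exact: subf0. Qed.

Lemma coefs_X i : k 'X`_i. Proof. by rewrite coefX; apply: subf_nat. Qed.

Lemma adj_base x : k x -> adj k a x.
Proof.
move=> kx; exists x%:P, 1; split.
- exact: coefs_C.
- by move=> i; apply: (coefs_C (subf1 Hk)).
- by rewrite hornerC oner_eq0.
- by rewrite !hornerC divr1.
Qed.

Lemma adj_gen : adj k a a.
Proof.
exists 'X, 1; split.
- exact: coefs_X.
- by move=> i; apply: (coefs_C (subf1 Hk)).
- by rewrite hornerC oner_eq0.
- by rewrite hornerX hornerC divr1.
Qed.

Lemma adj_subfield : subfieldP (adj k a).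
Proof.
split.
- exact: adj_base (subf1 Hk).
- move=> _ _ [p [q [kp kq q0 ->]]] [r [s [kr ks s0 ->]]].
  exists (p * s - r * q), (q * s); split.
  + by apply: coefs_sub; apply: coefs_mul.
  + exact: coefs_mul.
  + by rewrite hornerM mulf_neq0.
  + by rewrite !hornerE; field; rewrite ?q0 ?s0.
- move=> _ _ [p [q [kp kq q0 ->]]] [r [s [kr ks s0 ->]]].
  exists (p * r), (q * s); split.
  + exact: coefs_mul.
  + exact: coefs_mul.
  + by rewrite hornerM mulf_neq0.
  + by rewrite !hornerM; field; rewrite ?q0 ?s0.
- move=> _ [p [q [kp kq q0 ->]]].
  have [p0|p0] := eqVneq p.[a] 0.
    by rewrite p0 mul0r invr0; exact: adj_base (subf0 Hk).
  by exists q, p; split=> //; rewrite invf_div.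
Qed.

Lemma adj_least S : subfieldP S -> (forall x, k x -> S x) -> S a -> forall x, adj k a x -> S x.
Proof.
move=> HS kS Sa _ [p [q [kp kq _ ->]]].
by apply: subf_div => //; apply: subf_horner => // i; apply: kS.
Qed.

Lemma adj_common_denom (f : nat -> E) n : (forall i, adj k a (f i)) ->
  exists D : {poly E}, [/\ forall i, k D`_i, D.[a] != 0 &
    forall i, (i < n)%N -> exists N : {poly E}, (forall j, k N`_j) /\ N.[a] = D.[a] * f i].
Proof.
move=> Hf; elim: n => [|n [D [kD nzD HD]]].
  by exists 1; split=> [i||//]; [exact: (coefs_C (subf1 Hk)) | rewrite hornerC oner_eq0].
have [p [q [kp kq nzq Efn]]] := Hf n.
exists (D * q); split=> [||i]; [exact: coefs_mul | by rewrite hornerM mulf_neq0|].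
rewrite ltnS leq_eqVlt => /orP[/eqP ->|/HD[N [kN EN]]].
  exists (D * p); split; first exact: coefs_mul.
  by rewrite !hornerM Efn; field.
exists (N * q); split; first exact: coefs_mul.
by rewrite !hornerM EN mulrAC.
Qed.
End Adj.

Lemma alg_adj_closed k a : subfieldP k -> (forall x, k0 x -> k x) -> relclosed (algP (adj k a)).
Proof.
move=> Hk sk; have Ha := adj_subfield Hk a; split.
- exact: algP_subfield.
- by move=> x /sk kx; apply: (algP_id Ha); exact: adj_base.
- by move=> y; exact: (algP_idem Ha).
Qed.

Definition add1 A a x := A x \/ x = a.

Lemma cl_add1 A a y : cl (add1 A a) y -> algP (adj (cl A) a) y.
Proof.
have [HS Hb _] := cl_closed A; have Ha := adj_subfield HS a.
apply; first by apply: alg_adj_closed.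
move=> x [Ax|->]; apply: (algP_id Ha); last exact: adj_gen.
by apply: (adj_base HS); exact: cl_gen.
Qed.

(** Clearing denominators in an equation of b over k(a) gives a polynomial relation
between a and b over k; read as an equation for a, it has coefficients in k(b),
and it is not identically zero unless b is algebraic over k. *)
Lemma alg_exchange k a b : relclosed k -> algP (adj k a) b -> ~ k b -> algP (adj k b) a.
Proof.
move=> Hk [p [nz_p kp pb]] nkb; have HS := relc_sub Hk.
have [D [kD nzD HD]] := adj_common_denom HS (size p) kp.
have Hi i : exists N : {poly E}, (forall j, k N`_j) /\ N.[a] = D.[a] * p`_i.
  have [/HD//|gei] := ltnP i (size p); exists 0; split=> [j|].
    by rewrite coef0; exact: subf0.
  by rewrite horner0 nth_default ?mulr0.
have [P HP] := choice Hi.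
pose R := \sum_(i < size p) b ^+ i *: P i.
have Ra : root R a.
  apply/rootP; rewrite /R horner_sum.
  rewrite (eq_bigr (fun i : 'I_(size p) => D.[a] * (p`_i * b ^+ i))) => [|i _].
    by rewrite -mulr_sumr -horner_coef (rootP pb) mulr0.
  by rewrite hornerZ (HP i).2; ring.
have kR j : adj k b R`_j.
  rewrite coef_sum; apply: (subf_sum (adj_subfield HS b)) => i _; rewrite coefZ.
  apply: (subfM (adj_subfield HS b)); last by apply/adj_base => //; exact: (HP i).1.
  by apply: (subfX (adj_subfield HS b)); exact: adj_gen.
have [R0|nzR] := eqVneq R 0; last by exists R.
case: nkb; apply: (relc_alg Hk).
have [i pi] : exists i : 'I_(size p), p`_i != 0.
  have szp : ((size p).-1 < size p)%N by rewrite prednK // lt0n size_poly_eq0.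
  by exists (Ordinal szp); rewrite /= -lead_coefE lead_coef_eq0.
have nzP : P i != 0.
  apply: contraNneq (mulf_neq0 nzD pi) => P0.
  by rewrite -(HP i).2 P0 horner0 eqxx.
pose j := (size (P i)).-1.
have Pij : (P i)`_j != 0 by rewrite -lead_coefE lead_coef_eq0.
exists (\poly_(i < size p) (P i)`_j); split.
- apply: contraNneq Pij => /(congr1 (fun q : {poly E} => q`_i)).
  by rewrite coef_poly ltn_ord coef0 => ->.
- move=> l; rewrite coef_poly; case: ifP => _; last exact: (subf0 HS).
  by case: (HP l) => kP _; apply: kP.
apply/rootP; rewrite horner_poly.
have := congr1 (fun q : {poly E} => q`_j) R0; rewrite coef0 coef_sum => ER.
by apply: etrans ER; apply: eq_bigr => l _; rewrite coefZ mulrC.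
Qed.

Lemma cl_exchange A a b : cl (add1 A a) b -> ~ cl A b -> cl (add1 A b) a.
Proof.
move=> /cl_add1 Hb nb; have := alg_exchange (cl_closed A) Hb nb.
have HB := cl_closed (add1 A b); move=> Ha; apply: (relc_alg HB).
apply: algP_sub Ha => x; apply: (adj_least (relc_sub HB)).
  by apply: cl_sub => y Ay; apply: cl_gen; left.
by apply: cl_gen; right.
Qed.

Definition none : E -> Prop := fun _ => False.
(** The relative algebraic closures of k0, k0(a) and k0(a, b). *)
Definition cl0 := cl none.
Definition cl1 a := cl (add1 none a).
Definition cl2 a b := cl (add1 (add1 none a) b).

Lemma cl0_sub A x : cl0 x -> cl A x. Proof. by apply: cl_sub. Qed.
Lemma cl1_least A a x : cl A a -> cl1 a x -> cl A x.
Proof. by move=> Aa; apply: cl_sub => y [//|->]. Qed.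
Lemma cl2_least A a b x : cl A a -> cl A b -> cl2 a b x -> cl A x.
Proof. by move=> Aa Ab; apply: cl_sub => y [[//|->]|->]. Qed.
Lemma cl1_gen a : cl1 a a. Proof. by apply: cl_gen; right. Qed.
Lemma cl2_l a b : cl2 a b a. Proof. by apply: cl_gen; left; right. Qed.
Lemma cl2_r a b : cl2 a b b. Proof. by apply: cl_gen; right. Qed.
Lemma cl2C a b x : cl2 a b x -> cl2 b a x.
Proof. by apply: cl2_least; [exact: cl2_r | exact: cl2_l]. Qed.
Lemma cl12 a b x : cl1 a x -> cl2 a b x.
Proof. by apply: cl1_least; exact: cl2_l. Qed.

(** A set of rank at most 2 has a basis of at most two elements taken in the set;
the value 0 completes a basis that is too short. *)
Lemma cl_rank2 A z1 z2 : (forall x, A x -> cl2 z1 z2 x) ->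
  exists a b, [/\ A a \/ a = 0, A b \/ b = 0 & forall x, cl A x -> cl2 a b x].
Proof.
move=> HA.
have [A0|/existsNP[a /not_implyP[Aa na]]] := pselect (forall x, A x -> cl0 x).
  exists 0, 0; split; [by right | by right | move=> x; apply: cl_sub => y /A0].
  exact: cl0_sub.
have [A1|/existsNP[b /not_implyP[Ab nb]]] := pselect (forall x, A x -> cl1 a x).
  exists a, 0; split; [by left | by right | move=> x; apply: cl_sub => y /A1].
  exact: cl12.
exists a, b; split; [by left | by left |].
suff [H1 H2] : cl2 a b z1 /\ cl2 a b z2.
  by move=> x; apply: cl_sub => y /HA; apply: cl2_least.
have [az1|naz1] := pselect (cl1 z1 a).
  have z1a : cl1 a z1 by exact: cl_exchange az1 na.
  have ba : cl2 a z2 b.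
    by apply: cl2_least (HA b Ab); [exact: cl12 | exact: cl2_r].
  by split; [exact: cl12 | exact: (cl_exchange ba nb)].
have z2a : cl2 z1 a z2 := cl_exchange (HA a Aa) naz1.
have ba : cl2 a z1 b.
  by apply: cl2C; apply: cl2_least (HA b Ab); [exact: cl2_l | exact: z2a].
have z1b : cl2 a b z1 := cl_exchange ba nb.
by split=> //; apply: cl2_least z2a => //; exact: cl2_l.
Qed.

Variables (K : E -> Prop) (HK : subfieldP K).

(** The closure of K under the field operations and under algebraic functions of two
elements. *)
Inductive hull : E -> Prop :=
| hull_base x : K x -> hull x
| hull_sub x y : hull x -> hull y -> hull (x - y)
| hull_mul x y : hull x -> hull y -> hull (x * y)
| hull_inv x : hull x -> hull x^-1
| hull_alg a b y : hull a -> hull b -> cl2 a b y -> hull y.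

Lemma hull_subfield : subfieldP hull.
Proof.
split; [exact: hull_base (subf1 HK) | exact: hull_sub | exact: hull_mul | exact: hull_inv].
Qed.

(** The way in which elements are shown to lie in the hull: they are algebraic over
elements of the hull, and all depend algebraically on two elements z1, z2, which
need not lie in the hull. *)
Lemma hull_rank2 A z1 z2 y : (forall x, A x -> hull x) -> (forall x, A x -> cl2 z1 z2 x) ->
  cl A y -> hull y.
Proof.
move=> AM /cl_rank2[a [b [Aa Ab H]]] /H; have M0 : hull 0 := subf0 hull_subfield.
by apply: hull_alg; [case: Aa => [/AM|->] | case: Ab => [/AM|->]].
Qed.

Local Notation M := (subf hull_subfield).
Local Notation v := (@subf_val E hull hull_subfield).

Hypotheses (Ecl : closedF E) (E0 : char_zero E).

Lemma hull_char0 : char_zero M.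
Proof. by move=> n; rewrite -(fmorph_eq0 v) rmorph_nat. Qed.

Lemma hull_root (p : {poly M}) a b : (1 < size p)%N -> hull a -> hull b ->
  (forall i, cl2 a b (v p`_i)) -> exists x, root p x.
Proof.
move=> p_gt1 Ma Mb clp; have [|y py] := Ecl (p := map_poly v p); first by rewrite size_map_poly.
have [x Dx] : exists x, v x = y.
  apply: subf_ex; apply: (hull_alg Ma Mb); apply: (relc_alg (cl_closed _)).
  exists (map_poly v p); split=> // [|i]; last by rewrite coef_map; exact: clp.
  by rewrite map_poly_eq0 -size_poly_eq0 -lt0n ltnW.
by exists x; move: py; rewrite -Dx fmorph_root.
Qed.

Lemma hull_trinomial n (a b c : M) (x y : E) : hull x -> hull y ->
  cl2 x y (v a) -> cl2 x y (v b) -> cl2 x y (v c) ->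
  exists t, t ^+ n.+3 + a * t ^+ 2 + b * t + c = 0.
Proof.
move=> Mx My Ha Hb Hc; have HS := relc_sub (cl_closed (add1 (add1 none x) y)).
pose r : {poly M} := a *: 'X^2 + b *: 'X + c%:P.
pose p : {poly M} := 'X^(n.+3) + r.
have szq : (size r < n.+4)%N.
  apply: (@leq_ltn_trans 3) => //; rewrite (leq_trans (size_polyD _ _)) // geq_max.
  rewrite (leq_trans (size_polyC_leq1 _)) // andbT (leq_trans (size_polyD _ _)) // geq_max.
  by rewrite !(leq_trans (size_scale_leq _ _)) ?size_polyXn ?size_polyX.
have szp : size p = n.+4 by rewrite size_polyDl size_polyXn.
have [|i|t pt] := @hull_root p x y _ Mx My; first by rewrite szp.
  rewrite /p /r !coefD !coefZ !coefXn coefX coefC !rmorphD !rmorphM /= !rmorph_nat.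
  have Hn m : cl2 x y m%:R by exact: subf_nat.
  apply: (subfD HS); first exact: Hn.
  apply: (subfD HS); last by case: (i == 0%N); rewrite ?rmorph0 //; exact: (Hn 0%N).
  by apply: (subfD HS); apply: (subfM HS) => //; exact: Hn.
by exists t; move/rootP: pt; rewrite /p /r !hornerD !hornerZ !hornerXn hornerX hornerC !addrA.
Qed.

(** In X^n + a X^2 + b X + c the substitution X = mu Y with mu = b/a makes the two
lower coefficients equal, which leaves two parameters. *)
Lemma hull_solvable : solvable_upto M 6.
Proof.
apply: (solvable_upto6 hull_char0) => [b c|n a b c].
  have Hb := subf_valP b; have Hc := subf_valP c.
  have [|||i|x Hx] := @hull_root ('X^2 + (b *: 'X + c%:P)) (v b) (v c).
  - rewrite size_polyDl size_polyXn // (leq_ltn_trans (size_polyD _ _)) // gtn_max.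
    rewrite (leq_ltn_trans (size_polyC_leq1 _)) // andbT.
    by rewrite (leq_ltn_trans (size_scale_leq _ _)) // size_polyX.
  - exact: Hb.
  - exact: Hc.
  - have HS := relc_sub (cl_closed (add1 (add1 none (v b)) (v c))).
    rewrite !coefD !coefZ coefXn coefX coefC !rmorphD !rmorphM /= !rmorph_nat.
    have Hn m : cl2 (v b) (v c) m%:R by exact: subf_nat.
    apply: (subfD HS); first exact: Hn.
    apply: (subfD HS); first by apply: (subfM HS); [exact: cl2_l | exact: Hn].
    by case: (i == 0%N); rewrite ?rmorph0; [exact: cl2_r | exact: (Hn 0%N)].
  by exists x; move/rootP: Hx; rewrite !hornerD hornerZ hornerXn hornerX hornerC addrA.
have Ma := subf_valP a; have Mb := subf_valP b; have Mc := subf_valP c.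
have cl00 x y : cl2 x y (v 0) by rewrite rmorph0; exact: subf0 (relc_sub (cl_closed _)).
have [->|nza] := eqVneq a 0.
  apply: (hull_trinomial n Mb Mc); [exact: cl00 | exact: cl2_l | exact: cl2_r].
have [->|nzb] := eqVneq b 0.
  apply: (hull_trinomial n Ma Mc); [exact: cl2_l | exact: cl00 | exact: cl2_r].
pose mu := b / a; pose s := a / mu ^+ n.+1; pose t := c / mu ^+ n.+3.
have nzmu : mu != 0 by rewrite mulf_neq0 ?invr_eq0.
have [|||y Hy] := @hull_trinomial n s s t (v s) (v t) (subf_valP s) (subf_valP t).
- exact: cl2_l.
- exact: cl2_l.
- exact: cl2_r.
exists (mu * y); rewrite -[RHS](mulr0 (mu ^+ n.+3)) -Hy /s /t.
have Eb : b = a * mu by rewrite /mu mulrCA mulfV ?mulr1.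
by rewrite {1}Eb exprMn !exprS; field; rewrite nzmu expf_neq0.
Qed.

Lemma hull_nthroot k (c : M) : (0 < k)%N -> exists x, x ^+ k = c.
Proof.
move=> k_gt0; have Hc := subf_valP c.
have HS := relc_sub (cl_closed (add1 (add1 none (v c)) (v c))).
have szp : size ('X^k - c%:P) = k.+1 by rewrite size_XnsubC.
have [|i|x] := @hull_root ('X^k - c%:P) (v c) (v c) _ Hc Hc; first by rewrite szp.
  rewrite coefB coefXn coefC rmorphB rmorph_nat; apply: (subfB HS); first exact: subf_nat.
  by case: (i == 0%N); [exact: cl2_l | rewrite rmorph0; exact: subf0].
by rewrite rootE hornerD hornerN hornerXn hornerC subr_eq0 => /eqP; exists x.
Qed.
End Closure.

(** * Polynomial functions over the constants, and their zeros *)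

Section NatFun.
Variable C : fieldType.

(** Polynomial functions with coefficients in C are represented by the functions
that they define on the points over all C-algebras, compatibly with morphisms
([natural]): a functor-of-points form of the polynomial ring. *)
Definition natfun n := forall (A : comNzRingType), {rmorphism C -> A} -> 'rV[A]_n -> A.

Definition natural n (f : natfun n) := forall (A B : comNzRingType)
  (phi : {rmorphism C -> A}) (psi : {rmorphism C -> B}) (h : {rmorphism A -> B}),
  (forall c, h (phi c) = psi c) -> forall x, f B psi (map_mx h x) = h (f A phi x).

Definition homog n (f : natfun n) d :=
  forall (A : comNzRingType) (phi : {rmorphism C -> A}) c x, f A phi (c *: x) = c ^+ d * f A phi x.

Lemma natural_horner n (f : natfun n) (A : comNzRingType) (phi : {rmorphism C -> A}) (P : 'rV[{poly A}]_n) s :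
  natural f -> (f _ (polyC \o phi : {rmorphism C -> _}) P).[s] = f A phi (map_mx (horner_eval s) P).
Proof.
move=> nf; rewrite (nf _ _ (polyC \o phi : {rmorphism C -> {poly A}}) phi (horner_eval s)) //.
by move=> c; exact: hornerC.
Qed.

Lemma natural_pform n (f : natfun n) d (F : fieldType) (phi : {rmorphism C -> F}) :
  natural f -> homog f d -> pform d (f F phi).
Proof.
move=> nf hf; split=> [s v|g [m [v Hv]]]; first exact: hf.
pose P : 'rV[{poly F}]_n := \sum_(i < m) 'X^i *: map_mx polyC (v i).
exists (f _ (polyC \o phi : {rmorphism C -> _}) P) => s.
rewrite natural_horner //; congr (f _ _ _); rewrite Hv /P raddf_sum; apply: eq_bigr => i _.
apply/rowP => j; rewrite !mxE /= /horner_eval hornerM hornerXn hornerC //.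
Qed.

Section Values.
Variables (E : fieldType) (iota : {rmorphism C -> E}).
Local Notation imC := (imC iota).

Lemma subf_lift F (HF : subfieldP F) : (forall x, imC x -> F x) ->
  exists h : {rmorphism C -> subf HF}, forall c, @subf_val E F HF (h c) = iota c.
Proof. by move=> sF; apply: lift_rmorph => c; apply: subf_ex; apply: sF; exists c. Qed.

Lemma map_mx_lift F (HF : subfieldP F) n (x : 'rV[E]_n) : (forall i, F (x 0 i)) ->
  exists y, map_mx (@subf_val E F HF) y = x.
Proof.
move=> Fx; have [g Hg] := choice (fun i => subf_ex HF (Fx i)).
by exists (\row_i g i); apply/rowP => i; rewrite !mxE.
Qed.

Lemma natural_sub n (f : natfun n) (F : E -> Prop) (x : 'rV[E]_n) :
  natural f -> subfieldP F -> (forall c, imC c -> F c) ->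
  (forall i, F (x 0 i)) -> F (f E iota x).
Proof.
move=> nf HF sF Fx; have [h Hh] := subf_lift HF sF; have [y <-] := map_mx_lift HF Fx.
by rewrite (nf _ _ h iota (@subf_val E F HF) Hh); apply: subf_valP.
Qed.

(** On a curve parametrized by polynomials over F, the function is a polynomial
with coefficients in F. *)
Lemma natural_line n (f : natfun n) F (P : E -> 'rV[E]_n) : natural f ->
  forall (HF : subfieldP F), (forall x, imC x -> F x) ->
  (exists p : 'rV[{poly subf HF}]_n, forall s, P s = map_mx (horner_eval s \o map_poly (@subf_val E F HF)) p) ->
  exists2 p : {poly E}, (forall i, F p`_i) & forall s, f E iota (P s) = p.[s].
Proof.
move=> nf HF sF [p HP]; have [h Hh] := subf_lift HF sF.
exists (map_poly (@subf_val E F HF) (f _ (polyC \o h : {rmorphism C -> _}) p)) => [i|s].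
  by rewrite coef_map; apply: subf_valP.
rewrite HP (nf _ _ (polyC \o h : {rmorphism C -> {poly subf HF}}) iota (horner_eval s \o map_poly (@subf_val E F HF))) //.
by move=> c; rewrite /= map_polyC /horner_eval hornerC /= Hh.
Qed.

Hypothesis C0 : char_zero C.
Local Notation cl0 := (cl0 imC).
Local Notation cl1 := (cl1 imC).
Local Notation cl2 := (cl2 imC).

Definition row3 (A : comNzRingType) (a b c : A) : 'rV[A]_3 := \row_i nth 0 [:: a; b; c] i.

Lemma map_row3 (A B : comNzRingType) (h : {rmorphism A -> B}) a b c :
  map_mx h (row3 a b c) = row3 (h a) (h b) (h c).
Proof. by apply/rowP => i; rewrite !mxE; case: i => [[|[|[|//]]] ?]. Qed.

(** A coordinate that is transcendental over F may be given any value. *)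
Lemma generic_var n (f : natfun n) F (P : E -> 'rV[E]_n) y : natural f -> relclosed imC F ->
  (forall HF : subfieldP F, exists p : 'rV[{poly subf HF}]_n, forall s, P s = map_mx (horner_eval s \o map_poly (@subf_val E F HF)) p) ->
  ~ F y -> f E iota (P y) = 0 -> forall s, f E iota (P s) = 0.
Proof.
move=> nf HF HP nFy fy s.
have [p Fp Hp] := natural_line nf (relc_base HF) (HP (relc_sub HF)).
have [p0|nzp] := eqVneq p 0; first by rewrite Hp p0 horner0.
by case: nFy; apply: (relc_alg HF); exists p; split=> //; apply/rootP; rewrite -Hp.
Qed.

(** A function that vanishes at algebraically independent values is zero: the
coordinates are specialized one after the other. *)
Lemma generic_point (f : natfun 3) y1 y2 y3 : natural f ->
  ~ cl0 y1 -> ~ cl1 y1 y2 -> ~ cl2 y1 y2 y3 -> f E iota (row3 y1 y2 y3) = 0 ->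
  forall a b c : C, f C idfun (row3 a b c) = 0.
Proof.
move=> nf n1 n2 n3 f0 a b c.
have Hconst F (HF : subfieldP F) x : F x -> exists p : {poly subf HF},
    forall s, (map_poly (@subf_val E F HF) p).[s] = x.
  by move=> /(subf_ex HF)[w <-]; exists w%:P => s; rewrite map_polyC hornerC.
have HX F (HF : subfieldP F) s : (map_poly (@subf_val E F HF) 'X).[s] = s.
  by rewrite map_polyX hornerX.
have cC F d : relclosed imC F -> F (iota d) by move=> HF; apply: (relc_base HF); exists d.
have f3 s : f E iota (row3 y1 y2 s) = 0.
  apply: (generic_var (P := fun s => row3 y1 y2 s) nf (cl_closed _ _) _ n3 f0) => HF.
  have [p1 H1] := Hconst _ HF _ (@cl2_l E imC y1 y2); have [p2 H2] := Hconst _ HF _ (@cl2_r E imC y1 y2).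
  exists (row3 p1 p2 'X) => t; rewrite map_row3 /= /horner_eval H1 H2 HX //.
have f2 s : f E iota (row3 y1 s (iota c)) = 0.
  apply: (generic_var (P := fun s => row3 y1 s (iota c)) nf (cl_closed _ _) _ n2 (f3 _)) => HF.
  have [p1 H1] := Hconst _ HF _ (@cl1_gen E imC y1); have [p2 H2] := Hconst _ HF _ (cC _ c (cl_closed _ _)).
  exists (row3 p1 'X p2) => t; rewrite map_row3 /= /horner_eval H1 H2 HX //.
have f1 s : f E iota (row3 s (iota b) (iota c)) = 0.
  apply: (generic_var (P := fun s => row3 s (iota b) (iota c)) nf (cl_closed _ _) _ n1 (f2 _)) => HF.
  have [p1 H1] := Hconst _ HF _ (cC _ b (cl_closed _ _)); have [p2 H2] := Hconst _ HF _ (cC _ c (cl_closed _ _)).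
  exists (row3 'X p1 p2) => t; rewrite map_row3 /= /horner_eval H1 H2 HX //.
by apply: (fmorph_inj iota); rewrite rmorph0 -(nf _ _ idfun iota iota) // map_row3.
Qed.

Lemma rank3_dep (f : natfun 3) y1 y2 y3 (a b c : C) : natural f ->
  f E iota (row3 y1 y2 y3) = 0 -> f C idfun (row3 a b c) != 0 ->
  exists z1 z2, [/\ cl2 z1 z2 y1, cl2 z1 z2 y2 & cl2 z1 z2 y3].
Proof.
move=> nf f0 fc.
have [c1|n1] := pselect (cl0 y1).
  by exists y2, y3; split; [exact: cl0_sub | exact: cl2_l | exact: cl2_r].
have [c2|n2] := pselect (cl1 y1 y2).
  by exists y1, y3; split; [exact: cl2_l | exact: cl12 | exact: cl2_r].
have [c3|n3] := pselect (cl2 y1 y2 y3).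
  by exists y1, y2; split; [exact: cl2_l | exact: cl2_r | exact: c3].
by rewrite (generic_point nf n1 n2 n3 f0) eqxx in fc.
Qed.

(** A vector normalized by f(x) = 1 has each coordinate algebraic over the ratios of
its coordinates: x_j^d is the inverse of the value of f at x / x_j. *)
Lemma cl2_unproject n (x : 'rV[E]_n) (f : natfun n) d z1 z2 j : natural f -> homog f d -> (0 < d)%N ->
  f E iota x = 1 -> x 0 j != 0 -> (forall i, cl2 z1 z2 (x 0 i / x 0 j)) -> forall i, cl2 z1 z2 (x 0 i).
Proof.
move=> nf hf d_gt0 fx nzx Hx i; have Hcl := cl_closed imC (add1 (add1 (@none E) z1) z2).
have HS := relc_sub Hcl.
suff Hj : cl2 z1 z2 (x 0 j).
  by rewrite -(divfK nzx (x 0 i)); apply: (subfM HS); [exact: Hx | exact: Hj].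
have Ey : x = x 0 j *: ((x 0 j)^-1 *: x) by rewrite scalerA mulfV // scale1r.
set y := _^-1 *: x in Ey.
have Fy : cl2 z1 z2 (f E iota y).
  apply: (natural_sub nf HS (relc_base Hcl)) => l; rewrite mxE mulrC; exact: Hx.
have Exj : x 0 j ^+ d = (f E iota y)^-1.
  have E1 : x 0 j ^+ d * f E iota y = 1 by rewrite -hf -Ey.
  have nzf : f E iota y != 0 by apply: contraTneq (oner_neq0 E) => f0; rewrite -E1 f0 mulr0 eqxx.
  by apply: (mulIf nzf); rewrite mulVf.
apply: (relc_alg Hcl); exists ('X^d - (x 0 j ^+ d)%:P); split.
- by rewrite -size_poly_eq0 size_XnsubC.
- move=> l; rewrite coefB coefXn coefC; apply: (subfB HS); first exact: (subf_nat HS).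
  by case: eqP => _; [rewrite Exj; exact: (subfV HS) | exact: (subf0 HS)].
- by rewrite rootE hornerD hornerN hornerXn hornerC subrr.
Qed.
End Values.
End NatFun.

(** * Towers of extensions of essential dimension at most two *)

Lemma simple_extension (F E : fieldType) (g : {rmorphism F -> E}) (q : {poly F}) (y : E) :
  irreducible_poly q -> root (map_poly g q) y ->
  exists (L : fieldExtType F) (h : {rmorphism L -> E}),
    [/\ forall c, h c%:A = g c, \dim {:L} = (size q).-1,
        exists x, h x = y & forall x, exists p, h x = (map_poly g p).[y]].
Proof.
move=> irr_q qy; have nz_q := irredp_neq0 irr_q.
pose L := SubFieldExtType qy irr_q.
have add_h : zmod_morphism (subfx_inj : L -> E) by exact: rmorphB.
have mul_h : monoid_morphism (subfx_inj : L -> E) by split; [exact: rmorph1 | exact: rmorphM].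
pose h : {rmorphism L -> E} := HB.pack (subfx_inj : L -> E)
  (GRing.isZmodMorphism.Build L E (subfx_inj : L -> E) add_h)
  (GRing.isMonoidMorphism.Build L E (subfx_inj : L -> E) mul_h).
exists L, h; split.
- by move=> c; exact: subfx_inj_base.
- by rewrite dimvf.
- by exists (subfx_root g y q); exact: subfx_inj_root.
- by move=> x; have [p ->] := subfxE x; exists p; exact: subfx_inj_eval.
Qed.

(** If L0 maps to F' over K0 -> F, spans F' over F and has the degree of F', then a
basis of L0 over K0 is also one of F' over F: this identifies F' with the tensor
product. *)
Section Tensor.
Variables (K0 F : fieldType) (j : {rmorphism K0 -> F}).
Variables (L0 : fieldExtType K0) (F' : fieldExtType F) (kap : {rmorphism L0 -> F'}).
Hypotheses (kapZ : forall c x, kap (c *: x) = j c *: kap x) (dimE : \dim {:L0} = \dim {:F'}).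
Hypothesis kap_span : forall V : {vspace F'}, (forall x, kap x \in V) -> V = fullv.

Let n := \dim {:L0}.
Let e : n.-tuple L0 := vbasis {:L0}.
Let X : n.-tuple F' := [tuple of map kap e].

Let eE x : x = \sum_(i < n) coord e i x *: e`_i.
Proof. by apply: coord_vbasis; rewrite memvf. Qed.

Let XE i : X`_i = kap e`_i.
Proof.
have [lti|gei] := ltnP i n; first by rewrite (nth_map 0) ?size_tuple.
by rewrite !nth_default ?rmorph0 // ?size_map ?size_tuple.
Qed.

Let kapE x : kap x = \sum_(i < n) j (coord e i x) *: X`_i.
Proof.
by rewrite [in LHS](eE x) rmorph_sum; apply: eq_bigr => i _; rewrite /= kapZ XE.
Qed.

Let Xbasis : basis_of fullv X.
Proof.
rewrite basisEdim size_tuple (eq_leq dimE) andbT.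
rewrite (kap_span (V := <<X>>%VS)) ?subvv // => x; rewrite kapE.
by apply: rpred_sum => i _; apply: rpredZ; apply: memv_span; apply: mem_nth; rewrite size_tuple.
Qed.

Let vE v : v = \sum_(i < n) coord X i v *: X`_i.
Proof. by apply: coord_basis; [exact: Xbasis | rewrite memvf]. Qed.

Lemma tensor_form : iso_tensor j L0 F'.
Proof.
pose t (x : L0) (a : F) : F' := a *: kap x.
exists (F' : algType F), t; split; last by exists (idfun : {lrmorphism F' -> F'}); exists id.
split.
- split=> [x y a|x a a'|c x a|c x a]; rewrite /t.
  + by rewrite rmorphD scalerDr.
  + by rewrite scalerDl.
  + by rewrite kapZ !scalerA mulrC.
  + by rewrite scalerA.
- move=> V b [bDl bDr bZl bZr].
  have b0l a : b 0 a = 0 by apply: (addrI (b 0 a)); rewrite -bDl !addr0.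
  have b_sum (c : 'I_n -> L0) a : b (\sum_i c i) a = \sum_i b (c i) a.
    by elim/big_rec2: _ => // i y1 y2 _ <-; rewrite bDl.
  exists (fun v => \sum_(i < n) b e`_i (coord X i v)); split.
    split.
    + by move=> u v; rewrite -big_split; apply: eq_bigr => i _; rewrite /= linearD bDr.
    + by move=> c v; rewrite scaler_sumr; apply: eq_bigr => i _; rewrite linearZ /= bZr.
    + move=> x a; rewrite [in RHS](eE x) b_sum; apply: eq_bigr => i _.
      rewrite bZl -bZr; congr (b _ _); rewrite linearZ /= kapE.
      rewrite (coord_sum_free _ _ (basis_free Xbasis)) mulrC //.
  move=> h' [hD hZ ht]; apply: funext => v; rewrite [in RHS](vE v).
  have h0 : h' 0 = 0 by apply: (addrI (h' 0)); rewrite -hD !addr0.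
  have h_sum (c : 'I_n -> F') : h' (\sum_i c i) = \sum_i h' (c i).
    by elim/big_rec2: _ => // i y1 y2 _ <-; rewrite hD.
  by rewrite h_sum; apply: eq_bigr => i _; rewrite XE ht.
- by rewrite /t rmorph1 scale1r.
- by move=> x a y a'; rewrite /t rmorphM -scalerAl -scalerAr scalerA.
- by move=> c x a; rewrite /t scalerA.
Qed.
End Tensor.

Lemma closed_split (E : fieldType) (p : {poly E}) : closedF E -> p \is monic ->
  exists rs : seq E, p = \prod_(x <- rs) ('X - x%:P).
Proof.
move=> Ecl; have [n] := ubnP (size p); elim: n p => // n IHn p lep mon_p.
have [p1|p_gt1] := leqP (size p) 1.
  by exists [::]; rewrite big_nil; move: mon_p; rewrite (size1_polyC p1) monicE lead_coefC => /eqP ->.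
have [x /factor_theorem[q Dq]] := Ecl p p_gt1.
have mon_q : q \is monic by move: mon_p; rewrite Dq monicMr // monicXsubC.
have [|//|rs Drs] := IHn q; last by exists (x :: rs); rewrite big_cons -Drs mulrC.
by move: lep; rewrite Dq size_Mmonic ?monicXsubC ?monic_neq0 // size_XsubC addn2.
Qed.

Lemma irreducible_root (F E : fieldType) (g : {rmorphism F -> E}) (p : {poly F}) (y : E) :
  p != 0 -> root (map_poly g p) y ->
  exists q : {poly F}, [/\ q \is monic, irreducible_poly q, root (map_poly g q) y & q %| p].
Proof.
move=> nz_p py; have [n] := ubnP (size p); elim: n p nz_p py => // n IHn p nz_p py; rewrite ltnS => lep.
have p_gt1 : (1 < size p)%N.
  by rewrite -(size_map_poly g) (root_size_gt1 _ py) // map_poly_eq0.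
have [q irr_q /dvdpP[r Dp]] := irreducible_factor p_gt1.
have nz_q := irredp_neq0 irr_q.
have [qy|nqy] := boolP (root (map_poly g q) y).
  have nzl : (lead_coef q)^-1 != 0 by rewrite invr_eq0 lead_coef_eq0.
  have Eq : (lead_coef q)^-1 *: q %= q by rewrite eqp_scale.
  exists ((lead_coef q)^-1 *: q); split.
  - by rewrite monicE lead_coefZ mulVf // lead_coef_eq0.
  - split; first by rewrite size_scale //; case: irr_q.
    move=> d d1; rewrite (eqp_dvdr _ Eq) => /(irr_q.2 d d1).
    by move/eqp_trans; apply; rewrite eqp_sym.
  - by rewrite map_polyZ rootZ // fmorph_eq0.
  - by rewrite (eqp_dvdl _ Eq) Dp dvdp_mull.
have nz_r : r != 0 by apply: contraNneq nz_p => r0; rewrite Dp r0 mul0r.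
have ry : root (map_poly g r) y by move: py; rewrite Dp rmorphM rootM (negPf nqy) orbF.
have [|q' [mon_q' irr_q' q'y q'r]] := IHn r nz_r ry.
  apply: leq_trans lep; rewrite Dp size_mul //.
  by have := irr_q.1; case: (size q) => [|[|m]] // _; rewrite !addnS ltnS leq_addr.
by exists q'; split=> //; rewrite Dp; apply: dvdp_mulr.
Qed.

Lemma irreducible_descent (K0 F : fieldType) (j : {rmorphism K0 -> F}) (q0 : {poly K0}) :
  irreducible_poly (map_poly j q0) -> irreducible_poly q0.
Proof.
case=> q_gt1 irr_q; split; first by rewrite -(size_map_poly j).
move=> d d1 dq; rewrite -(eqp_map j); apply: irr_q; first by rewrite size_map_poly.
by rewrite dvdp_map.
Qed.

Local Notation adjoinC := Defs.adjoinC.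

Section TrdegTwo.
Variables (R : realType) (K : extC R).

Section Adjoin.
Variables (n : nat) (a : 'I_n -> K).
Local Notation ev := (mmap (embC K) a).

Lemma adjoinC_subfield : subfieldP (adjoinC a).
Proof.
split.
- by exists 1, 1; rewrite /evalC !rmorph1 divr1 oner_neq0.
- move=> _ _ [p [q [q0 ->]]] [r [s [s0 ->]]]; exists (p * s - r * q), (q * s).
  rewrite /evalC in q0 s0 *; rewrite rmorphB !rmorphM mulf_neq0 //; split=> //.
  by field; rewrite q0 s0.
- move=> _ _ [p [q [q0 ->]]] [r [s [s0 ->]]]; exists (p * r), (q * s).
  rewrite /evalC in q0 s0 *; rewrite !rmorphM mulf_neq0 //; split=> //.
  by field; rewrite q0 s0.
- move=> _ [p [q [q0 ->]]]; have [p0|nzp] := eqVneq (evalC a p) 0.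
    exists 0, 1; rewrite p0 mul0r invr0 /evalC rmorph0 rmorph1 mul0r; split=> //.
    exact: oner_neq0.
  by exists q, p; rewrite invf_div.
Qed.

Lemma adjoinC_base c : adjoinC a (embC K c).
Proof.
by exists (mpolyC n c), 1; rewrite /evalC rmorph1 oner_neq0 divr1 mmapC.
Qed.

Lemma adjoinC_gen i : adjoinC a (a i).
Proof.
exists (mpolyX _ (mnm1 i)), 1; rewrite /evalC rmorph1 oner_neq0 divr1; split=> //.
by rewrite mmapX mmap1U.
Qed.

Lemma adjoinC_least S : subfieldP S -> (forall c, S (embC K c)) -> (forall i, S (a i)) ->
  forall x, adjoinC a x -> S x.
Proof.
move=> HS SC Sa _ [p [q [_ ->]]].
have He r : S (evalC a r).
  apply: (subf_sum HS) => m _; apply: (subfM HS) => //.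
  by apply: (subf_prod HS) => i _; apply: (subfX HS).
exact: subf_div.
Qed.
End Adjoin.

(** The whole field is algebraic over C(a). *)
Definition alg_gen n (a : 'I_n -> K) := forall x, algP (adjoinC a) x.

Lemma alg_gen_over n (a : 'I_n -> K) : alg_gen a -> forall x, algebraic_over (adjoinC a) x.
Proof. by move=> H x; have [p [nz_p Sp px]] := H x; exists p. Qed.

Lemma alg_gen_drop n m (a : 'I_n -> K) (b : 'I_m -> K) : alg_gen a ->
  (forall i, algP (adjoinC b) (a i)) -> alg_gen b.
Proof.
move=> Ha Hab x; have HS := adjoinC_subfield b; apply: (algP_idem HS).
apply: algP_sub (Ha x) => y; apply: adjoinC_least => // [|c].
  exact: algP_subfield.
exact/(algP_id HS)/adjoinC_base.
Qed.

Definition fam0 : 'I_0 -> K := fun _ => 0.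
Definition fam1 (a : K) : 'I_1 -> K := fun _ => a.
Definition fam2 (a b : K) : 'I_2 -> K := fun i => if i == 0 then a else b.

Lemma indep0 : alg_independent fam0.
Proof.
move=> p; rewrite [p]nvar0_mpolyC /evalC mmapC => /eqP; rewrite fmorph_eq0 => /eqP ->.
by rewrite mpolyC0.
Qed.

Lemma dep1 a p : evalC (fam1 a) p = 0 -> p != 0 -> algP (adjoinC fam0) a.
Proof.
move=> p0 nz_p; pose o : 'I_1 := ord0.
pose q : {poly K} := \sum_(m <- msupp p) embC K (mcoeff m p) *: 'X^(fun_of_multinom m o).
exists q; split.
- have [m mp] : exists m, m \in msupp p.
    by case E: (msupp p) nz_p => [|m s] nz_p; [rewrite -msupp_eq0 E in nz_p | exists m; rewrite mem_head].
  apply/eqP => /(congr1 (fun r : {poly K} => r`_(fun_of_multinom m o))).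
  rewrite coef0 coef_sum (bigD1_seq m) ?msupp_uniq //= coefZ coefXn eqxx mulr1 big1 => [|m' nm].
    by move/eqP; rewrite addr0 fmorph_eq0 mcoeff_eq0 mp.
  rewrite coefZ coefXn; case: eqP => [E|]; last by rewrite mulr0.
  by case/eqP: nm; apply/mnmP => i; rewrite (ord1 i).
- move=> i; rewrite coef_sum; apply: (subf_sum (adjoinC_subfield _)) => m _.
  rewrite coefZ; apply: (subfM (adjoinC_subfield _)); first exact: adjoinC_base.
  by rewrite coefXn; apply: subf_nat; exact: adjoinC_subfield.
- apply/rootP; rewrite -[RHS]p0 /evalC /mmap horner_sum; apply: eq_bigr => m _.
  by rewrite hornerZ hornerXn /mmap1 big_ord1.
Qed.

(** A relation between a and b, ordered by powers of b: if some coefficient is nonzero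
then b is algebraic over C(a); otherwise each coefficient is a relation for a. *)
Lemma dep2 a b p : evalC (fam2 a b) p = 0 -> p != 0 ->
  algP (adjoinC (fam1 a)) b \/ algP (adjoinC fam0) a.
Proof.
move=> p0 nz_p; pose o : 'I_2 := ord0; pose o' : 'I_2 := ord_max.
pose e (m : multinom 2) (i : 'I_2) : nat := fun_of_multinom m i.
pose q : {poly K} := \sum_(m <- msupp p) (embC K (mcoeff m p) * a ^+ e m o) *: 'X^(e m o').
have [q0|nz_q] := eqVneq q 0; last first.
  left; exists q; split=> //.
    move=> i; rewrite coef_sum; have HS := adjoinC_subfield (fam1 a).
    apply: (subf_sum HS) => m _; rewrite coefZ; apply: (subfM HS).
      by apply: (subfM HS); [exact: adjoinC_base | apply: (subfX HS); exact: (adjoinC_gen (fam1 a) ord0)].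
    by rewrite coefXn; exact: subf_nat.
  apply/rootP; rewrite -[RHS]p0 /evalC /mmap horner_sum; apply: eq_bigr => m _.
  rewrite hornerZ hornerXn /mmap1 big_ord_recl big_ord1 mulrA; congr (_ * _ ^+ _).
  by congr (e m _); apply: val_inj.
right; have [m0 m0p] : exists m, m \in msupp p.
  by case E: (msupp p) nz_p => [|m s] nz_p; [rewrite -msupp_eq0 E in nz_p | exists m; rewrite mem_head].
pose r : {poly K} := \sum_(m <- msupp p) (embC K (mcoeff m p) * (e m o' == e m0 o')%:R) *: 'X^(e m o).
exists r; split.
- apply/eqP => /(congr1 (fun r : {poly K} => r`_(e m0 o))).
  rewrite coef0 coef_sum (bigD1_seq m0) ?msupp_uniq //= coefZ coefXn !eqxx !mulr1 big1 => [|m nm].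
    by move/eqP; rewrite addr0 fmorph_eq0 mcoeff_eq0 m0p.
  rewrite coefZ coefXn; case: eqP => [Em|]; last by rewrite mulr0 mul0r.
  case: eqP => [E|]; last by rewrite mulr0.
  case/eqP: nm; apply/mnmP => i; have [->|->] : i = o \/ i = o'; [|by []|by []].
  by case: i => [[|[|//]] lti]; [left | right]; apply: val_inj.
- move=> i; have HS := adjoinC_subfield fam0; rewrite coef_sum; apply: (subf_sum HS) => m _.
  rewrite coefZ; apply: (subfM HS).
    by apply: (subfM HS); [exact: adjoinC_base | exact: subf_nat].
  by rewrite coefXn; exact: subf_nat.
- apply/rootP; have := congr1 (fun r : {poly K} => r`_(e m0 o')) q0; rewrite coef0 coef_sum => E.
  apply: etrans E; rewrite horner_sum; apply: eq_bigr => m _.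
  by rewrite coefZ coefXn [e m0 _ == _]eq_sym hornerZ hornerXn mulrAC.
Qed.

Lemma trdeg_le2 a b : alg_gen (fam2 a b) -> exists2 d, (d <= 2)%N & trdeg_is K d.
Proof.
have stop n (c : 'I_n -> K) : alg_gen c -> alg_independent c -> trdeg_is K n.
  by move=> Hc ic; exists c; split=> //; exact: alg_gen_over.
have step1 c : alg_gen (fam1 c) -> exists2 d, (d <= 2)%N & trdeg_is K d.
  move=> Hc; have [i1|/existsNP[p /not_implyP[p0 /eqP nz_p]]] := pselect (alg_independent (fam1 c)).
    by exists 1%N => //; exact: stop i1.
  exists 0%N => //; apply: stop indep0; apply: alg_gen_drop Hc _ => i; exact: dep1 p0 nz_p.
move=> Hab; have [i2|/existsNP[p /not_implyP[p0 /eqP nz_p]]] := pselect (alg_independent (fam2 a b)).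
  by exists 2%N => //; exact: stop i2.
have [bd|ad] := dep2 p0 nz_p.
  apply: (step1 a); apply: alg_gen_drop Hab _ => i; rewrite /fam2; case: ifP => // _.
  by apply: (algP_id (adjoinC_subfield _)); exact: (adjoinC_gen (fam1 a) ord0).
apply: (step1 b); apply: alg_gen_drop Hab _ => i; rewrite /fam2; case: ifP => // _.
  apply: algP_sub ad => x; apply: adjoinC_least => [|c|[]//]; first exact: adjoinC_subfield.
  exact: adjoinC_base.
by apply: (algP_id (adjoinC_subfield _)); exact: (adjoinC_gen (fam1 b) ord0).
Qed.
End TrdegTwo.

Section Tower.
Variables (R : realType) (E : fieldType) (Ecl : closedF E).

(** K0 is the field of the elements of F that are algebraic over C(a, b).  The minimal
polynomial q of y over F has its coefficients in K0, because they are polynomials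
in its roots, which are algebraic over C(a, b); so F(y) is a base change of the
extension K0(y) of K0. *)
Lemma step_extension (F : extC R) (g : {rmorphism F -> E}) (a b : F) (y : E) :
  cl2 (imC (g \o embC F : {rmorphism R[i] -> E})) (g a) (g b) y ->
  exists (F' : fieldExtType F) (h : {rmorphism F' -> E}),
    [/\ (ed F' <= 2%:R%:E)%E, forall c, h c%:A = g c & exists x, h x = y].
Proof.
set iota : {rmorphism R[i] -> E} := (g \o embC F); set k := cl2 _ _ _ => ky.
have Hk : relclosed (imC iota) k := cl_closed _ _.
pose S (x : F) := k (g x).
have HS : subfieldP S.
  have H := relc_sub Hk; split; rewrite /S.
  - by rewrite rmorph1; exact: subf1 H.
  - by move=> x x' kx kx'; rewrite rmorphB; exact: (subfB H).
  - by move=> x x' kx kx'; rewrite rmorphM; exact: (subfM H).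
  - by move=> x kx; rewrite fmorphV; exact: (subfV H).
pose j : {rmorphism subf HS -> F} := @subf_val F S HS.
have [e0 He0] : exists e0 : {rmorphism R[i] -> subf HS}, forall c, j (e0 c) = embC F c.
  apply: lift_rmorph => c; apply: subf_ex; apply: (relc_base Hk); by exists c.
pose K0 : extC R := ExtC (subf HS : fieldType) e0.
have [a0 Ha0] : exists a0 : K0, j a0 = a by apply: subf_ex; exact: cl2_l.
have [b0 Hb0] : exists b0 : K0, j b0 = b by apply: subf_ex; exact: cl2_r.
(* T is the image of C(a, b) in E. *)
pose T (u : E) := exists2 w : K0, adjoinC (fam2 a0 b0) w & g (j w) = u.
have HT : subfieldP T.
  have H := adjoinC_subfield (fam2 a0 b0); split.
  - by exists 1; [exact: subf1 H | rewrite !rmorph1].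
  - by move=> _ _ [w Hw <-] [w' Hw' <-]; exists (w - w'); [exact: subfB | rewrite !rmorphB].
  - by move=> _ _ [w Hw <-] [w' Hw' <-]; exists (w * w'); [exact: subfM | rewrite !rmorphM].
  - by move=> _ [w Hw <-]; exists w^-1; [exact: subfV | rewrite !fmorphV].
have algT u : k u -> algP T u.
  have HaT : relclosed (imC iota) (algP T).
    split; [exact: algP_subfield | | by move=> v; exact: algP_idem].
    move=> _ [c <-]; apply: (algP_id HT); exists (e0 c); first exact: (adjoinC_base (K := K0)).
    by rewrite He0.
  apply=> // v [[//|->]|->]; apply: (algP_id HT).
  - by exists a0; [exact: (adjoinC_gen (fam2 a0 b0) ord0) | rewrite Ha0].
  - by exists b0; [exact: (adjoinC_gen (fam2 a0 b0) ord_max) | rewrite Hb0].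
have tr : exists2 d, (d <= 2)%N & trdeg_is K0 d.
  apply: (@trdeg_le2 R K0 a0 b0) => x.
  have [p [nz_p Tp px]] := algT (g (j x)) (subf_valP x).
  have /choice[w Hw] : forall i, exists w : K0, adjoinC (fam2 a0 b0) w /\ (g \o j : {rmorphism _ -> _}) w = p`_i.
    by move=> i; have [w Hw Ew] := Tp i; exists w.
  have Dp : map_poly (g \o j : {rmorphism K0 -> E}) (\poly_(i < size p) w i) = p.
    apply/polyP => i; rewrite coef_map coef_poly; case: ltnP => [_|gei]; first by case: (Hw i).
    by rewrite raddf0 nth_default.
  exists (\poly_(i < size p) w i); split.
  - by rewrite -(map_poly_eq0 (g \o j : {rmorphism K0 -> E})) Dp.
  - move=> i; rewrite coef_poly; case: ifP => _; first by case: (Hw i).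
    exact: subf0 (adjoinC_subfield _).
  - by rewrite -(fmorph_root (g \o j : {rmorphism K0 -> E})) Dp.
have [p [nz_p Tp py]] := algT y ky.
have [p1 Dp1] : exists p1, map_poly g p1 = p.
  by apply: lift_poly => i; have [w _ <-] := Tp i; exists (j w).
have [||q [mon_q irr_q qy qp]] := @irreducible_root F E g p1 y.
- by rewrite -(map_poly_eq0 g) Dp1.
- by rewrite Dp1.
have [rs Drs] := closed_split Ecl (monic_map g mon_q).
have krs x : x \in rs -> k x.
  move=> xrs; apply: (relc_alg Hk); exists p; split=> //.
    move=> i; have [w _ <-] := Tp i; exact: (subf_valP w).
  by rewrite -Dp1; apply: (@root_dvdp _ (map_poly g q)); rewrite ?dvdp_map // Drs root_prod_XsubC.
have [q0 Dq0] : exists q0, map_poly j q0 = q.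
  apply: lift_poly => i; apply: subf_ex; rewrite /S -coef_map Drs.
  exact: (subf_polyXsubC_prod (relc_sub Hk)).
have irr_q0 : irreducible_poly q0 by apply: (irreducible_descent (j := j)); rewrite Dq0.
have q0y : root (map_poly (g \o j : {rmorphism K0 -> E}) q0) y by rewrite map_poly_comp Dq0.
have [L0 [h0 [h0b dL0 [y0 Ey0] h0P]]] := simple_extension irr_q0 q0y.
have [F' [h [hb dF' [y1 Ey1] hP]]] := simple_extension irr_q qy.
exists F', h; split; [|by [] | by exists y1].
have [kap Hkap] : exists kap : {rmorphism L0 -> F'}, forall x, h (kap x) = h0 x.
  apply: lift_rmorph => x; have [r ->] := h0P x.
  exists (map_poly (in_alg F' \o j : {rmorphism K0 -> F'}) r).[y1].
  rewrite -horner_map Ey1 -map_poly_comp; congr (_.[_]).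
  by apply: eq_map_poly => c /=; exact: hb.
apply/least_le; have [d led tr_d] := tr; exists d => //.
exists K0, j; split=> //; exists L0; apply: (tensor_form (kap := kap)).
- move=> c x; apply: (fmorph_inj h); rewrite Hkap -mulr_algl rmorphM h0b /=.
  by rewrite -[j c *: _]mulr_algl rmorphM hb Hkap.
- by rewrite dL0 dF' -Dq0 size_map_poly.
- move=> V HV; apply/vspaceP => v; rewrite memvf; have [r Er] := hP v.
  have -> : v = \sum_(i < size r) r`_i *: kap (y0 ^+ i).
    apply: (fmorph_inj h); rewrite Er rmorph_sum horner_coef size_map_poly.
    apply: eq_bigr => i _; rewrite coef_map /= -mulr_algl rmorphM hb Hkap rmorphXn.
    by rewrite Ey0.
  by apply: rpred_sum => i _; apply: rpredZ.
Qed.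

Lemma ed_tower_embC d (K F : extC R) (f : {rmorphism K -> F}) :
  ed_tower d f -> forall c, f (embC K c) = embC F c.
Proof. by elim=> // F1 f1 F2 _ IH _ c /=; rewrite IH. Qed.

Variables (K : extC R) (lam : {rmorphism K -> E}).
Let iota : {rmorphism R[i] -> E} := (lam \o embC K).

(** The tower is built on top of an arbitrary one, so that the towers of several
elements can be put on top of each other. *)
Lemma tower_of_hull x : hull (imC iota) (imC lam) x ->
  forall (F : extC R) (f : {rmorphism K -> F}) (g : {rmorphism F -> E}),
    ed_tower 2 f -> (forall c, g (f c) = lam c) ->
  exists (F' : extC R) (f' : {rmorphism K -> F'}) (g' : {rmorphism F' -> E}),
    [/\ ed_tower 2 f', forall c, g' (f' c) = lam c, forall a, exists b, g' b = g a
      & exists b, g' b = x].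
Proof.
elim=> {x} [x [c <-]|x y _ IHx _ IHy|x y _ IHx _ IHy|x _ IHx|a b y _ IHa _ IHb ky] F f g Tf gf.
- by exists F, f, g; split=> //; [move=> a; exists a | exists (f c)].
- have [F1 [f1 [g1 [T1 gf1 sg1 [x1 Ex1]]]]] := IHx F f g Tf gf.
  have [F2 [f2 [g2 [T2 gf2 sg2 [y2 Ey2]]]]] := IHy F1 f1 g1 T1 gf1.
  have [x2 Ex2] := sg2 x1; exists F2, f2, g2; split=> //.
    by move=> a; have [b <-] := sg1 a.
  by exists (x2 - y2); rewrite rmorphB Ex2 Ex1 Ey2.
- have [F1 [f1 [g1 [T1 gf1 sg1 [x1 Ex1]]]]] := IHx F f g Tf gf.
  have [F2 [f2 [g2 [T2 gf2 sg2 [y2 Ey2]]]]] := IHy F1 f1 g1 T1 gf1.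
  have [x2 Ex2] := sg2 x1; exists F2, f2, g2; split=> //.
    by move=> a; have [b <-] := sg1 a.
  by exists (x2 * y2); rewrite rmorphM Ex2 Ex1 Ey2.
- have [F1 [f1 [g1 [T1 gf1 sg1 [x1 Ex1]]]]] := IHx F f g Tf gf.
  by exists F1, f1, g1; split=> //; exists x1^-1; rewrite fmorphV Ex1.
have [F1 [f1 [g1 [T1 gf1 sg1 [a1 Ea1]]]]] := IHa F f g Tf gf.
have [F2 [f2 [g2 [T2 gf2 sg2 [b2 Eb2]]]]] := IHb F1 f1 g1 T1 gf1.
have [a2 Ea2] := sg2 a1.
have ky2 : cl2 (imC (g2 \o embC F2 : {rmorphism R[i] -> E})) (g2 a2) (g2 b2) y.
  rewrite Ea2 Ea1 Eb2 (_ : imC _ = imC iota) //.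
  apply: funext => u; apply: propext.
  by split=> -[c <-]; exists c; rewrite /= -(ed_tower_embC T2) gf2.
have [F' [h [edF' hb [y' Ey']]]] := step_extension ky2.
exists (extC_over F'), (in_alg F' \o f2 : {rmorphism K -> F'}), h; split.
- exact: ed_tower_step.
- by move=> c /=; rewrite hb gf2.
- by move=> u; have [u1 <-] := sg1 u; have [u2 <-] := sg2 u1; exists u2%:A; rewrite hb.
- by exists y'.
Qed.

Lemma resolvable_of_hull (L : fieldExtType K) (g : {rmorphism L -> E}) :
  (forall c, g c%:A = lam c) -> (forall x, hull (imC iota) (imC lam) (g x)) ->
  resolvable_in L 2.
Proof.
move=> glam hullg; pose X := vbasis {:L}.
have [F [f [h [Tf hf HX]]]] : exists (F : extC R) (f : {rmorphism K -> F}) (h : {rmorphism F -> E}),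
    [/\ ed_tower 2 f, forall c, h (f c) = lam c & forall x, x \in (X : seq L) -> exists b, h b = g x].
  elim: (X : seq L) => [|x s [F [f [h [Tf hf Hs]]]]].
    by exists K, idfun, lam; split=> //; exact: ed_tower_base.
  have [F' [f' [h' [Tf' hf' sh Hx]]]] := tower_of_hull (hullg x) Tf hf.
  exists F', f', h'; split=> // u; rewrite inE => /predU1P[->//|/Hs[b <-]].
  exact: sh.
exists F, f; split=> //.
have [k Hk] : exists k : {rmorphism L -> F}, forall x, h (k x) = g x.
  apply: lift_rmorph => x.
  have /choice[b Hb] : forall i : 'I_(\dim {:L}), exists b, h b = g X`_i.
    by move=> i; apply: HX; apply: mem_nth; rewrite size_tuple.
  exists (\sum_i f (coord X i x) * b i).
  rewrite rmorph_sum [in RHS](coord_vbasis (memvf x)) rmorph_sum; apply: eq_bigr => i _.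
  by rewrite /= rmorphM hf Hb -mulr_algl rmorphM glam.
by exists k => c; apply: (fmorph_inj h); rewrite Hk glam hf.
Qed.
End Tower.

(** * The Weil representation of SL(2,11) *)

Local Notation F11 := 'F_11.
Local Notation o0 := (@Ordinal 5 0 isT).
Local Notation o1 := (@Ordinal 5 1 isT).
Local Notation o2 := (@Ordinal 5 2 isT).
Local Notation o3 := (@Ordinal 5 3 isT).
Local Notation o4 := (@Ordinal 5 4 isT).

Lemma F11_exp5 (x : F11) : x != 0 -> (x ^+ 5 == 1) || (x ^+ 5 == -1).
Proof. by case: x => [[|[|[|[|[|[|[|[|[|[|[|//]]]]]]]]]]]]. Qed.

Lemma F11_cases (P : F11 -> Prop) :
  P 0 -> P 1 -> P 2%:R -> P 3%:R -> P 4%:R -> P 5%:R -> P 6%:R -> P 7%:R -> P 8%:R -> P 9%:R ->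
  P 10%:R -> forall x, P x.
Proof.
move=> H0 H1 H2 H3 H4 H5 H6 H7 H8 H9 H10 x.
have -> : x = (val x)%:R by rewrite natr_Zp.
case: x => [[|[|[|[|[|[|[|[|[|[|[|//]]]]]]]]]]]] //=.
Qed.

Lemma sum_F11 (V : nmodType) (f : F11 -> V) : \sum_x f x =
  f 0 + (f 1 + (f 2%:R + (f 3%:R + (f 4%:R + (f 5%:R + (f 6%:R + (f 7%:R + (f 8%:R + (f 9%:R + f 10%:R))))))))).
Proof.
rewrite (eq_bigr (fun x : F11 => f (val x)%:R)) => [|x _]; last by rewrite natr_Zp.
by rewrite !big_ord_recl big_ord0 addr0.
Qed.

Lemma sum5 (V : nmodType) (f : 'I_5 -> V) : \sum_i f i =
  f (@Ordinal 5 0 isT) + (f (@Ordinal 5 1 isT) + (f (@Ordinal 5 2 isT) + (f (@Ordinal 5 3 isT) + f (@Ordinal 5 4 isT)))).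
Proof.
rewrite !big_ord_recl big_ord0 addr0.
by congr (f _ + (f _ + (f _ + (f _ + f _)))); apply: val_inj.
Qed.

Section Weil.
Variables (F : fieldType) (F0 : char_zero F) (z : F).
Hypotheses (z11 : z ^+ 11 = 1) (z1 : z != 1).

(** The additive character of the prime field defined by an eleventh root of unity. *)
Definition echar (x : F11) : F := z ^+ x.

Lemma chE n : echar n%:R = z ^+ n.
Proof. by rewrite /echar val_Fp_nat // expr_mod. Qed.
Lemma ch0 : echar 0 = 1. Proof. by []. Qed.
Lemma chD x y : echar (x + y) = echar x * echar y.
Proof. by rewrite -[x]natr_Zp -[y]natr_Zp -natrD !chE exprD. Qed.
Lemma chN x : echar (- x) * echar x = 1. Proof. by rewrite -chD addNr. Qed.
Lemma ch_neq0 x : echar x != 0.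
Proof. by apply: contraTneq (oner_neq0 F) => x0; rewrite -(chN x) x0 mulr0 eqxx. Qed.

Lemma sum_z : \sum_(i < 11) z ^+ i = 0.
Proof.
apply/eqP; have /eqP := subrX1 z 11; rewrite z11 subrr eq_sym mulf_eq0 subr_eq0.
by rewrite (negPf z1).
Qed.

Lemma sum_zE : 1 + z + z ^+ 2 + z ^+ 3 + z ^+ 4 + z ^+ 5 + z ^+ 6 + z ^+ 7 + z ^+ 8 + z ^+ 9 + z ^+ 10 = 0.
Proof. by rewrite -[RHS]sum_z !big_ord_recl big_ord0 /= /bump /=; ring. Qed.

Lemma ch_neq1 x : x != 0 -> echar x != 1.
Proof.
move=> nzx; apply: contra z1 => /eqP cx1.
have chX n : echar (n%:R * x) = echar x ^+ n.
  by elim: n => [|n IHn]; rewrite ?mul0r // -natr1 mulrDl mul1r chD IHn exprSr.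
have := chX (val (x^-1)); rewrite cx1 expr1n natr_Zp mulVf // => /eqP.
by rewrite /echar expr1.
Qed.

Lemma sum_ch x : \sum_y echar (x * y) = if x == 0 then 11%:R else 0.
Proof.
case: eqP => [->|/eqP nzx].
  by rewrite (eq_bigr (fun=> 1)) => [|y _]; rewrite ?mul0r // sumr_const card_Fp.
rewrite (reindex_inj (h := fun y => x^-1 * y)) /=; last by apply: mulfI; rewrite invr_eq0.
rewrite (eq_bigr (fun y : F11 => z ^+ y)) => [|y _]; last by rewrite mulVKf.
exact: sum_z.
Qed.

(** The quadratic character, by Euler's criterion. *)
Definition chi (x : F11) : F := if x ^+ 5 == 1 then 1 else -1.

Lemma chiM x y : x != 0 -> y != 0 -> chi (x * y) = chi x * chi y.
Proof.
move=> /F11_exp5 Hx /F11_exp5 Hy; rewrite /chi exprMn.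
case/orP: Hx => /eqP ->; case/orP: Hy => /eqP ->;
 rewrite ?mulr1 ?mul1r ?mulrNN ?eqxx ?mulr1 //= ?mulN1r ?mulrN1 ?opprK //.
Qed.
Lemma chi_sq x : chi x * chi x = 1.
Proof. by rewrite /chi; case: ifP; rewrite ?mulr1 // mulrNN mulr1. Qed.
Lemma chi1 : chi 1 = 1. Proof. by rewrite /chi expr1n eqxx. Qed.
Lemma chiN1 : chi (-1) = -1. Proof. by []. Qed.
Lemma chi_neq0 x : chi x != 0.
Proof. by apply: contraTneq (oner_neq0 F) => x0; rewrite -(chi_sq x) x0 mulr0 eqxx. Qed.
Lemma chiV x : x != 0 -> chi x^-1 = chi x.
Proof.
move=> nzx; apply: (mulIf (chi_neq0 x)); rewrite chi_sq -chiM ?invr_eq0 //.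
by rewrite mulVf // chi1.
Qed.

Definition gauss : F := \sum_y echar (y ^+ 2).

Lemma gaussE : gauss = 1 + 2%:R * (z + z ^+ 3 + z ^+ 4 + z ^+ 5 + z ^+ 9).
Proof.
have E n : echar (n%:R ^+ 2) = z ^+ (n ^ 2 %% 11) by rewrite -natrX /echar val_Fp_nat.
rewrite /gauss sum_F11 !E (E 0%N) (E 1%N).
rewrite -[(0 ^ 2 %% 11)%N]/0%N -[(1 ^ 2 %% 11)%N]/1%N -[(2 ^ 2 %% 11)%N]/4%N -[(3 ^ 2 %% 11)%N]/9%N.
rewrite -[(4 ^ 2 %% 11)%N]/5%N -[(5 ^ 2 %% 11)%N]/3%N -[(6 ^ 2 %% 11)%N]/3%N -[(7 ^ 2 %% 11)%N]/5%N.
rewrite -[(8 ^ 2 %% 11)%N]/9%N -[(9 ^ 2 %% 11)%N]/4%N -[(10 ^ 2 %% 11)%N]/1%N; ring.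
Qed.

Lemma gauss_sq : gauss ^+ 2 = - 11%:R.
Proof.
apply/eqP; rewrite -subr_eq0; apply/eqP; rewrite gaussE.
rewrite -[RHS](mulr0 (12%:R - 8%:R * z + 8%:R * z ^+ 4 - 4%:R * z ^+ 7 + 4%:R * z ^+ 8)) -sum_zE.
ring.
Qed.

Lemma gauss_neq0 : gauss != 0.
Proof.
have : gauss ^+ 2 != 0 by rewrite gauss_sq oppr_eq0; apply: F0.
by rewrite expf_eq0.
Qed.

Lemma gauss_opp : \sum_y echar (- y ^+ 2) = - gauss.
Proof.
have E n : echar (- n%:R ^+ 2) = z ^+ ((11 - n ^ 2 %% 11) %% 11).
  by rewrite -natrX /echar /= val_Fp_nat.
rewrite sum_F11 !E (E 0%N) (E 1%N) gaussE.
rewrite -[((11 - 0 ^ 2 %% 11) %% 11)%N]/0%N -[((11 - 1 ^ 2 %% 11) %% 11)%N]/10%N -[((11 - 2 ^ 2 %% 11) %% 11)%N]/7%N.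
rewrite -[((11 - 3 ^ 2 %% 11) %% 11)%N]/2%N -[((11 - 4 ^ 2 %% 11) %% 11)%N]/6%N -[((11 - 5 ^ 2 %% 11) %% 11)%N]/8%N.
apply/eqP; rewrite -addr_eq0 -[0](mulr0 2%:R) -sum_zE; apply/eqP; ring.
Qed.

Lemma gauss_scale x : x != 0 -> \sum_y echar (x * y ^+ 2) = chi x * gauss.
Proof.
move=> nzx; have sqr (t : F11) : t ^+ 5 == 1 -> (t ^+ 3) ^+ 2 = t.
  by move/eqP => t5; rewrite -exprM (exprD t 5 1) t5 mul1r expr1.
have nz3 (t : F11) : t != 0 -> injective (fun y => t ^+ 3 * y).
  by move=> nzt; apply: mulfI; rewrite expf_eq0.
rewrite /chi; case: ifP => [x5|/negbT x5].
  rewrite mul1r /gauss.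
  have nzx' : x^-1 != 0 by rewrite invr_eq0.
  have x5' : x^-1 ^+ 5 == 1 by rewrite exprVn (eqP x5) invr1.
  rewrite (reindex_inj (nz3 _ nzx')) /=; apply: eq_bigr => y _.
  by rewrite exprMn sqr // mulrA mulfV // mul1r.
have := F11_exp5 nzx; rewrite (negPf x5) /= => x5n.
have nx5 : (- x) ^+ 5 == 1.
  by rewrite exprNn (eqP x5n) mulrN1 -signr_odd /= expr1 opprK.
rewrite mulN1r -gauss_opp.
have nzx' : - x^-1 != 0 by rewrite oppr_eq0 invr_eq0.
have x5' : (- x^-1) ^+ 5 == 1 by rewrite -invrN exprVn (eqP nx5) invr1.
rewrite (reindex_inj (nz3 _ nzx')) /=; apply: eq_bigr => y _.
by rewrite exprMn sqr // mulrA mulrN mulfV // mulN1r.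
Qed.

(** The normalization -1/g, with g the Gauss sum, which makes the kernels below
multiplicative on the nose and not only up to a scalar. *)
Definition gam : F := - gauss^-1.

Lemma gauss_full (u v : F11) : u != 0 ->
  \sum_y echar (u * y ^+ 2 - v * y) = echar (- v ^+ 2 / (4%:R * u)) * (chi u * gauss).
Proof.
move=> nzu; rewrite -gauss_scale //.
have nz2 : 2%:R != 0 :> F11 by []. have nz4 : 4%:R != 0 :> F11 by [].
rewrite (reindex_inj (addIr (v / (2%:R * u)))) /= mulr_sumr; apply: eq_bigr => y _.
rewrite -chD; congr echar; field; rewrite nzu //=.
Qed.

(** The kernel of the operator of the Weil representation attached to the matrix
(a, b; c, d) of determinant 1, on functions on the prime field. *)
Definition ker (a b c d : F11) (x y : F11) : F :=
  if c == 0 then chi a * echar (a * b * x ^+ 2 / 2%:R) * (y == a * x)%:R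
  else chi c * gam * echar ((a * x ^+ 2 - 2%:R * x * y + d * y ^+ 2) / (2%:R * c)).

Lemma sum_delta (f : F11 -> F) (t : F11) : \sum_y f y * (y == t)%:R = f t.
Proof.
rewrite (bigD1 t) //= eqxx mulr1 big1 ?addr0 // => y /negPf->.
by rewrite mulr0.
Qed.

(** The product of two kernels is a Gaussian sum, degenerate in four ways according to
which of c, c' and the lower left entry of the product vanish. *)
Lemma ker_mul a b c d a' b' c' d' x t :
  a * d - b * c = 1 -> a' * d' - b' * c' = 1 ->
  \sum_y ker a b c d x y * ker a' b' c' d' y t =
  ker (a * a' + b * c') (a * b' + b * d') (c * a' + d * c') (c * b' + d * d') x t.
Proof.
have nz2 : 2%:R != 0 :> F11 by []. have nz4 : 4%:R != 0 :> F11 by [].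
move=> D D'; rewrite /ker.
have [c0|nzc] := eqVneq c 0; have [c0'|nzc'] := eqVneq c' 0.
- subst c c'; rewrite !mul0r !mulr0 !addr0 eqxx ?mul0r !subr0 in D D' *.
  have nza : a != 0 by apply: contra_eq_neq D => ->; rewrite mul0r eq_sym oner_eq0.
  have nza' : a' != 0 by apply: contra_eq_neq D' => ->; rewrite mul0r eq_sym oner_eq0.
  have Dd : d = a^-1 by apply: (mulfI nza); rewrite D mulfV.
  have Dd' : d' = a'^-1 by apply: (mulfI nza'); rewrite D' mulfV.
  pose f y := chi a * echar (a * b * x ^+ 2 / 2%:R) * (chi a' * echar (a' * b' * y ^+ 2 / 2%:R) * (t == a' * y)%:R).
  rewrite (eq_bigr (fun y => f y * (y == a * x)%:R)) => [|y _]; last by rewrite /f mulrAC.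
  rewrite sum_delta /f chiM //.
  have -> : echar (a * a' * (a * b' + b * d') * x ^+ 2 / 2%:R) = echar (a * b * x ^+ 2 / 2%:R) * echar (a' * b' * (a * x) ^+ 2 / 2%:R).
    by rewrite -chD Dd'; congr echar; field; rewrite nza'.
  rewrite mulrCA [a * a']mulrC -mulrA [a' * (a * x)]mulrA; ring.
- subst c; rewrite !mul0r !mulr0 ?addr0 !add0r !subr0 in D *.
  have nza : a != 0 by apply: contra_eq_neq D => ->; rewrite mul0r eq_sym oner_eq0.
  have Dd : d = a^-1 by apply: (mulfI nza); rewrite D mulfV.
  have nzd : d != 0 by rewrite Dd invr_eq0.
  rewrite mulf_eq0 (negPf nzd) (negPf nzc') /=.
  pose f y := chi a * echar (a * b * x ^+ 2 / 2%:R) * (chi c' * gam * echar ((a' * y ^+ 2 - 2%:R * y * t + d' * t ^+ 2) / (2%:R * c'))).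
  rewrite (eq_bigr (fun y => f y * (y == a * x)%:R)) => [|y _]; last by rewrite /f mulrAC.
  rewrite sum_delta /f chiM // Dd chiV //.
  have -> : echar (((a * a' + b * c') * x ^+ 2 - 2%:R * x * t + a^-1 * d' * t ^+ 2) / (2%:R * (a^-1 * c'))) =
     echar (a * b * x ^+ 2 / 2%:R) * echar ((a' * (a * x) ^+ 2 - 2%:R * (a * x) * t + d' * t ^+ 2) / (2%:R * c')).
    by rewrite -chD; congr echar; field; rewrite nza nzc'.
  ring.
- subst c'; rewrite !mulr0 ?addr0 ?subr0 in D' *.
  have nza' : a' != 0 by apply: contra_eq_neq D' => ->; rewrite mul0r eq_sym oner_eq0.
  have Dd' : d' = a'^-1 by apply: (mulfI nza'); rewrite D' mulfV.
  rewrite mulf_eq0 (negPf nza') (negPf nzc) /=.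
  pose f y := chi c * gam * echar ((a * x ^+ 2 - 2%:R * x * y + d * y ^+ 2) / (2%:R * c)) * (chi a' * echar (a' * b' * y ^+ 2 / 2%:R)).
  rewrite (eq_bigr (fun y => f y * (y == d' * t)%:R)) => [|y _]; last first.
    rewrite /f -!mulrA; do 5!congr (_ * _); congr (_%:R); congr nat_of_bool.
    apply/eqP/eqP => ->; rewrite Dd'; by [rewrite mulKf | rewrite mulVKf].
  rewrite sum_delta /f chiM // Dd'.
  have -> : echar ((a * a' * x ^+ 2 - 2%:R * x * t + (c * b' + d * a'^-1) * t ^+ 2) / (2%:R * (c * a'))) =
     echar ((a * x ^+ 2 - 2%:R * x * (a'^-1 * t) + d * (a'^-1 * t) ^+ 2) / (2%:R * c)) * echar (a' * b' * (a'^-1 * t) ^+ 2 / 2%:R).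
    by rewrite -chD; congr echar; field; rewrite nza' nzc.
  ring.
(* With c and c' nonzero the sum is a Gauss sum of y |-> u y^2 - v y, up to the factor w. *)
pose u := (c * a' + d * c') / (2%:R * c * c'); pose v := x / c + t / c'.
pose w := a * x ^+ 2 / (2%:R * c) + d' * t ^+ 2 / (2%:R * c').
rewrite (eq_bigr (fun y => chi c * chi c' * gam ^+ 2 * echar w * echar (u * y ^+ 2 - v * y))) => [|y _]; last first.
  rewrite -[RHS]mulrA; have -> : echar w * echar (u * y ^+ 2 - v * y) = echar ((a * x ^+ 2 - 2%:R * x * y + d * y ^+ 2) / (2%:R * c)) * echar ((a' * y ^+ 2 - 2%:R * y * t + d' * t ^+ 2) / (2%:R * c')).
    by rewrite -!chD /u /v /w; congr echar; field; rewrite nzc nzc'.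
  ring.
rewrite -mulr_sumr.
have nzcc : 2%:R * c * c' != 0 by rewrite !mulf_neq0.
have g2 : gam ^+ 2 * 11%:R = -1.
  rewrite /gam sqrrN exprVn gauss_sq invrN mulNr mulVf //; exact: F0.
have [c0|nzc''] := eqVneq (c * a' + d * c') 0.
  have -> : u = 0 by rewrite /u c0 mul0r.
  have Da' : a' = - (d * c' / c) by apply: (mulfI nzc); rewrite mulrN mulrCA mulfV // mulr1; apply/eqP; rewrite -addr_eq0 c0.
  have Db : b = (a * d - 1) / c by rewrite -D; field.
  have Db' : b' = (a' * d' - 1) / c' by rewrite -D'; field.
  have Da'' : a * a' + b * c' = - c' / c by rewrite Da' Db; field.
  rewrite (eq_bigr (fun y => echar (- v * y))) => [|y _]; last by rewrite mul0r add0r mulNr.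
  rewrite sum_ch oppr_eq0 Da''.
  have -> : (t == - c' / c * x) = (v == 0).
    rewrite /v addrC addr_eq0; apply/eqP/eqP => E; first by rewrite E; field; rewrite nzc nzc'.
    by rewrite -[t](mulfVK nzc') E; field.
  have [v0|_] := eqVneq v 0; last by rewrite !mulr0.
  have Dt : t = - c' / c * x.
    by move/eqP: v0; rewrite /v addrC addr_eq0 => /eqP E; rewrite -[t](mulfVK nzc') E; field.
  have -> : chi (- c' / c) = - (chi c * chi c').
    rewrite chiM ?oppr_eq0 ?invr_eq0 // chiV // -[- c']mulN1r chiM ?oppr_eq0 ?oner_eq0 //.
    by rewrite chiN1; ring.
  have -> : w = - c' / c * (a * b' + b * d') * x ^+ 2 / 2%:R.
    by rewrite /w Dt Db Db' Da'; field; rewrite nzc nzc'.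
  rewrite mulr1 -[gam ^+ 2 in LHS]mulr1; set e := echar _; transitivity (chi c * chi c' * e * (gam ^+ 2 * 11%:R)); first by ring.
  by rewrite g2; ring.
have nzu : u != 0 by rewrite /u mulf_neq0 ?invr_eq0.
rewrite gauss_full //.
have -> : chi u = chi 2%:R * chi c * chi c' * chi (c * a' + d * c').
  by rewrite /u chiM ?invr_eq0 // chiV // !chiM ?mulf_neq0 //; ring.
have -> : echar ((((a * a' + b * c') * x ^+ 2 - 2%:R * x * t + (c * b' + d * d') * t ^+ 2) / (2%:R * (c * a' + d * c')))) = echar w * echar (- v ^+ 2 / (4%:R * u)).
  have Db : b = (a * d - 1) / c by rewrite -D; field.
  have Db' : b' = (a' * d' - 1) / c' by rewrite -D'; field.
  by rewrite -chD /w /v /u Db Db'; congr echar; field; rewrite nzc nzc' nzc''.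
have chi2 : chi 2%:R = -1 by [].
rewrite chi2 /gam; set e1 := echar w; set e2 := echar _.
have := chi_sq c; have := chi_sq c'; set h := chi c; set h' := chi c' => Eh' Eh.
transitivity ((h * h) * (h' * h') * - (gauss^-1 * (gauss^-1 * gauss)) * e1 * e2 * chi (c * a' + d * c')).
  by ring.
by rewrite Eh Eh' mulVf ?gauss_neq0 //; ring.
Qed.
End Weil.

(** The symmetric trilinear form with tri5(x, x, x) = 3 (x0^2 x1 + x1^2 x2 + x2^2 x3 +
x3^2 x4 + x4^2 x0). *)
Definition tri5 (R : comNzRingType) (x0 x1 x2 x3 x4 u0 u1 u2 u3 u4 v0 v1 v2 v3 v4 : R) : R :=
  (x1 * u0 * v0 + x0 * u1 * v0 + x0 * u0 * v1) +
  (x2 * u1 * v1 + x1 * u2 * v1 + x1 * u1 * v2) +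
  (x3 * u2 * v2 + x2 * u3 * v2 + x2 * u2 * v3) +
  (x4 * u3 * v3 + x3 * u4 * v3 + x3 * u3 * v4) +
  (x0 * u4 * v4 + x4 * u0 * v4 + x4 * u4 * v0).

Section HankelInvariance.
Variables (F : fieldType) (F0 : char_zero F).

(** The values of the trilinear form on the columns of the Hankel matrix with entries
s_(i+j), indices modulo 5.  As the form is symmetric and invariant under cyclic
shifts, these seven values determine it on all triples of columns. *)
Definition hk_a (s0 s1 s2 s3 s4 : F) : F := tri5 s0 s1 s2 s3 s4  s0 s1 s2 s3 s4  s0 s1 s2 s3 s4.
Definition hk_b (s0 s1 s2 s3 s4 : F) : F := tri5 s0 s1 s2 s3 s4  s0 s1 s2 s3 s4  s1 s2 s3 s4 s0.
Definition hk_c (s0 s1 s2 s3 s4 : F) : F := tri5 s0 s1 s2 s3 s4  s0 s1 s2 s3 s4  s2 s3 s4 s0 s1.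
Definition hk_d (s0 s1 s2 s3 s4 : F) : F := tri5 s0 s1 s2 s3 s4  s0 s1 s2 s3 s4  s3 s4 s0 s1 s2.
Definition hk_e (s0 s1 s2 s3 s4 : F) : F := tri5 s0 s1 s2 s3 s4  s0 s1 s2 s3 s4  s4 s0 s1 s2 s3.
Definition hk_f (s0 s1 s2 s3 s4 : F) : F := tri5 s0 s1 s2 s3 s4  s1 s2 s3 s4 s0  s2 s3 s4 s0 s1.
Definition hk_g (s0 s1 s2 s3 s4 : F) : F := tri5 s0 s1 s2 s3 s4  s1 s2 s3 s4 s0  s3 s4 s0 s1 s2.

Definition hankel_ok (s0 s1 s2 s3 s4 t : F) : Prop :=
  [/\ hk_a s0 s1 s2 s3 s4 = 0, hk_b s0 s1 s2 s3 s4 = t, hk_c s0 s1 s2 s3 s4 = 0 & hk_d s0 s1 s2 s3 s4 = 0] /\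
  [/\ hk_e s0 s1 s2 s3 s4 = 0, hk_f s0 s1 s2 s3 s4 = 0 & hk_g s0 s1 s2 s3 s4 = 0].

Lemma hankel_ok_shift s0 s1 s2 s3 s4 t :
  hankel_ok s0 s1 s2 s3 s4 t -> hankel_ok s1 s2 s3 s4 s0 t.
Proof.
case=> [[Ea Eb Ec Ed] [Ee Ef Eg]]; split; split.
- by rewrite -Ea /hk_a /tri5; ring.
- by rewrite -Eb /hk_b /tri5; ring.
- by rewrite -Ec /hk_c /tri5; ring.
- by rewrite -Ed /hk_d /tri5; ring.
- by rewrite -Ee /hk_e /tri5; ring.
- by rewrite -Ef /hk_f /tri5; ring.
- by rewrite -Eg /hk_g /tri5; ring.
Qed.

Lemma tri5_hankel s0 s1 s2 s3 s4 c t x0 x1 x2 x3 x4 u0 u1 u2 u3 u4 v0 v1 v2 v3 v4 :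
  hankel_ok s0 s1 s2 s3 s4 t ->
  tri5 (c * (s0 * x0 + s1 * x1 + s2 * x2 + s3 * x3 + s4 * x4)) (c * (s1 * x0 + s2 * x1 + s3 * x2 + s4 * x3 + s0 * x4)) (c * (s2 * x0 + s3 * x1 + s4 * x2 + s0 * x3 + s1 * x4)) (c * (s3 * x0 + s4 * x1 + s0 * x2 + s1 * x3 + s2 * x4)) (c * (s4 * x0 + s0 * x1 + s1 * x2 + s2 * x3 + s3 * x4))
    (c * (s0 * u0 + s1 * u1 + s2 * u2 + s3 * u3 + s4 * u4)) (c * (s1 * u0 + s2 * u1 + s3 * u2 + s4 * u3 + s0 * u4)) (c * (s2 * u0 + s3 * u1 + s4 * u2 + s0 * u3 + s1 * u4)) (c * (s3 * u0 + s4 * u1 + s0 * u2 + s1 * u3 + s2 * u4)) (c * (s4 * u0 + s0 * u1 + s1 * u2 + s2 * u3 + s3 * u4))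
    (c * (s0 * v0 + s1 * v1 + s2 * v2 + s3 * v3 + s4 * v4)) (c * (s1 * v0 + s2 * v1 + s3 * v2 + s4 * v3 + s0 * v4)) (c * (s2 * v0 + s3 * v1 + s4 * v2 + s0 * v3 + s1 * v4)) (c * (s3 * v0 + s4 * v1 + s0 * v2 + s1 * v3 + s2 * v4)) (c * (s4 * v0 + s0 * v1 + s1 * v2 + s2 * v3 + s3 * v4)) =
  c ^+ 3 * t * tri5 x0 x1 x2 x3 x4 u0 u1 u2 u3 u4 v0 v1 v2 v3 v4.
Proof.
case=> [[Ea Eb Ec Ed] [Ee Ef Eg]].
transitivity (c ^+ 3 * (
  hk_a s0 s1 s2 s3 s4 * (x0 * u0 * v0 + x1 * u1 * v1 + x2 * u2 * v2 + x3 * u3 * v3 + x4 * u4 * v4) +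
  hk_b s0 s1 s2 s3 s4 * (x0 * u0 * v1 + x0 * u1 * v0 + x0 * u4 * v4 + x1 * u0 * v0 + x1 * u1 * v2 + x1 * u2 * v1 + x2 * u1 * v1 + x2 * u2 * v3 + x2 * u3 * v2 + x3 * u2 * v2 + x3 * u3 * v4 + x3 * u4 * v3 + x4 * u0 * v4 + x4 * u3 * v3 + x4 * u4 * v0) +
  hk_c s0 s1 s2 s3 s4 * (x0 * u0 * v2 + x0 * u2 * v0 + x0 * u3 * v3 + x1 * u1 * v3 + x1 * u3 * v1 + x1 * u4 * v4 + x2 * u0 * v0 + x2 * u2 * v4 + x2 * u4 * v2 + x3 * u0 * v3 + x3 * u1 * v1 + x3 * u3 * v0 + x4 * u1 * v4 + x4 * u2 * v2 + x4 * u4 * v1) +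
  hk_d s0 s1 s2 s3 s4 * (x0 * u0 * v3 + x0 * u2 * v2 + x0 * u3 * v0 + x1 * u1 * v4 + x1 * u3 * v3 + x1 * u4 * v1 + x2 * u0 * v2 + x2 * u2 * v0 + x2 * u4 * v4 + x3 * u0 * v0 + x3 * u1 * v3 + x3 * u3 * v1 + x4 * u1 * v1 + x4 * u2 * v4 + x4 * u4 * v2) +
  hk_e s0 s1 s2 s3 s4 * (x0 * u0 * v4 + x0 * u1 * v1 + x0 * u4 * v0 + x1 * u0 * v1 + x1 * u1 * v0 + x1 * u2 * v2 + x2 * u1 * v2 + x2 * u2 * v1 + x2 * u3 * v3 + x3 * u2 * v3 + x3 * u3 * v2 + x3 * u4 * v4 + x4 * u0 * v0 + x4 * u3 * v4 + x4 * u4 * v3) +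
  hk_f s0 s1 s2 s3 s4 * (x0 * u1 * v2 + x0 * u1 * v4 + x0 * u2 * v1 + x0 * u3 * v4 + x0 * u4 * v1 + x0 * u4 * v3 + x1 * u0 * v2 + x1 * u0 * v4 + x1 * u2 * v0 + x1 * u2 * v3 + x1 * u3 * v2 + x1 * u4 * v0 + x2 * u0 * v1 + x2 * u1 * v0 + x2 * u1 * v3 + x2 * u3 * v1 + x2 * u3 * v4 + x2 * u4 * v3 + x3 * u0 * v4 + x3 * u1 * v2 + x3 * u2 * v1 + x3 * u2 * v4 + x3 * u4 * v0 + x3 * u4 * v2 + x4 * u0 * v1 + x4 * u0 * v3 + x4 * u1 * v0 + x4 * u2 * v3 + x4 * u3 * v0 + x4 * u3 * v2) +
  hk_g s0 s1 s2 s3 s4 * (x0 * u1 * v3 + x0 * u2 * v3 + x0 * u2 * v4 + x0 * u3 * v1 + x0 * u3 * v2 + x0 * u4 * v2 + x1 * u0 * v3 + x1 * u2 * v4 + x1 * u3 * v0 + x1 * u3 * v4 + x1 * u4 * v2 + x1 * u4 * v3 + x2 * u0 * v3 + x2 * u0 * v4 + x2 * u1 * v4 + x2 * u3 * v0 + x2 * u4 * v0 + x2 * u4 * v1 + x3 * u0 * v1 + x3 * u0 * v2 + x3 * u1 * v0 + x3 * u1 * v4 + x3 * u2 * v0 + x3 * u4 * v1 + x4 * u0 * v2 + x4 * u1 * v2 + x4 * u1 * v3 + x4 * u2 * v0 + x4 * u2 * v1 + x4 * u3 * v1))).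
  rewrite /hk_a /hk_b /hk_c /hk_d /hk_e /hk_f /hk_g /tri5; ring.
rewrite Ea Eb Ec Ed Ee Ef Eg /tri5; ring.
Qed.

Variable z : F.
Hypotheses (z11 : z ^+ 11 = 1) (z1 : z != 1).

(** The entries of the Weyl element on odd functions, up to the scalar [gam].  In each
identity the difference of the two sides is a polynomial in z, divisible by
1 + z + ... + z^10; the multiplier is the quotient. *)
Lemma hankel_weil : hankel_ok (z ^+ 10 - z) (z ^+ 8 - z ^+ 3) (z ^+ 2 - z ^+ 9) (z ^+ 6 - z ^+ 5) (z ^+ 7 - z ^+ 4) (11%:R * gauss z).
Proof.
have S0 := sum_zE z11 z1.
split; split; apply/eqP; rewrite -subr_eq0 ?subr0 ?gaussE //; apply/eqP.
- rewrite -[RHS](mulr0 (- 3%:R * z ^+ 5 + 3%:R * z ^+ 6 + 3%:R * z ^+ 8 - 9%:R * z ^+ 9 + 12%:R * z ^+ 10 - 6%:R * z ^+ 11 + 6%:R * z ^+ 12 - 12%:R * z ^+ 13 + 9%:R * z ^+ 14 - 3%:R * z ^+ 15 - 3%:R * z ^+ 17 + 3%:R * z ^+ 18)) -S0 /hk_a /tri5; ring.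
- rewrite -[RHS](mulr0 (- 11%:R - 11%:R * z + 22%:R * z ^+ 2 - 22%:R * z ^+ 3 + z ^+ 4 - z ^+ 5 + 20%:R * z ^+ 6 - 2%:R * z ^+ 7 + 3%:R * z ^+ 8 - 19%:R * z ^+ 9 + 20%:R * z ^+ 10 - 14%:R * z ^+ 11 + 3%:R * z ^+ 12 + 2%:R * z ^+ 13 - 3%:R * z ^+ 14 - 3%:R * z ^+ 15 + 2%:R * z ^+ 16 + 2%:R * z ^+ 17 + z ^+ 18 - z ^+ 19)) -S0 /hk_b /tri5; ring.
- rewrite -[RHS](mulr0 (- z ^+ 5 + 3%:R * z ^+ 6 - 3%:R * z ^+ 7 + z ^+ 9 + 2%:R * z ^+ 11 - 2%:R * z ^+ 12 - z ^+ 14 + 3%:R * z ^+ 16 - 3%:R * z ^+ 17 + z ^+ 18)) -S0 /hk_c /tri5; ring.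
- rewrite -[RHS](mulr0 (- z ^+ 6 + z ^+ 7 + 2%:R * z ^+ 8 - 3%:R * z ^+ 9 + z ^+ 10 - z ^+ 13 + 3%:R * z ^+ 14 - 2%:R * z ^+ 15 - z ^+ 16 + z ^+ 17)) -S0 /hk_d /tri5; ring.
- rewrite -[RHS](mulr0 (- z ^+ 3 + z ^+ 4 + 3%:R * z ^+ 6 - 3%:R * z ^+ 7 - 2%:R * z ^+ 8 + z ^+ 9 + z ^+ 10 + 2%:R * z ^+ 11 - 2%:R * z ^+ 12 - z ^+ 13 - z ^+ 14 + 2%:R * z ^+ 15 + 3%:R * z ^+ 16 - 3%:R * z ^+ 17 - z ^+ 19 + z ^+ 20)) -S0 /hk_e /tri5; ring.
- rewrite -[RHS](mulr0 (- 2%:R * z ^+ 5 + 2%:R * z ^+ 6 + 3%:R * z ^+ 8 - 6%:R * z ^+ 9 + 5%:R * z ^+ 10 - 2%:R * z ^+ 11 + 2%:R * z ^+ 12 - 5%:R * z ^+ 13 + 6%:R * z ^+ 14 - 3%:R * z ^+ 15 - 2%:R * z ^+ 17 + 2%:R * z ^+ 18)) -S0 /hk_f /tri5; ring.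
- rewrite -[RHS](mulr0 (z ^+ 4 - z ^+ 5 + z ^+ 6 - 2%:R * z ^+ 8 + z ^+ 10 - 2%:R * z ^+ 11 + 2%:R * z ^+ 12 - z ^+ 13 + 2%:R * z ^+ 15 - z ^+ 17 + z ^+ 18 - z ^+ 19)) -S0 /hk_g /tri5; ring.
Qed.
End HankelInvariance.

(** The five nonzero squares modulo 11: odd functions are given by their values at
these points, as -1 is not a square.  In this order, multiplication by 3 is the
cyclic shift of the coordinates. *)
Definition aa (i : 'I_5) : F11 := 3%:R ^+ i.

Lemma aa_neq0 i : aa i != 0. Proof. by rewrite /aa expf_neq0. Qed.

Lemma aaE : (aa o0 = 1) * (aa o1 = 3%:R) * (aa o2 = 9%:R) * (aa o3 = 5%:R) * (aa o4 = 4%:R).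
Proof. by do !split; apply: val_inj. Qed.

Lemma sum_F11_fold (R : comNzRingType) (f : F11 -> R) :
  \sum_y f y = f 0 + \sum_j (f (aa j) + f (- aa j)).
Proof.
rewrite sum_F11 sum5 !aaE.
have -> : - 1 = 10%:R :> F11 by apply: val_inj.
have -> : - 3%:R = 8%:R :> F11 by apply: val_inj.
have -> : - 9%:R = 2%:R :> F11 by apply: val_inj.
have -> : - 5%:R = 6%:R :> F11 by apply: val_inj.
have -> : - 4%:R = 7%:R :> F11 by apply: val_inj.
ring.
Qed.

(** Half the matrix of second derivatives of the Klein cubic. *)
Definition hess (R : comNzRingType) (x : 'rV[R]_5) : 'M[R]_5 := \matrix_(i, j)
  nth 0 (nth [::] [:: [:: x 0 o1; x 0 o0; 0; 0; x 0 o4];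
                      [:: x 0 o0; x 0 o2; x 0 o1; 0; 0];
                      [:: 0; x 0 o1; x 0 o3; x 0 o2; 0];
                      [:: 0; 0; x 0 o2; x 0 o4; x 0 o3];
                      [:: x 0 o4; 0; 0; x 0 o3; x 0 o0]] i) j.

Definition tri (R : comNzRingType) (x u v : 'rV[R]_5) : R :=
  tri5 (x 0 o0) (x 0 o1) (x 0 o2) (x 0 o3) (x 0 o4) (u 0 o0) (u 0 o1) (u 0 o2) (u 0 o3) (u 0 o4)
       (v 0 o0) (v 0 o1) (v 0 o2) (v 0 o3) (v 0 o4).

Section WeilMatrices.
Variables (F : fieldType) (F0 : char_zero F) (z : F).
Hypotheses (z11 : z ^+ 11 = 1) (z1 : z != 1).
Local Notation ch := (echar z).
Local Notation ker := (ker z).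

Lemma ker_odd a b c d x y : ker a b c d (- x) (- y) = ker a b c d x y.
Proof.
rewrite /ker; case: eqP => [_|/eqP nzc]; last by congr (_ * echar _ (_ / _)); ring.
by rewrite sqrrN mulrN (inj_eq oppr_inj).
Qed.

Lemma ker_swap a b c d x y : ker a b c d (- x) y = ker a b c d x (- y).
Proof. by rewrite -ker_odd opprK. Qed.

(** The action on odd functions. *)
Definition weil4 a b c d : 'M[F]_5 :=
  \matrix_(i, j) (ker a b c d (aa i) (aa j) - ker a b c d (aa i) (- aa j)).

Lemma weil4_mul a b c d a' b' c' d' :
  a * d - b * c = 1 -> a' * d' - b' * c' = 1 ->
  weil4 a b c d *m weil4 a' b' c' d' =
  weil4 (a * a' + b * c') (a * b' + b * d') (c * a' + d * c') (c * b' + d * d').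
Proof.
move=> D D'; apply/matrixP => i k; rewrite !mxE -!(ker_mul F0 z11 z1 _ _ D D').
rewrite -sumrB sum_F11_fold -[in X in X + _]mulrBr.
have -> : ker a' b' c' d' 0 (aa k) - ker a' b' c' d' 0 (- aa k) = 0.
  by rewrite -ker_odd oppr0 subrr.
rewrite mulr0 add0r; apply: eq_bigr => j _.
by rewrite !mxE !ker_swap !opprK; ring.
Qed.

Definition rho (g : 'M[F11]_2) : 'M[F]_5 := weil4 (g 0 0) (g 0 1) (g 1 0) (g 1 1).

Lemma det2 (g : 'M[F11]_2) : \det g = g 0 0 * g 1 1 - g 0 1 * g 1 0.
Proof.
rewrite (expand_det_row _ 0) !big_ord_recl big_ord0 /cofactor !det_mx11 !mxE /= addr0.
rewrite expr0 expr1 mul1r mulN1r mulrN.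
by congr (g _ _ * g _ _ - g _ _ * g _ _); apply: val_inj.
Qed.

Lemma rhoM g h : \det g = 1 -> \det h = 1 -> rho (g *m h) = rho g *m rho h.
Proof.
rewrite !det2 => D D'; rewrite /rho weil4_mul //.
have E (i j : 'I_2) : (g *m h) i j = g i 0 * h 0 j + g i 1 * h 1 j.
  rewrite mxE big_ord_recl big_ord1; congr (_ + g _ _ * h _ _); exact: val_inj.
by rewrite !E.
Qed.

(** The matrices 1 and -1 both act trivially: the quadratic character of -1 and the
oddness of the functions contribute two signs that cancel. *)
Lemma weil4_scalar a : a * a = 1 -> weil4 a 0 0 a = 1%:M.
Proof.
move=> aa1; have : (a == 1) || (a == -1) by rewrite -eqf_sqr expr2 aa1 expr1n.
have inj_aa (i j : 'I_5) : (aa j == aa i) = (i == j).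
  by move: i j; do 2 (case=> [[|[|[|[|[|//]]]]] ?]).
have opp_aa (i j : 'I_5) : (aa j == - aa i) = false.
  by move: i j; do 2 (case=> [[|[|[|[|[|//]]]]] ?]).
case/orP => /eqP ->; apply/matrixP => i j; rewrite !mxE /ker eqxx !mulr0 !mul0r /ch expr0 mulr1.
  by rewrite chi1 !mul1r inj_aa eqr_oppLR opp_aa subr0.
by rewrite chiN1 !mulN1r eqr_opp inj_aa opp_aa oppr0 add0r opprK.
Qed.

Lemma weil4_faithful a b c d : a * d - b * c = 1 -> weil4 a b c d = 1%:M ->
  [/\ b = 0, c = 0 & a = d].
Proof.
move=> D /matrixP W.
have nz2 : 2%:R != 0 :> F11 by [].
have [c0|nzc] := eqVneq c 0; last first.
  have := W o0 o1; rewrite !mxE /ker (negPf nzc) => /eqP.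
  rewrite -mulrBr mulf_eq0 mulf_eq0 (negPf (chi_neq0 F _)) /gam oppr_eq0 invr_eq0 (negPf (gauss_neq0 F0 z11 z1)) /=.
  rewrite subr_eq0 => /eqP E.
  have : ch (4%:R * aa o0 * aa o1 / (2%:R * c)) = 1.
    pose t := (a * aa o0 ^+ 2 - 2%:R * aa o0 * aa o1 + d * aa o1 ^+ 2) / (2%:R * c).
    apply: (mulIf (ch_neq0 z11 t)); rewrite mul1r [RHS]E -(chD z11); congr echar; rewrite /t; field.
    by rewrite nzc.
  move/eqP; rewrite (negPf (ch_neq1 z11 z1 _)) // !mulf_neq0 ?invr_eq0 ?mulf_neq0 ?aa_neq0 //.
rewrite c0 mulr0 subr0 in D *.
have := W o0 o0; rewrite !mxE /ker c0 eqxx aaE !mulr1 expr1n mulr1 /= => E.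
have nza : a != 0 by apply: contra_eq_neq D => ->; rewrite mul0r eq_sym oner_eq0.
have n11 : (-1 == 1 :> F11) = false by [].
have n12 : (1 == -1 :> F11) = false by [].
have [a1|na1] := eqVneq a 1.
  rewrite a1 chi1 !mul1r mulr1 in D E *.
  rewrite n11 mulr0 subr0 in E.
  split=> //; apply/eqP; have := ch_neq1 z11 z1 (x := b / 2%:R); rewrite E eqxx mulf_eq0 negb_or.
  by case: (b == 0) => // /(_ isT).
have [aN1|naN1] := eqVneq a (-1).
  rewrite aN1 chiN1 !mulN1r eqxx mulr1 opprK in D E *.
  rewrite n12 mulr0 add0r in E.
  split=> //; last by rewrite -D opprK.
  apply/eqP; have := ch_neq1 z11 z1 (x := - b / 2%:R); rewrite E eqxx mulf_eq0 oppr_eq0 negb_or.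
  by case: (b == 0) => // /(_ isT).
move/eqP: E; rewrite ![_ == a]eq_sym (negPf na1) (negPf naN1) mulr0 subrr eq_sym oner_eq0 //.
Qed.

Lemma tri_hess (x u v : 'rV[F]_5) : (u *m hess x *m v^T) 0 0 = tri x u v.
Proof. by rewrite mxE sum5 !mxE !sum5 !mxE /= /tri /tri5; ring. Qed.

(** Upper triangular unipotent matrices act by diagonal matrices, whose characters on
the monomials x_i^2 x_(i+1) are trivial because 2 + 3^2 = 0 modulo 11. *)
Lemma tri_diag (t : F11) (x u v : 'rV[F]_5) (D := diag_mx (\row_i ch (t * aa i ^+ 2))) :
  tri (x *m D) (u *m D) (v *m D) = tri x u v.
Proof.
have E (y : 'rV[F]_5) i : (y *m D) 0 i = ch (t * aa i ^+ 2) * y 0 i.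
  by rewrite mul_mx_diag !mxE mulrC.
have W i j : 2%:R * aa i ^+ 2 + aa j ^+ 2 == 0 -> ch (t * aa i ^+ 2) * ch (t * aa i ^+ 2) * ch (t * aa j ^+ 2) = 1.
  move=> /eqP Eij; rewrite -!(chD z11) -[RHS](ch0 z) -(mulr0 t) -Eij; congr echar; ring.
have W0 := W o0 o1 isT; have W1 := W o1 o2 isT; have W2 := W o2 o3 isT.
have W3 := W o3 o4 isT; have W4 := W o4 o0 isT.
rewrite /tri !E; move: W0 W1 W2 W3 W4.
move: (ch _) (ch _) (ch _) (ch _) (ch _) => c4 c3 c2 c1 c0 W0 W1 W2 W3 W4.
rewrite /tri5; transitivity (
  c0 * c0 * c1 * (x 0 o1 * u 0 o0 * v 0 o0 + x 0 o0 * u 0 o1 * v 0 o0 + x 0 o0 * u 0 o0 * v 0 o1) +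
  c1 * c1 * c2 * (x 0 o2 * u 0 o1 * v 0 o1 + x 0 o1 * u 0 o2 * v 0 o1 + x 0 o1 * u 0 o1 * v 0 o2) +
  c2 * c2 * c3 * (x 0 o3 * u 0 o2 * v 0 o2 + x 0 o2 * u 0 o3 * v 0 o2 + x 0 o2 * u 0 o2 * v 0 o3) +
  c3 * c3 * c4 * (x 0 o4 * u 0 o3 * v 0 o3 + x 0 o3 * u 0 o4 * v 0 o3 + x 0 o3 * u 0 o3 * v 0 o4) +
  c4 * c4 * c0 * (x 0 o0 * u 0 o4 * v 0 o4 + x 0 o4 * u 0 o0 * v 0 o4 + x 0 o4 * u 0 o4 * v 0 o0)).
  ring.
by rewrite W0 W1 W2 W3 W4 !mul1r.
Qed.
End WeilMatrices.

Section WeilInvariance.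
Variables (F : fieldType) (F0 : char_zero F) (z : F).
Hypotheses (z11 : z ^+ 11 = 1) (z1 : z != 1).
Local Notation ch := (echar z).
Local Notation weil4 := (weil4 z).

(** The entries of the Weyl matrix with c = 1 on the antidiagonals i + j = m, up to [gam];
c = 3^k shifts the index by k. *)
Definition wsv (m : nat) : F :=
  nth 0 [:: z ^+ 10 - z; z ^+ 8 - z ^+ 3; z ^+ 2 - z ^+ 9; z ^+ 6 - z ^+ 5; z ^+ 7 - z ^+ 4] m.

Lemma aaV k : (aa k)^-1 = 3%:R ^+ (5 - k).
Proof.
apply: (mulfI (aa_neq0 k)); rewrite mulfV ?aa_neq0 // /aa -exprD subnKC; last exact: ltnW.
exact: val_inj.
Qed.

Lemma chi_aa k : chi F (aa k) = 1.
Proof.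
rewrite /chi /aa -exprM mulnC exprM (_ : (3%:R : F11) ^+ 5 = 1) ?expr1n ?eqxx //.
exact: val_inj.
Qed.

Lemma weyl_entry k i j :
  weil4 0 (- (aa k)^-1) (aa k) 0 i j = gam z * wsv ((i + j + (5 - k)) %% 5).
Proof.
rewrite !mxE /ker (negPf (aa_neq0 k)) chi_aa !mul1r.
have nz2 : 2%:R != 0 :> F11 by [].
have E y : (0 * aa i ^+ 2 - 2%:R * aa i * y + 0 * y ^+ 2) / (2%:R * aa k) = - (aa i * y / aa k).
  by field; rewrite aa_neq0.
have N : - (aa i * - aa j / aa k) = aa i * aa j / aa k by rewrite mulrN mulNr opprK.
rewrite !E N -mulrBr; congr (_ * _).
rewrite aaV /aa -!exprD (_ : (3%:R : F11) ^+ (i + j + (5 - k)) = 3%:R ^+ ((i + j + (5 - k)) %% 5)); last first.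
  rewrite [in LHS](divn_eq (i + j + (5 - k)) 5) exprD mulnC exprM.
  have -> : (3%:R : F11) ^+ 5 = 1 by apply: val_inj.
  by rewrite expr1n mul1r.
by move: (_ %% 5)%N (ltn_pmod (i + j + (5 - k)) (isT : 0 < 5)%N) => [|[|[|[|[|//]]]]] _.
Qed.

Lemma weylN c : c != 0 -> weil4 0 (- (- c)^-1) (- c) 0 = weil4 0 (- c^-1) c 0.
Proof.
move=> nzc; apply/matrixP => i j; rewrite !mxE /ker oppr_eq0 (negPf nzc).
have nz2 : 2%:R != 0 :> F11 by [].
have chic : chi F (- c) = - chi F c by rewrite -mulN1r chiM ?oppr_eq0 ?oner_eq0 // chiN1 mulN1r.
rewrite chic.
have E y : (0 * aa i ^+ 2 - 2%:R * aa i * y + 0 * y ^+ 2) / (2%:R * - c) = (0 * aa i ^+ 2 - 2%:R * aa i * (- y) + 0 * (- y) ^+ 2) / (2%:R * c).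
  by field; rewrite oppr_eq0 nzc.
by rewrite !E opprK; ring.
Qed.

Lemma F11_aa (c : F11) : c != 0 -> exists k, c = aa k \/ c = - aa k.
Proof.
elim/F11_cases: c => // _.
- by exists o0; left; apply: val_inj.
- by exists o2; right; apply: val_inj.
- by exists o1; left; apply: val_inj.
- by exists o4; left; apply: val_inj.
- by exists o3; left; apply: val_inj.
- by exists o3; right; apply: val_inj.
- by exists o4; right; apply: val_inj.
- by exists o1; right; apply: val_inj.
- by exists o2; left; apply: val_inj.
- by exists o0; right; apply: val_inj.
Qed.

Lemma gam3 : gam z ^+ 3 * (11%:R * gauss z) = 1.
Proof.
have g0 := gauss_neq0 F0 z11 z1; have g2 := gauss_sq z11 z1.
have -> : gam z ^+ 3 * (11%:R * gauss z) = - 11%:R / gauss z ^+ 2 by rewrite /gam; field.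
by rewrite g2 mulfV // oppr_eq0; apply: F0.
Qed.

Lemma tri_weyl c (x u v : 'rV[F]_5) (W := weil4 0 (- c^-1) c 0) : c != 0 ->
  tri (x *m W) (u *m W) (v *m W) = tri x u v.
Proof.
rewrite /W {W} => nzc; wlog [k ->] : c nzc / exists k, c = aa k.
  move=> IH; have [k [Dc|Dc]] := F11_aa nzc; first by apply: IH => //; exists k.
  by rewrite Dc weylN ?aa_neq0 //; apply: IH; [exact: aa_neq0 | exists k].
have H0 := hankel_weil z11 z1.
have H1 := hankel_ok_shift H0; have H2 := hankel_ok_shift H1.
have H3 := hankel_ok_shift H2; have H4 := hankel_ok_shift H3.
have E (y : 'rV[F]_5) i : (y *m weil4 0 (- (aa k)^-1) (aa k) 0) 0 i =
   gam z * (wsv ((i + 0 + (5 - k)) %% 5) * y 0 o0 + wsv ((i + 1 + (5 - k)) %% 5) * y 0 o1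
     + wsv ((i + 2 + (5 - k)) %% 5) * y 0 o2 + wsv ((i + 3 + (5 - k)) %% 5) * y 0 o3
     + wsv ((i + 4 + (5 - k)) %% 5) * y 0 o4).
  rewrite mxE sum5 !weyl_entry ![(_ + i)%N]addnC; ring.
rewrite /tri !E; case: k {E} => [[|[|[|[|[|//]]]]] ltk].
- exact: etrans (tri5_hankel _ _ _ _ _ _ _ _ _ _ _ _ _ _ _ _ H0) (etrans (congr1 ( *%R^~ _) gam3) (mul1r _)).
- exact: etrans (tri5_hankel _ _ _ _ _ _ _ _ _ _ _ _ _ _ _ _ H4) (etrans (congr1 ( *%R^~ _) gam3) (mul1r _)).
- exact: etrans (tri5_hankel _ _ _ _ _ _ _ _ _ _ _ _ _ _ _ _ H3) (etrans (congr1 ( *%R^~ _) gam3) (mul1r _)).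
- exact: etrans (tri5_hankel _ _ _ _ _ _ _ _ _ _ _ _ _ _ _ _ H2) (etrans (congr1 ( *%R^~ _) gam3) (mul1r _)).
- exact: etrans (tri5_hankel _ _ _ _ _ _ _ _ _ _ _ _ _ _ _ _ H1) (etrans (congr1 ( *%R^~ _) gam3) (mul1r _)).
Qed.

(** The Bruhat decomposition of the matrices with c nonzero. *)
Lemma bruhat a b c d (D := fun t => diag_mx (\row_i ch (t * aa i ^+ 2))) : c != 0 ->
  weil4 a b c d = D (a / (2%:R * c)) *m weil4 0 (- c^-1) c 0 *m D (d / (2%:R * c)).
Proof.
move=> nzc; rewrite /D mul_mx_diag mul_diag_mx; apply/matrixP => i j; rewrite !mxE /ker (negPf nzc).
have E y : ch ((a * aa i ^+ 2 - 2%:R * aa i * y + d * y ^+ 2) / (2%:R * c)) =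
   ch (a / (2%:R * c) * aa i ^+ 2) * ch ((0 * aa i ^+ 2 - 2%:R * aa i * y + 0 * y ^+ 2) / (2%:R * c)) * ch (d / (2%:R * c) * y ^+ 2).
  rewrite -!(chD z11); congr echar; have nz2 : 2%:R != 0 :> F11 by []. by field; rewrite nzc.
by rewrite !E sqrrN; ring.
Qed.

(** A matrix with c = 0 is a product of two matrices with c nonzero. *)
Lemma generic_ind (P : 'M[F]_5 -> Prop) :
  (forall a b c d, a * d - b * c = 1 -> c != 0 -> P (weil4 a b c d)) ->
  (forall A B, P A -> P B -> P (A *m B)) ->
  forall g, \det g = 1 -> P (rho z g).
Proof.
move=> Pc PM g; rewrite det2 => D; rewrite /rho.
have [c0|nzc] := eqVneq (g 1 0) 0; last exact: Pc.
rewrite c0 mulr0 subr0 in D *; set a := g 0 0 in D *; set d := g 1 1 in D *; set b := g 0 1.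
have nzd : d != 0 by apply: contra_eq_neq D => ->; rewrite mulr0 eq_sym oner_eq0.
have -> : weil4 a b 0 d = weil4 b (- a) d 0 *m weil4 0 1 (-1) 0.
  rewrite weil4_mul // ?mulr0 ?mul0r ?mulr1 ?mulrN1 ?addr0 ?add0r ?opprK ?sub0r ?opprK //.
  by rewrite mulNr D opprK.
apply: PM; apply: Pc => //.
  by rewrite mulr0 sub0r mulNr D opprK.
by rewrite mulr0 sub0r mul1r opprK.
Qed.

Lemma tri_rho g (x u v : 'rV[F]_5) : \det g = 1 -> tri (x *m rho z g) (u *m rho z g) (v *m rho z g) = tri x u v.
Proof.
move=> Dg; move: x u v.
apply: (generic_ind (P := fun M => forall x u v : 'rV[F]_5, tri (x *m M) (u *m M) (v *m M) = tri x u v)) Dg => [a b c d _ nzc x u v|A B HA HB x u v]; last first.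
  by rewrite !mulmxA HB HA.
by rewrite (bruhat _ _ _ nzc) !mulmxA tri_diag // tri_weyl // tri_diag.
Qed.

(** On the generators the determinant is that of the operator attached to
(0, -1/c; c, 0), whose square is -1, which acts trivially. *)
Lemma det_rho g : \det g = 1 -> \det (rho z g) ^+ 2 = 1.
Proof.
apply: (generic_ind (P := fun M => \det M ^+ 2 = 1)) => [a b c d D nzc|A B HA HB]; last first.
  by rewrite det_mulmx exprMn HA HB mulr1.
have Ddiag t : \det (diag_mx (\row_i ch (t * aa i ^+ 2))) = 1.
  rewrite det_diag (eq_bigr (fun i => ch (t * aa i ^+ 2))) => [|i _]; last by rewrite mxE.
  have -> : \prod_i ch (t * aa i ^+ 2) = ch (t * \sum_i aa i ^+ 2).
    by rewrite mulr_sumr; elim/big_rec2: _ => // i y1 y2 _ ->; rewrite (chD z11).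
  have -> : \sum_i aa i ^+ 2 = 0 by rewrite sum5 !aaE; apply: val_inj.
  by rewrite mulr0.
rewrite (bruhat _ _ _ nzc) !det_mulmx !Ddiag mulr1 mul1r expr2 -det_mulmx weil4_mul //.
- by rewrite !mulr0 !mul0r ?add0r ?addr0 ?add0r mulNr mulrN mulVf // mulfV // weil4_scalar ?det1 // mulrNN mulr1.
- by rewrite mulr0 mulNr mulVf // sub0r opprK.
- by rewrite mulr0 mulNr mulVf // sub0r opprK.
Qed.

End WeilInvariance.

(** * The Klein cubic, its Hessian, and vectors of projective rank two *)

Definition quintic (R : comNzRingType) (x0 x1 x2 x3 x4 : R) : R :=
  3%:R * x0 * x1 * x2 * x3 * x4
  + x0 ^+ 3 * (x2 ^+ 2 - x3 * x4) + x1 ^+ 3 * (x3 ^+ 2 - x4 * x0) + x2 ^+ 3 * (x4 ^+ 2 - x0 * x1)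
  + x3 ^+ 3 * (x0 ^+ 2 - x1 * x2) + x4 ^+ 3 * (x1 ^+ 2 - x2 * x3).

(** Laplace expansion along the first row as a recursive function on entries indexed
by natural numbers, which evaluates by computation. *)
Fixpoint laplace (R : comNzRingType) n (m : nat -> nat -> R) : R :=
  if n isn't n'.+1 then 1 else
  foldr (fun k s => (-1) ^+ k * m 0%N k * laplace n' (fun i j => m i.+1 (bump k j)) + s) 0 (iota 0 n).

Lemma det_laplace (R : comNzRingType) n (m : nat -> nat -> R) :
  \det (\matrix_(i < n, j < n) m i j) = laplace n m.
Proof.
elim: n m => [|n IHn] m; first by rewrite det_mx00.
pose G k := (-1) ^+ k * m 0%N k * laplace n (fun i j => m i.+1 (bump k j)).
transitivity (\sum_(k < n.+1) G k).
  rewrite (expand_det_row _ ord0); apply: eq_bigr => k _.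
  rewrite /G -IHn /cofactor !mxE /= mulrCA mulrA; congr (_ * \det _).
  by apply/matrixP => i j; rewrite !mxE.
rewrite -(big_mkord xpredT G) /index_iota subn0 -[RHS]/(foldr (fun k s => G k + s) 0 (iota 0 n.+1)).
by elim: (iota 0 n.+1) => [|k s IHs]; rewrite ?big_nil ?big_cons //= IHs.
Qed.

Lemma det_hess (R : comNzRingType) (x : 'rV[R]_5) :
  \det (hess x) = quintic (x 0 o0) (x 0 o1) (x 0 o2) (x 0 o3) (x 0 o4).
Proof.
rewrite /hess (det_laplace 5 (fun i j => nth 0 (nth [::] [:: _; _; _; _; _] i) j)).
move: (x 0 o0) (x 0 o1) (x 0 o2) (x 0 o3) (x 0 o4) => x0 x1 x2 x3 x4.
rewrite /laplace /= /quintic; ring.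
Qed.

Definition klein (R : comNzRingType) (x0 x1 x2 x3 x4 : R) : R :=
  x0 ^+ 2 * x1 + x1 ^+ 2 * x2 + x2 ^+ 2 * x3 + x3 ^+ 2 * x4 + x4 ^+ 2 * x0.

(** In the chart x0 = 1, with coordinates y1, ..., y4, the cubic is
y4^2 + y3^2 y4 + resC, and modulo the cubic the quintic is resA + resB y4. *)
Definition resA (R : comNzRingType) (y1 y2 y3 : R) : R :=
  - 2%:R * y1 * y2 * y3 ^+ 3 - 2%:R * y1 * y2 ^+ 3 + 2%:R * y1 ^+ 3 * y3 ^+ 2 + y3 ^+ 3 + y2 ^+ 2
  - y1 ^+ 2 * y2 ^+ 4 - y2 ^+ 5 * y3 - y2 ^+ 3 * y3 ^+ 4 + y1 ^+ 4 * y2 * y3 ^+ 2.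

Definition resB (R : comNzRingType) (y1 y2 y3 : R) : R :=
  4%:R * y1 * y2 * y3 - 2%:R * y1 ^+ 3 - y3 - y1 ^+ 4 * y2 - y2 * y3 ^+ 5 + y1 ^+ 2 * y3 ^+ 4.

Definition resC (R : comNzRingType) (y1 y2 y3 : R) : R := y1 + y1 ^+ 2 * y2 + y2 ^+ 2 * y3.

(** The resultant in y4 of the cubic and the reduced quintic. *)
Definition resultant3 (R : comNzRingType) (y1 y2 y3 : R) : R :=
  resA y1 y2 y3 ^+ 2 - y3 ^+ 2 * resA y1 y2 y3 * resB y1 y2 y3 + resC y1 y2 y3 * resB y1 y2 y3 ^+ 2.

Lemma resultant3_zero (R : comNzRingType) (y1 y2 y3 y4 : R) :
  klein 1 y1 y2 y3 y4 = 0 -> quintic 1 y1 y2 y3 y4 = 0 -> resultant3 y1 y2 y3 = 0.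
Proof.
move=> H3 H5; have HA : resA y1 y2 y3 = - resB y1 y2 y3 * y4.
  apply/eqP; rewrite -subr_eq0; apply/eqP.
  transitivity (quintic 1 y1 y2 y3 y4 - klein 1 y1 y2 y3 y4 *
    ((y1 ^+ 2 - y2 * y3) * y4 + (y2 ^+ 3 - y3 ^+ 2 * (y1 ^+ 2 - y2 * y3)))).
    rewrite /resA /resB /quintic /klein; ring.
  by rewrite H3 H5 mul0r subrr.
transitivity (resB y1 y2 y3 ^+ 2 * klein 1 y1 y2 y3 y4); last by rewrite H3 mulr0.
rewrite /resultant3 HA /klein /resC; ring.
Qed.

Section ProjectiveRank.
Variables (C : fieldType) (C0 : char_zero C) (E : fieldType) (iota : {rmorphism C -> E}).
Local Notation cl2 := (cl2 (imC iota)).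

(** The resultant is a nontrivial relation between y1, y2 and y3 (its value at
(1, 0, 0) is 4), and y4 is a root of the cubic, monic in y4. *)
Lemma klein_rank2_chart y1 y2 y3 y4 : klein 1 y1 y2 y3 y4 = 0 -> quintic 1 y1 y2 y3 y4 = 0 ->
  exists z1 z2, [/\ cl2 z1 z2 y1, cl2 z1 z2 y2, cl2 z1 z2 y3 & cl2 z1 z2 (y4 : E)].
Proof.
move=> H3 H5.
pose i1 := @Ordinal 3 0 isT; pose i2 := @Ordinal 3 1 isT; pose i3 := @Ordinal 3 2 isT.
pose f : natfun C 3 := fun A phi x => resultant3 (x 0 i1) (x 0 i2) (x 0 i3).
have nf : natural f.
  move=> A B phi psi h _ x; rewrite /f !mxE /resultant3 /resA /resB /resC.
  ring.
have [||z1 [z2 [c1 c2 c3]]] := @rank3_dep C E iota f y1 y2 y3 1 0 0 nf.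
- by rewrite /f !mxE /= (resultant3_zero H3 H5).
- rewrite /f !mxE /= (_ : resultant3 1 0 0 = 4%:R); first exact: C0.
  rewrite /resultant3 /resA /resB /resC; ring.
exists z1, z2; split=> //; have Hcl := cl_closed (imC iota) (add1 (add1 (@none E) z1) z2).
have HS := relc_sub Hcl; set c := resC y1 y2 y3.
have cc : cl2 z1 z2 c.
  apply: (subfD HS); last by apply: (subfM HS) => //; exact: (subfX HS).
  by apply: (subfD HS) => //; apply: (subfM HS) => //; exact: (subfX HS).
apply: (relc_alg Hcl); exists ('X^2 + (y3 ^+ 2 *: 'X + c%:P)); split.
- rewrite -size_poly_eq0 size_polyDl ?size_polyXn // (leq_ltn_trans (size_polyD _ _)) // gtn_max.
  by rewrite (leq_ltn_trans (size_scale_leq _ _)) ?size_polyX // (leq_ltn_trans (size_polyC_leq1 _)).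
- move=> i; rewrite !coefD coefXn coefZ coefX coefC; apply: (subfD HS); first exact: (subf_nat HS).
  apply: (subfD HS); first by apply: (subfM HS); [exact: (subfX HS) | exact: (subf_nat HS)].
  by case: eqP => _ //; exact: (subf0 HS).
- rewrite rootE !hornerD hornerXn hornerZ hornerX hornerC; apply/eqP.
  by rewrite -[RHS]H3 /klein /c /resC; ring.
Qed.

(** The point of projective space lies on a subvariety of dimension at most 2 over
the constants. *)
Definition proj_rank2 n (x : 'rV[E]_n) :=
  exists j z1 z2, x 0 j != 0 /\ forall i, cl2 z1 z2 (x 0 i / x 0 j).

Lemma klein_rot (R : comNzRingType) (x0 x1 x2 x3 x4 : R) : klein x1 x2 x3 x4 x0 = klein x0 x1 x2 x3 x4.
Proof. by rewrite /klein; ring. Qed.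
Lemma quintic_rot (R : comNzRingType) (x0 x1 x2 x3 x4 : R) : quintic x1 x2 x3 x4 x0 = quintic x0 x1 x2 x3 x4.
Proof. by rewrite /quintic; ring. Qed.

Lemma klein_rank2_nz x0 x1 x2 x3 x4 : klein x0 x1 x2 x3 x4 = 0 -> quintic x0 x1 x2 x3 x4 = 0 -> x0 != 0 ->
  exists z1 z2, [/\ cl2 z1 z2 (x1 / x0), cl2 z1 z2 (x2 / x0), cl2 z1 z2 (x3 / x0) & cl2 z1 z2 (x4 / x0 : E)].
Proof.
move=> H3 H5 nz; apply: klein_rank2_chart.
  transitivity (klein x0 x1 x2 x3 x4 / x0 ^+ 3); last by rewrite H3 mul0r.
  by rewrite /klein; field.
transitivity (quintic x0 x1 x2 x3 x4 / x0 ^+ 5); last by rewrite H5 mul0r.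
by rewrite /quintic; field.
Qed.

Lemma klein_rank2 (x : 'rV[E]_5) : x != 0 ->
  klein (x 0 o0) (x 0 o1) (x 0 o2) (x 0 o3) (x 0 o4) = 0 ->
  quintic (x 0 o0) (x 0 o1) (x 0 o2) (x 0 o3) (x 0 o4) = 0 -> proj_rank2 x.
Proof.
move=> nzx; have [j nzj] : exists j, x 0 j != 0.
  apply: contrapT => /forallNP H; case/eqP: nzx; apply/rowP => i; rewrite [RHS]mxE.
  by apply/eqP/negPn/negP/H.
have case5 (P : 'I_5 -> Prop) : P o0 -> P o1 -> P o2 -> P o3 -> P o4 -> forall i, P i.
  by move=> P0 P1 P2 P3 P4 [[|[|[|[|[|//]]]]] lti]; rewrite (bool_irrelevance lti isT).
have one z1 z2 : cl2 z1 z2 (x 0 j / x 0 j).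
  by rewrite mulfV //; exact: subf1 (relc_sub (cl_closed _ _)).
move=> H3 H5; move: j nzj one; apply: (case5 _) => nz one.
- have [z1 [z2 [h1 h2 h3 h4]]] := klein_rank2_nz H3 H5 nz.
  by exists o0, z1, z2; split=> //; apply: case5.
- rewrite -klein_rot -quintic_rot in H3 H5.
  have [z1 [z2 [h1 h2 h3 h4]]] := klein_rank2_nz H3 H5 nz.
  by exists o1, z1, z2; split=> //; apply: case5.
- do 2 rewrite -klein_rot -quintic_rot in H3 H5.
  have [z1 [z2 [h1 h2 h3 h4]]] := klein_rank2_nz H3 H5 nz.
  by exists o2, z1, z2; split=> //; apply: case5.
- do 3 rewrite -klein_rot -quintic_rot in H3 H5.
  have [z1 [z2 [h1 h2 h3 h4]]] := klein_rank2_nz H3 H5 nz.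
  by exists o3, z1, z2; split=> //; apply: case5.
rewrite klein_rot quintic_rot in H3 H5.
have [z1 [z2 [h1 h2 h3 h4]]] := klein_rank2_nz H3 H5 nz.
by exists o4, z1, z2; split=> //; apply: case5.
Qed.

Lemma proj_rank2_lin m n (u : 'rV[E]_m) (B : 'M[C]_(m, n)) : proj_rank2 u ->
  u *m map_mx iota B != 0 -> proj_rank2 (u *m map_mx iota B).
Proof.
move=> [j [z1 [z2 [nzj Hu]]]] nzx; set x := u *m _ in nzx *.
have HS := relc_sub (cl_closed (imC iota) (add1 (add1 (@none E) z1) z2)).
have Hx i : cl2 z1 z2 (x 0 i / u 0 j).
  rewrite mxE mulr_suml; apply: (subf_sum HS) => l _; rewrite mulrAC mxE.
  by apply: (subfM HS); [exact: Hu | apply: (relc_base (cl_closed _ _)); exists (B l i)].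
have [j' nzj'] : exists j, x 0 j != 0.
  apply: contrapT => /forallNP H; case/eqP: nzx; apply/rowP => i; rewrite [RHS]mxE.
  by apply/eqP/negPn/negP/H.
exists j', z1, z2; split=> // i.
have -> : x 0 i / x 0 j' = (x 0 i / u 0 j) / (x 0 j' / u 0 j) by field; rewrite nzj nzj'.
by apply: (subf_div HS); exact: Hx.
Qed.

Lemma proj_rank2_small m (u : 'rV[E]_m) : (m <= 3)%N -> u != 0 -> proj_rank2 u.
Proof.
move=> lem nzu; have [j nzj] : exists j, u 0 j != 0.
  apply: contrapT => /forallNP H; case/eqP: nzu; apply/rowP => i; rewrite [RHS]mxE.
  by apply/eqP/negPn/negP/H.
have one z1 z2 : cl2 z1 z2 (u 0 j / u 0 j).
  by rewrite mulfV //; exact: subf1 (relc_sub (cl_closed _ _)).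
have [/existsP[i1 n1]|/existsPn H1] := boolP [exists i1, i1 != j]; last first.
  exists j, 0, 0; split=> // i; have /negPn/eqP -> := H1 i; exact: one.
have [/existsP[i2 n2]|/existsPn H2] := boolP [exists i2, i2 \notin [set j; i1]]; last first.
  exists j, (u 0 i1 / u 0 j), 0; split=> // i.
  by have := H2 i; rewrite negbK !inE => /orP[/eqP ->|/eqP ->]; [exact: one | exact: cl2_l].
exists j, (u 0 i1 / u 0 j), (u 0 i2 / u 0 j); split=> // i.
have : i \in [set j; i1; i2]%SET.
  apply/negPn/negP => ni; have := max_card (i |: [set j; i1; i2])%SET.
  rewrite cardsU1 ni card_ord [[set j; i1; i2]%SET]finset.setUC cardsU1 n2 cards2 eq_sym n1 /=.
  by move: lem; clear; lia.
rewrite !inE => /orP[/orP[]|] /eqP ->; [exact: one | exact: cl2_l | exact: cl2_r].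
Qed.

(** A hypersurface in projective 3-space.  The point c where f is not zero is first moved
along the j-th coordinate axis, so that its j-th coordinate is not zero either and it
is seen in the same chart as u. *)
Lemma proj_rank2_hypersurface d (f : natfun C 4) (u : 'rV[E]_4) (c : 'rV[C]_4) : natural f -> homog f d ->
  u != 0 -> f E iota u = 0 -> f C idfun c != 0 -> proj_rank2 u.
Proof.
move=> nf hf nzu fu fc; have [j nzj] : exists j, u 0 j != 0.
  apply: contrapT => /forallNP H; case/eqP: nzu; apply/rowP => i; rewrite [RHS]mxE.
  by apply/eqP/negPn/negP/H.
have one z1 z2 : cl2 z1 z2 (u 0 j / u 0 j).
  by rewrite mulfV //; exact: subf1 (relc_sub (cl_closed _ _)).
have [c' nzc' fc'] : exists2 c' : 'rV[C]_4, c' 0 j != 0 & f C idfun c' != 0.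
  pose P : 'rV[{poly C}]_4 := map_mx polyC c + 'X *: map_mx polyC (delta_mx 0 j).
  pose p := f _ (polyC \o (idfun : {rmorphism C -> C}) : {rmorphism C -> {poly C}}) P.
  have Ep s : p.[s] = f C idfun (c + s *: delta_mx 0 j).
    rewrite /p natural_horner //; congr (f _ _ _); apply/rowP => i; rewrite !mxE /=.
    by rewrite /horner_eval hornerD hornerM hornerX !hornerC.
  have nzp : p * ((c 0 j)%:P + 'X) != 0.
    rewrite mulf_neq0 //; last by rewrite addrC -(opprK (c 0 j)) polyCN -size_poly_eq0 size_XsubC.
    by apply: contraNneq fc => p0; have := Ep 0; rewrite p0 horner0 scale0r addr0 => <-.
  have [s Hs] : exists s, (p * ((c 0 j)%:P + 'X)).[s] != 0.
    apply: contrapT => /forallNP H; case/eqP: nzp; apply: (poly_eq_nonzero C0) => s _.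
    by rewrite horner0; apply/eqP/negPn/negP/H.
  move: Hs; rewrite hornerM mulf_eq0 negb_or hornerD hornerC hornerX => /andP[ps cs].
  by exists (c + s *: delta_mx 0 j); rewrite -?Ep // !mxE !eqxx mulr1.
pose ins (A : comNzRingType) (y : 'rV[A]_3) : 'rV[A]_4 := \row_i oapp (y 0) 1 (unlift j i).
pose g : natfun C 3 := fun A phi y => f A phi (ins A y).
have ng : natural g.
  move=> A B phi psi h hphi y; rewrite /g -(nf _ _ phi psi h hphi); congr (f _ _ _).
  by apply/rowP => i; rewrite !mxE; case: unliftP => [k _|_] /=; rewrite ?mxE ?rmorph1.
pose y k := u 0 (lift j k) / u 0 j; pose b k := c' 0 (lift j k) / c' 0 j.
pose i1 := @Ordinal 3 0 isT; pose i2 := @Ordinal 3 1 isT; pose i3 := @Ordinal 3 2 isT.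
have ins3 (A : fieldType) (w : 'rV[A]_4) : w 0 j != 0 ->
   ins A (row3 (w 0 (lift j i1) / w 0 j) (w 0 (lift j i2) / w 0 j) (w 0 (lift j i3) / w 0 j)) = (w 0 j)^-1 *: w.
  move=> nzw; apply/rowP => i; rewrite !mxE; case: unliftP => [k ->|->] /=; last by rewrite mulVf.
  rewrite !mxE [RHS]mulrC; case: k => [[|[|[|//]]] ltk] /=; congr (w 0 (lift j _) / _); exact: val_inj.
have [||z1 [z2 [h1 h2 h3]]] := @rank3_dep C E iota g (y i1) (y i2) (y i3) (b i1) (b i2) (b i3) ng.
- by rewrite /g ins3 // hf fu mulr0.
- by rewrite /g ins3 // hf mulf_neq0 // expf_neq0 // invr_eq0.
exists j, z1, z2; split=> // i; case: (unliftP j i) => [k ->|->]; last exact: one.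
case: k => [[|[|[|//]]] ltk].
- by rewrite (_ : Ordinal ltk = i1) //; apply: val_inj.
- by rewrite (_ : Ordinal ltk = i2) //; apply: val_inj.
- by rewrite (_ : Ordinal ltk = i3) //; apply: val_inj.
Qed.
End ProjectiveRank.

Lemma triC12 (A : comNzRingType) (x u v : 'rV[A]_5) : tri x u v = tri u x v.
Proof. by rewrite /tri /tri5; ring. Qed.
Lemma triC23 (A : comNzRingType) (x u v : 'rV[A]_5) : tri x u v = tri x v u.
Proof. by rewrite /tri /tri5; ring. Qed.
Lemma triD (A : comNzRingType) (x u v w : 'rV[A]_5) : tri x u (v + w) = tri x u v + tri x u w.
Proof. by rewrite /tri !mxE /tri5; ring. Qed.
Lemma triDm (A : comNzRingType) (x u v w : 'rV[A]_5) : tri x (u + v) w = tri x u w + tri x v w.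
Proof. by rewrite !(triC23 _ _ w) triD. Qed.
Lemma triZ (A : comNzRingType) (x u v : 'rV[A]_5) c : tri x u (c *: v) = c * tri x u v.
Proof. by rewrite /tri !mxE /tri5; ring. Qed.

Lemma tri_polar3 (A : comNzRingType) (x u v : 'rV[A]_5) : 6%:R * tri x u v =
  tri (x + u + v) (x + u + v) (x + u + v) - tri (x + u) (x + u) (x + u) - tri (x + v) (x + v) (x + v)
  - tri (u + v) (u + v) (u + v) + tri x x x + tri u u u + tri v v v.
Proof.
by rewrite /tri !mxE /tri5; ring.
Qed.

Lemma tri_polar2 (A : comNzRingType) (x u v : 'rV[A]_5) :
  2%:R * tri x u v = tri x (u + v) (u + v) - tri x u u - tri x v v.
Proof. by rewrite !triD !(triC23 x (u + v)) !triD (triC23 x v u); ring. Qed.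

Lemma tri_map (A B : comNzRingType) (h : {rmorphism A -> B}) (x u v : 'rV[A]_5) :
  tri (map_mx h x) (map_mx h u) (map_mx h v) = h (tri x u v).
Proof. by rewrite /tri !mxE /tri5; ring. Qed.

Lemma tri_klein (A : comNzRingType) (x : 'rV[A]_5) :
  tri x x x = 3%:R * klein (x 0 o0) (x 0 o1) (x 0 o2) (x 0 o3) (x 0 o4).
Proof. by rewrite /tri /tri5 /klein; ring. Qed.

Lemma map_hess (A B : comNzRingType) (h : {rmorphism A -> B}) (x : 'rV[A]_5) :
  map_mx h (hess x) = hess (map_mx h x).
Proof.
apply/matrixP => i j; rewrite !mxE.
by case: i j => [[|[|[|[|[|//]]]]] ?] [[|[|[|[|[|//]]]]] ?] /=; rewrite ?rmorph0.
Qed.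

Lemma hessZ (A : comNzRingType) (x : 'rV[A]_5) c : hess (c *: x) = c *: hess x.
Proof.
apply/matrixP => i j; rewrite !mxE.
by case: i j => [[|[|[|[|[|//]]]]] ?] [[|[|[|[|[|//]]]]] ?] /=; rewrite ?mulr0.
Qed.

Lemma hess_eq0 (F : fieldType) (x : 'rV[F]_5) : hess x = 0 -> x = 0.
Proof.
move=> /matrixP H; apply/rowP => i; rewrite [RHS]mxE.
have e0 := H o0 o1; have e1 := H o0 o0; have e2 := H o1 o1; have e3 := H o2 o2; have e4 := H o3 o3.
rewrite !mxE /= in e0 e1 e2 e3 e4.
by case: i => [[|[|[|[|[|//]]]]] lti]; rewrite (bool_irrelevance lti isT).
Qed.

(** The invariant forms; the last one is a polar form of the cubic. *)
Definition cubic_fun (C : fieldType) : natfun C 5 := fun A phi x => tri x x x.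
Definition quintic_fun (C : fieldType) : natfun C 5 := fun A phi x => \det (hess x).
Definition quadric_fun (C : fieldType) (w : 'rV[C]_5) : natfun C 5 := fun A phi x => tri (map_mx phi w) x x.

Lemma cubic_fun_natural C : natural (@cubic_fun C).
Proof. by move=> A B phi psi h _ x; exact: tri_map. Qed.
Lemma cubic_fun_homog C : homog (@cubic_fun C) 3.
Proof. by move=> A phi c x; rewrite /cubic_fun triZ triC23 triZ triC12 triC23 triZ; ring. Qed.
Lemma quintic_fun_natural C : natural (@quintic_fun C).
Proof. by move=> A B phi psi h _ x; rewrite /quintic_fun -map_hess det_map_mx. Qed.
Lemma quintic_fun_homog C : homog (@quintic_fun C) 5.
Proof. by move=> A phi c x; rewrite /quintic_fun hessZ detZ. Qed.
Lemma quadric_fun_natural C w : natural (@quadric_fun C w).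
Proof.
move=> A B phi psi h hphi x; rewrite /quadric_fun -tri_map; congr (tri _ _ _).
by apply/rowP => i; rewrite !mxE.
Qed.
Lemma quadric_fun_homog C w : homog (@quadric_fun C w) 2.
Proof. by move=> A phi c x; rewrite /quadric_fun triZ triC23 triZ; ring. Qed.

(** For an n that is equal to 4 only propositionally, such as the rank of a matrix. *)
Lemma proj_rank2_hypersurface_eq n (C : fieldType) (C0 : char_zero C) (E : fieldType) (iota : {rmorphism C -> E})
  d (f : natfun C n) (u : 'rV[E]_n) (c : 'rV[C]_n) : n = 4%N -> natural f -> homog f d ->
  u != 0 -> f E iota u = 0 -> f C idfun c != 0 -> proj_rank2 iota u.
Proof. by move=> n4; move: f u c; rewrite n4 => f u c; exact: proj_rank2_hypersurface. Qed.

(** * Galois descent over the hull *)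

Section Descent.
Variables (M E : fieldType) (v : {rmorphism M -> E}).
Variables (gT : finGroupType) (G : {group gT}) (t : gT -> E) (r : gT -> {poly M}) (W : {poly M}).
Hypotheses (t_inj : {in G &, injective t})
  (r_t : forall s u, s \in G -> u \in G -> (map_poly v (r s)).[t u] = t (s * u)%g)
  (WE : map_poly v W = \prod_(s in G) ('X - (t s)%:P)).

(** The point t s is the conjugate under s of a primitive element t 1, and r s is a
polynomial expressing it through t 1; W has all conjugates for roots.  A polynomial p
over M stands for the element p(t 1) of M(t 1), of which ev s p is the conjugate. *)
Definition ev (s : gT) (p : {poly M}) : E := (map_poly v p).[t s].
Fact ev_zmod s : zmod_morphism (ev s).
Proof. by move=> p q; rewrite /ev rmorphB hornerD hornerN. Qed.
Fact ev_monoid s : monoid_morphism (ev s).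
Proof. by split=> [|p q]; rewrite /ev ?rmorph1 ?hornerC // rmorphM hornerM. Qed.
HB.instance Definition _ s := GRing.isZmodMorphism.Build {poly M} E (ev s) (ev_zmod s).
HB.instance Definition _ s := GRing.isMonoidMorphism.Build {poly M} E (ev s) (ev_monoid s).

Lemma evD s p q : ev s (p + q) = ev s p + ev s q. Proof. exact: rmorphD. Qed.
Lemma evB s p q : ev s (p - q) = ev s p - ev s q. Proof. exact: rmorphB. Qed.
Lemma evM s p q : ev s (p * q) = ev s p * ev s q. Proof. exact: rmorphM. Qed.
Lemma ev_exp s p k : ev s (p ^+ k) = ev s p ^+ k. Proof. exact: rmorphXn. Qed.
Lemma evC s c : ev s c%:P = v c. Proof. by rewrite /ev map_polyC hornerC. Qed.
Lemma evX s : ev s 'X = t s. Proof. by rewrite /ev map_polyX hornerX. Qed.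

(** The Galois group of M(t 1) over M: the conjugates that satisfy all the algebraic
relations of t 1 over M. *)
Definition stabM : {set gT} := [set s in G | `[< forall p, ev 1%g p = 0 -> ev s p = 0 >]]%SET.

Lemma stabM_sub : {subset stabM <= G}. Proof. by move=> s; rewrite inE => /andP[]. Qed.
Lemma stabMP s : s \in stabM -> forall p, ev 1%g p = 0 -> ev s p = 0.
Proof. by rewrite inE => /andP[_ /asboolP]. Qed.

Lemma stabM_group_set : group_set stabM.
Proof.
apply/group_setP; split; first by rewrite inE group1; apply/asboolP.
move=> s u Ss Su; have [Gs Gu] := (stabM_sub Ss, stabM_sub Su).
rewrite inE groupM //=; apply/asboolP => p p1.
have Ew w : w \in G -> ev w (p \Po r s) = ev (s * w)%g p.
  by move=> Gw; rewrite /ev map_comp_poly horner_comp r_t.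
rewrite -Ew //; apply: (stabMP Su); rewrite Ew ?group1 // mulg1.
exact: (stabMP Ss).
Qed.
Canonical stabM_group := Group stabM_group_set.

(** The minimal polynomial of t 1 divides W, so its roots are conjugates t s, and those
s belong to the stabilizer. *)
Lemma exists_minpoly : exists q : {poly M}, [/\ q != 0, ev 1%g q = 0,
  forall p, ev 1%g p = 0 -> q %| p & (size q <= #|stabM|.+1)%N].
Proof.
have evW : ev 1%g W = 0.
  by rewrite /ev WE horner_prod (bigD1 1%g) //= hornerXsubC subrr mul0r.
have nzW : W != 0.
  by rewrite -(map_poly_eq0 v) WE; apply: monic_neq0; apply: monic_prod_XsubC.
pose Q n := `[< exists q : {poly M}, [/\ q != 0, ev 1%g q = 0 & size q = n] >].
have exQ : exists n, Q n by exists (size W); apply/asboolP; exists W.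
case: (ex_minnP exQ) => n /asboolP[q [nzq q1 szq]] min_n.
have q_dvd p : ev 1%g p = 0 -> q %| p.
  move=> p1; apply/modp_eq0P/eqP/negPn/negP => nzr.
  have r1 : ev 1%g (p %% q) = 0.
    by move: p1; rewrite {1}(divp_eq p q) evD evM q1 mulr0 add0r.
  have /min_n : Q (size (p %% q)) by apply/asboolP; exists (p %% q).
  by rewrite -szq leqNgt ltn_modp nzq.
exists q; split=> //.
have qW : map_poly v q %| \prod_(x <- [seq t s | s <- enum G]) ('X - x%:P).
  by rewrite big_map big_enum /= -WE dvdp_map; exact: q_dvd.
have [m Dq] := dvdp_prod_XsubC qW.
rewrite -(size_map_poly v) (eqp_size Dq) size_prod_XsubC ltnS.
have uniqm : uniq (mask m [seq t s | s <- enum G]).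
  by rewrite mask_uniq // map_inj_in_uniq ?enum_uniq // => s u; rewrite !mem_enum; exact: t_inj.
rewrite cardE -(size_map t); apply: uniq_leq_size => // x xm.
have /mapP[s Gs Ex] := mem_mask xm; rewrite mem_enum in Gs.
apply/mapP; exists s => //; rewrite mem_enum inE Gs; apply/asboolP => p /q_dvd /dvdpP[p' ->].
rewrite evM; suff -> : ev s q = 0 by rewrite mulr0.
by apply/rootP; rewrite (eqp_root Dq) root_prod_XsubC -Ex.
Qed.

(** Modulo the minimal polynomial p has degree less than the order of the group, and it
takes the same value at all t s; so it is constant. *)
Lemma descent p : (forall s, s \in stabM -> ev s p = ev 1%g p) -> exists c, v c = ev 1%g p.
Proof.
move=> Hp; have [q [nzq q1 q_dvd szq]] := exists_minpoly.
pose p' := p %% q; set c := ev 1%g p in Hp *.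
have Hp' s : s \in stabM -> ev s p' = c.
  move=> Ss; rewrite -(Hp s Ss) [in RHS](divp_eq p q) evD evM.
  by rewrite (stabMP Ss q1) mulr0 add0r.
have S_gt0 : (0 < #|stabM|)%N by apply/card_gt0P; exists 1%g; exact: (group1 stabM_group).
have szp' : (size p' <= #|stabM|)%N by rewrite -ltnS (leq_trans _ szq) // ltn_modp.
have D : map_poly v p' = c%:P.
  apply/eqP; rewrite -subr_eq0; apply/negPn/negP => nz.
  have /(max_poly_roots nz) : all (root (map_poly v p' - c%:P)) [seq t s | s <- enum stabM].
    apply/allP => x /mapP[s]; rewrite mem_enum => Ss ->.
    by rewrite rootE hornerD hornerN hornerC -/(ev s p') Hp' // subrr.
  rewrite map_inj_in_uniq ?enum_uniq => [/(_ isT)|s u]; last first.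
    by rewrite !mem_enum => /stabM_sub Gs /stabM_sub Gu; exact: t_inj.
  rewrite size_map -cardE; apply/negP; rewrite -leqNgt (leq_trans (size_polyD _ _)) //.
  by rewrite geq_max size_map_poly szp' size_polyN (leq_trans (size_polyC_leq1 _)).
exists p'`_0; by rewrite -coef_map D coefC.
Qed.

Variables (C : fieldType) (iota : {rmorphism C -> E}) (jC : {rmorphism C -> M}).
Hypothesis vj : forall c, v (jC c) = iota c.
Variables (n : nat) (rh : gT -> 'M[C]_n).
Hypotheses (rhM : {in G &, {morph rh : s u / (s * u)%g >-> s *m u}}) (rh1 : rh 1%g = 1%:M).
Local Notation S := stabM.
Local Notation act s := (map_mx iota (rh s)).

(** Vectors over M(t 1) on which conjugation acts as the inverse of the representation. *)
Definition equivariant (P : 'rV[{poly M}]_n) :=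
  forall s, s \in S -> map_mx (ev s) P *m act s = map_mx (ev 1%g) P.

(** The trace of the vector (t 1)^k w for the twisted action of the group. *)
Definition orbit_vec k (w : 'rV[C]_n) : 'rV[{poly M}]_n :=
  \sum_(s in S) r s ^+ k *: map_mx (polyC \o jC) (w *m rh s).

Lemma ev_orbit_vec k w u : u \in S ->
  map_mx (ev u) (orbit_vec k w) = \sum_(s in S) t (s * u)%g ^+ k *: map_mx iota (w *m rh s).
Proof.
move=> Su; rewrite /orbit_vec raddf_sum; apply: eq_bigr => s Ss; apply/rowP => i.
rewrite !mxE /= evM ev_exp evC vj; congr (_ ^+ _ * _).
by rewrite /ev r_t ?stabM_sub.
Qed.

Lemma orbit_vec_equivariant k w : equivariant (orbit_vec k w).
Proof.
move=> u Su; rewrite !ev_orbit_vec ?(group1 stabM_group) // mulmx_suml.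
rewrite [RHS](reindex_inj (mulIg u)) /=; apply: eq_big => [s|s Ss].
  by rewrite (groupMr (G := stabM_group)).
by rewrite -scalemxAl -map_mxM -mulmxA rhM ?stabM_sub // mulg1.
Qed.

Lemma equivariant_comb m (P : 'I_m -> 'rV[{poly M}]_n) (c : 'I_m -> M) :
  (forall i, equivariant (P i)) -> equivariant (\sum_i (c i)%:P *: P i).
Proof.
have Es s : map_mx (ev s) (\sum_i (c i)%:P *: P i) = \sum_i v (c i) *: map_mx (ev s) (P i).
  rewrite raddf_sum; apply: eq_bigr => i _; apply/rowP => j.
  by rewrite !mxE /= evM evC.
move=> HP s Ss; rewrite !Es mulmx_suml; apply: eq_bigr => i _.
by rewrite -scalemxAl HP.
Qed.

(** Conjugation is trivial on a vector over M. *)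
Lemma equivariant_rational P : equivariant P -> (forall i, exists c, v c = ev 1%g (P 0 i)) ->
  forall s, s \in S -> map_mx (ev 1%g) P *m act s = map_mx (ev 1%g) P.
Proof.
move=> eP HP s Ss; rewrite -[RHS](eP s Ss); congr (_ *m _); apply/rowP => i; rewrite !mxE.
have [c Dc] := HP i; have : ev 1%g (P 0 i - c%:P) = 0 by rewrite evB evC -Dc subrr.
by move/(stabMP Ss)/eqP; rewrite evB evC subr_eq0 Dc => /eqP.
Qed.

Lemma invariant_rational (f : natfun C n) P : natural f -> equivariant P ->
  (forall s, s \in S -> forall x, f E iota (x *m act s) = f E iota x) ->
  exists c, v c = f E iota (map_mx (ev 1%g) P).
Proof.
move=> nf eP fS; pose p := f _ (polyC \o jC : {rmorphism C -> {poly M}}) P.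
have Ep s : ev s p = f E iota (map_mx (ev s) P).
  by rewrite /p -(nf _ _ (polyC \o jC : {rmorphism C -> {poly M}}) iota (ev s)) // => c; rewrite /= evC.
rewrite -Ep; apply: descent => s Ss.
by rewrite !Ep -(eP s Ss) fS.
Qed.
End Descent.

(** * Equivariant vectors of projective rank two *)

Lemma map_prod_XsubC (A B : comNzRingType) (h : {rmorphism A -> B}) (I : Type) (s : seq I) (a : I -> A) :
  map_poly h (\prod_(i <- s) ('X - (a i)%:P)) = \prod_(i <- s) ('X - (h (a i))%:P).
Proof.
by elim: s => [|i s IHs]; rewrite ?big_nil ?rmorph1 // !big_cons rmorphM /= IHs map_polyXsubC.
Qed.

Lemma prod_XsubC_scale (A : comNzRingType) (I : Type) (s : seq I) (a : I -> A) c k :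
  (\prod_(i <- s) ('X - (c * a i)%:P))`_k = c ^+ (size s - k) * (\prod_(i <- s) ('X - (a i)%:P))`_k.
Proof.
have szP (b : I -> A) (u : seq I) l : (size u < l)%N -> (\prod_(i <- u) ('X - (b i)%:P))`_l = 0.
  by move=> lt_l; rewrite nth_default // size_prod_XsubC.
elim: s k => [|i s IHs] k.
  by rewrite !big_nil coef1 sub0n expr0 mul1r.
rewrite !big_cons !mulrBl !coefB !coefXM !coefCM; case: k => [|k] /=.
  by rewrite !sub0r IHs !subn0 exprS; ring.
rewrite subSS !IHs; have [lek|ltk] := leqP k.+1 (size s); last first.
  by rewrite (szP _ _ k.+1) // !mulr0 !subr0.
have -> : (size s - k = (size s - k.+1).+1)%N by rewrite subnSK.
by rewrite exprS; ring.
Qed.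

Section Equivariant.
Variables (E : fieldType) (Ecl : closedF E) (E0 : char_zero E).
Variables (C : fieldType) (C0 : char_zero C) (iota : {rmorphism C -> E}).
Variables (K : E -> Prop) (HK : subfieldP K) (CK : forall x, imC iota x -> K x).
Local Notation M := (subf (hull_subfield (imC iota) HK)).
Local Notation v := (@subf_val E _ (hull_subfield (imC iota) HK)).
Variables (gT : finGroupType) (G : {group gT}) (t : gT -> E) (r : gT -> {poly M}) (W : {poly M}).
Hypotheses (t_inj : {in G &, injective t})
  (r_t : forall s u, s \in G -> u \in G -> (map_poly v (r s)).[t u] = t (s * u)%g)
  (WE : map_poly v W = \prod_(s in G) ('X - (t s)%:P)).
Variable rh : gT -> 'M[C]_5.
Hypotheses (rhM : {in G &, {morph rh : s u / (s * u)%g >-> s *m u}}) (rh1 : rh 1%g = 1%:M).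
Local Notation S := (stabM v G t).
Local Notation act s := (map_mx iota (rh s)).
Local Notation ev := (ev v t).
Local Notation equivariant := (equivariant v G t iota rh).

Let Sgroup : {group gT} := stabM_group r_t.
Let S1 : 1%g \in S := group1 Sgroup.
Let SG s : s \in S -> s \in G. Proof. exact: stabM_sub. Qed.
Let S_gt0 : (0 < #|S|)%N. Proof. by apply/card_gt0P; exists 1%g. Qed.
Let nzS : #|S|%:R != 0 :> C.
Proof. by rewrite -(prednK S_gt0); apply: C0. Qed.

Let jC_ex : exists jC : {rmorphism C -> M}, forall c, v (jC c) = iota c.
Proof. by apply: lift_rmorph => c; apply: subf_ex; apply: hull_base; apply: CK; exists c. Qed.

(** The projection on the vectors fixed by S, and the complementary projection on the sum
of the nontrivial subrepresentations. *)
Definition avg : 'M[C]_5 := #|S|%:R^-1 *: \sum_(s in S) rh s.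
Definition prj : 'M[C]_5 := 1%:M - avg.

Lemma rh_avg s : s \in S -> rh s *m avg = avg.
Proof.
move=> Ss; rewrite /avg -scalemxAr mulmx_sumr; congr (_ *: _).
rewrite [RHS](reindex_inj (mulgI s)) /=; apply: eq_big => [u|u Su].
  by rewrite (groupMl (G := Sgroup)).
by rewrite rhM ?SG.
Qed.

Lemma avg_rh s : s \in S -> avg *m rh s = avg.
Proof.
move=> Ss; rewrite /avg -scalemxAl mulmx_suml; congr (_ *: _).
rewrite [RHS](reindex_inj (mulIg s)) /=; apply: eq_big => [u|u Su].
  by rewrite (groupMr (G := Sgroup)).
by rewrite rhM ?SG.
Qed.

Lemma fixed_avg (x : 'rV[E]_5) : (forall s, s \in S -> x *m act s = x) -> x *m map_mx iota avg = x.
Proof.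
move=> fx; rewrite /avg map_mxZ fmorphV rmorph_nat raddf_sum -scalemxAr mulmx_sumr.
rewrite (eq_bigr (fun=> x)) => [|s Ss]; last exact: fx.
have nzSE : #|S|%:R != 0 :> E by rewrite -(rmorph_nat iota) fmorph_eq0.
by rewrite sumr_const -scaler_nat scalerA mulVf // scale1r.
Qed.

Lemma avgK : avg *m avg = avg.
Proof.
rewrite {1}/avg -scalemxAl mulmx_suml (eq_bigr (fun=> avg)) => [|s Ss]; last exact: rh_avg.
by rewrite sumr_const -scaler_nat scalerA mulVf // scale1r.
Qed.

Lemma prjD_avg : prj + avg = 1%:M. Proof. exact: subrK. Qed.

Lemma prj_avg : prj *m avg = 0. Proof. by rewrite mulmxBl mul1mx avgK subrr. Qed.

Lemma prj_rh s : s \in S -> prj *m rh s = rh s *m prj.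
Proof. by move=> Ss; rewrite mulmxBl mulmxBr mul1mx mulmx1 avg_rh // rh_avg. Qed.

(** The coefficients of the polynomial whose roots are the i-th coordinates of the images
of x under S: invariants of S over which that coordinate is integral. *)
Definition orbit_coef i k : natfun C 5 := fun A phi x =>
  (\prod_(s <- enum S) ('X - ((x *m map_mx phi (rh s)) 0 i)%:P))`_k.

Lemma orbit_coef_natural i k : natural (orbit_coef i k).
Proof.
move=> A B phi psi h hphi x; rewrite /orbit_coef -coef_map map_prod_XsubC; congr (_`_k).
have Em s : map_mx psi (rh s) = map_mx h (map_mx phi (rh s)).
  by apply/matrixP => a b; rewrite !mxE.
by under eq_bigr => s _ do rewrite Em -map_mxM mxE.
Qed.

Lemma orbit_coef_homog i k : homog (orbit_coef i k) (#|S| - k).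
Proof.
move=> A phi c x; rewrite /orbit_coef cardE -prod_XsubC_scale; congr (_`_k).
by under eq_bigr => s _ do rewrite -scalemxAl mxE.
Qed.

Lemma orbit_coef_inv i k s x : s \in S -> orbit_coef i k iota (x *m act s) = orbit_coef i k iota x.
Proof.
move=> Ss; rewrite /orbit_coef; apply: (congr1 (fun p : {poly E} => p`_k)).
rewrite !big_enum /= [RHS](reindex_inj (mulgI s)) /=.
under [RHS]eq_bigl => u do rewrite (groupMl (G := Sgroup)) //.
by under [RHS]eq_bigr => u Su do rewrite rhM ?SG // map_mxM mulmxA.
Qed.

Lemma orbit_coef_root i (x : 'rV[E]_5) :
  \sum_(k < #|S|.+1) orbit_coef i k iota x * (x 0 i) ^+ k = 0.
Proof.
set p := \prod_(s <- enum S) ('X - ((x *m act s) 0 i)%:P).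
have szp : size p = #|S|.+1 by rewrite size_prod_XsubC cardE.
have : root p (x 0 i).
  rewrite /p -(big_map (fun s => (x *m act s) 0 i) xpredT (fun a => 'X - a%:P)) root_prod_XsubC.
  by apply/mapP; exists 1%g; rewrite ?mem_enum // rh1 map_mx1 mulmx1.
by move/rootP; rewrite horner_coef szp.
Qed.

Lemma orbit_coef_top i (x : 'rV[E]_5) : orbit_coef i #|S| iota x = 1.
Proof.
rewrite /orbit_coef; set p := \prod_(s <- _) _.
have /monicP : p \is monic by exact: monic_prod_XsubC.
by rewrite /lead_coef size_prod_XsubC -cardE.
Qed.

Lemma equivariantZ c P : equivariant P -> equivariant (c%:P *: P).
Proof.
have [jC vj] := jC_ex.
move=> eP; have := equivariant_comb (rh := rh) (iota := iota) (P := fun _ : 'I_1 => P) (fun=> c) (fun=> eP).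
by rewrite big_ord1.
Qed.

(** Some nonconstant coefficient of the orbit polynomial of the nonzero coordinate j is not
zero at x; the inverse of its value has a root mu in M, by which x is rescaled to x'.
Then the coordinates of x' are algebraic over two elements ([cl2_unproject]), and over the
invariants at x', which are in M; [hull_rank2] puts them in M.  So S fixes x'. *)
Lemma no_rank2_vector P : equivariant P -> let x := map_mx (ev 1%g) P in
  x *m map_mx iota prj = x -> x != 0 -> proj_rank2 iota x -> False.
Proof.
move=> eP x xprj nzx [j [z1 [z2 [nzj Hz]]]]; have [jC vj] := jC_ex.
have [k ltk nzc] : exists2 k, (k < #|S|)%N & orbit_coef j k iota x != 0.
  apply: contrapT => H; have := orbit_coef_root j x; rewrite big_ord_recr /= orbit_coef_top mul1r.
  rewrite big1 ?add0r => [/eqP|k _]; first by rewrite expf_eq0 (negPf nzj) andbF.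
  have [->|nz] := eqVneq (orbit_coef j k iota x) 0; first by rewrite mul0r.
  by case: H; exists k.
have inv f : natural f -> (forall s, s \in S -> forall x, f E iota (x *m act s) = f E iota x) ->
    forall P, equivariant P -> exists c, v c = f E iota (map_mx (ev 1%g) P).
  by move=> nf fS P' eP'; exact: (invariant_rational t_inj r_t WE vj nf eP' fS).
have [c Dc] := inv _ (orbit_coef_natural j k) (fun s Ss x => orbit_coef_inv j k x Ss) P eP.
have d_gt0 : (0 < #|S| - k)%N by rewrite subn_gt0.
have [mu Dmu] := hull_nthroot Ecl c^-1 d_gt0.
pose P' := mu%:P *: P; have eP' : equivariant P' := equivariantZ mu eP.
pose x' := map_mx (ev 1%g) P'.
have Dx' : x' = v mu *: x by apply/rowP => i; rewrite !mxE evM evC.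
have fx' : orbit_coef j k iota x' = 1.
  have Dv : v mu ^+ (#|S| - k) = (orbit_coef j k iota x)^-1.
    transitivity (v c)^-1; last by congr (_^-1).
    by rewrite -fmorphV -Dmu rmorphXn.
  by rewrite Dx' orbit_coef_homog Dv mulVf.
have nzmu : v mu != 0.
  apply: contraTneq (oner_neq0 E) => mu0; rewrite -fx' Dx' orbit_coef_homog mu0.
  by rewrite expr0n gtn_eqF // mul0r eqxx.
have nzj' : x' 0 j != 0 by rewrite Dx' mxE mulf_neq0.
have Hx' : forall i, cl2 (imC iota) z1 z2 (x' 0 i).
  have Hratio i : cl2 (imC iota) z1 z2 (x' 0 i / x' 0 j).
    have -> : x' 0 i / x' 0 j = x 0 i / x 0 j.
      by rewrite Dx' [in LHS]mxE [X in _ / X]mxE -mulf_div mulfV // mul1r.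
    exact: Hz.
  exact: (cl2_unproject (orbit_coef_natural j k) (orbit_coef_homog j k) d_gt0 fx' nzj' Hratio).
have Mx' i : hull (imC iota) K (x' 0 i).
  pose A y := exists k, y = orbit_coef i k iota x'.
  have AM y : A y -> hull (imC iota) K y.
    move=> [l ->]; have [c' <-] := inv _ (orbit_coef_natural i l) (fun s Ss x => orbit_coef_inv i l x Ss) P' eP'.
    exact: subf_valP.
  have A2 y : A y -> cl2 (imC iota) z1 z2 y.
    move=> [l ->]; have Hcl := cl_closed (imC iota) (add1 (add1 (@none E) z1) z2).
    exact: (natural_sub (orbit_coef_natural i l) (relc_sub Hcl) (relc_base Hcl) Hx').
  have Hcl := cl_closed (imC iota) A.
  have Ax : cl (imC iota) A (x' 0 i).
    apply: (relc_alg Hcl); exists (\poly_(l < #|S|.+1) orbit_coef i l iota x'); split.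
    - apply/eqP => /(congr1 (fun p : {poly E} => p`_#|S|)).
      by rewrite coef_poly ltnSn orbit_coef_top coef0 => /eqP; rewrite oner_eq0.
    - move=> l; rewrite coef_poly; case: ifP => _; last exact: subf0 (relc_sub Hcl).
      by apply: cl_gen; exists l.
    - by apply/rootP; rewrite horner_poly; exact: orbit_coef_root.
  exact: hull_rank2 AM A2 Ax.
have fix' : forall s, s \in S -> x' *m act s = x'.
  apply: (equivariant_rational (v := v)) => // i.
  have [c' Dc'] := subf_ex (hull_subfield (imC iota) HK) (Mx' i); exists c'.
  by apply: etrans Dc' _; rewrite mxE.
have : x' = 0.
  have x'prj : x' *m map_mx iota prj = x' by rewrite Dx' -scalemxAl xprj.
  by rewrite -x'prj map_mxB map_mx1 mulmxBr mulmx1 fixed_avg // subrr.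
move/eqP; rewrite Dx' scaler_eq0 (negPf nzmu) /=; exact/negP.
Qed.

(** The evaluations at t 1 of the orbit vectors of (t 1)^k w, for w in the image of prj,
span that image: by a Lagrange interpolation polynomial which is 1 at t 1 and 0 at the
other t s, a combination of the orbit vectors with k varying is w itself. *)
Lemma equivariant_basis : exists P : 'I_(\rank prj) -> 'rV[{poly M}]_5,
  [/\ forall i, equivariant (P i), row_free (\matrix_i map_mx (ev 1%g) (P i))
    & forall i, map_mx (ev 1%g) (P i) *m map_mx iota prj = map_mx (ev 1%g) (P i)].
Proof.
have [jC vj] := jC_ex.
pose l : {poly E} := \prod_(s in S | s != 1%g) ((t 1%g - t s)^-1 *: ('X - (t s)%:P)).
have l1 : l.[t 1%g] = 1.
  rewrite horner_prod big1 // => s /andP[Ss ns]; rewrite hornerZ hornerXsubC mulVf // subr_eq0.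
  by apply: contra ns => /eqP/t_inj -> //; exact: SG.
have ls s : s \in S -> s != 1%g -> l.[t s] = 0.
  by move=> Ss ns; rewrite horner_prod (bigD1 s) ?Ss //= hornerZ hornerXsubC subrr mulr0 mul0r.
pose I := ('I_(size l) * 'I_5)%type.
pose Q (a : I) := orbit_vec v G t r jC rh a.1 (row a.2 prj).
pose EE := \matrix_(a < #|{: I}|) map_mx (ev 1%g) (Q (enum_val a)).
have evQ k w : map_mx (ev 1%g) (orbit_vec v G t r jC rh k w) = \sum_(s in S) t s ^+ k *: map_mx iota (w *m rh s).
  by rewrite (ev_orbit_vec r_t vj) //; apply: eq_bigr => s _; rewrite mulg1.
have rkEE : (EE :=: map_mx iota prj)%MS.
  apply/eqmxP/andP; split; last first.
    apply/row_subP => i; rewrite -map_row.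
    have -> : map_mx iota (row i prj) = \sum_(k < size l) l`_k *: map_mx (ev 1%g) (Q (k, i)).
      rewrite /Q /=; under eq_bigr => k _ do rewrite evQ scaler_sumr.
      have lsum s : \sum_(k < size l) l`_k *: (t s ^+ k *: map_mx iota (row i prj *m rh s)) = l.[t s] *: map_mx iota (row i prj *m rh s).
        by rewrite horner_coef scaler_suml; apply: eq_bigr => k _; rewrite scalerA.
      rewrite exchange_big /= (bigD1 1%g S1) /= lsum l1 scale1r rh1 mulmx1 big1 ?addr0 // => s SsN.
      by case/andP: SsN => Ss ns; rewrite lsum ls // scale0r.
    apply: summx_sub => k _; apply: scalemx_sub.
    have -> : map_mx (ev 1%g) (Q (k, i)) = row (enum_rank ((k, i) : I)) EE by rewrite rowK enum_rankK.
    exact: row_sub.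
  apply/row_subP => a; rewrite rowK evQ; apply: summx_sub => s Ss; apply: scalemx_sub.
  by rewrite -row_mul prj_rh // map_row map_mxM row_mul submxMl.
have rk : \rank EE = \rank prj by rewrite rkEE mxrank_map.
rewrite -rk; exists (fun i => Q (enum_val (maxrankfun EE i))); split.
- by move=> i; exact: (orbit_vec_equivariant r_t vj rhM).
- have -> : \matrix_i map_mx (ev 1%g) (Q (enum_val (maxrankfun EE i))) = rowsub (maxrankfun EE) EE.
    by apply/row_matrixP => i; rewrite rowK row_rowsub rowK.
  exact: maxrowsub_free.
- move=> i; rewrite evQ mulmx_suml; apply: eq_bigr => s Ss; rewrite -scalemxAl -map_mxM.
  have prjK : prj *m prj = prj by rewrite {2}/prj mulmxBr mulmx1 prj_avg subr0.
  by rewrite -mulmxA -prj_rh // mulmxA -row_mul prjK.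
Qed.
End Equivariant.

(** * Triviality of the decomposition group *)

Section Contradiction.
Variables (E : fieldType) (Ecl : closedF E) (E0 : char_zero E).
Variables (C : fieldType) (C0 : char_zero C) (iota : {rmorphism C -> E}).
Variables (K : E -> Prop) (HK : subfieldP K) (CK : forall x, imC iota x -> K x).
Local Notation M := (subf (hull_subfield (imC iota) HK)).
Local Notation v := (@subf_val E _ (hull_subfield (imC iota) HK)).
Variables (gT : finGroupType) (G : {group gT}) (t : gT -> E) (r : gT -> {poly M}) (W : {poly M}).
Hypotheses (t_inj : {in G &, injective t})
  (r_t : forall s u, s \in G -> u \in G -> (map_poly v (r s)).[t u] = t (s * u)%g)
  (WE : map_poly v W = \prod_(s in G) ('X - (t s)%:P)).
Variable rh : gT -> 'M[C]_5.
Hypotheses (rhM : {in G &, {morph rh : s u / (s * u)%g >-> s *m u}}) (rh1 : rh 1%g = 1%:M).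
Local Notation S := (stabM v G t).
Local Notation act s := (map_mx iota (rh s)).
Local Notation ev := (ev v t).
Local Notation equivariant := (equivariant v G t iota rh).
Local Notation prj := (prj iota HK G t rh).
Local Notation avg := (avg iota HK G t rh).
Hypothesis tri_act : forall s, s \in G -> forall x u w : 'rV[E]_5,
  tri (x *m act s) (u *m act s) (w *m act s) = tri x u w.
Hypothesis det_act : forall s, s \in G -> \det (act s) ^+ 2 = 1.

Let SG s : s \in S -> s \in G. Proof. exact: stabM_sub. Qed.

Lemma tri_act_base s x u w : s \in G -> tri (x *m rh s) (u *m rh s) (w *m rh s) = tri x u w.
Proof.
move=> Gs; apply: (fmorph_inj iota).
by rewrite -!tri_map !map_mxM tri_act.
Qed.

Lemma det_hess_act s x : s \in G -> \det (hess (x *m act s)) = \det (hess x).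
Proof.
move=> Gs; have -> : hess x = act s *m hess (x *m act s) *m (act s)^T.
  apply/matrixP => i j.
  have Eij (B : 'M[E]_5) : B i j = ((delta_mx 0 i : 'rV_5) *m B *m (delta_mx 0 j : 'rV_5)^T) 0 0.
    by rewrite trmx_delta -colE -rowE !mxE.
  by rewrite Eij [RHS]Eij tri_hess -(tri_act Gs) -tri_hess trmx_mul !mulmxA.
by rewrite !det_mulmx det_tr mulrAC -expr2 det_act // mul1r.
Qed.

Lemma tri_avg a u b : tri (a *m avg) (u *m avg) (b *m avg) = tri (a *m avg) u (b *m avg).
Proof.
have S_gt0 : (0 < #|S|)%N.
  by apply/card_gt0P; exists 1%g; exact: (group1 (stabM_group r_t)).
have nzS : #|S|%:R != 0 :> C by rewrite -(prednK S_gt0); apply: C0.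
set a' := a *m avg; set b' := b *m avg.
have HL w : tri a' w b' = (w *m (hess a' *m b'^T)) 0 0 by rewrite mulmxA tri_hess.
have Es s : s \in S -> u *m rh s *m (hess a' *m b'^T) = u *m (hess a' *m b'^T).
  move=> Ss; rewrite [LHS]mx11_scalar [RHS]mx11_scalar -!HL; congr (_%:M).
  rewrite -[in RHS](tri_act_base _ _ _ (SG Ss)) /a' /b' -!(mulmxA _ avg).
  by rewrite !(avg_rh r_t rhM Ss).
rewrite !HL /avg -scalemxAr -scalemxAl mulmx_sumr mulmx_suml (eq_bigr _ Es).
by rewrite sumr_const -scaler_nat scalerA mulVf // scale1r.
Qed.

(** If all invariant forms in question vanished on the image of prj, so would their
polarizations: the trilinear form would be zero on triples of vectors each in the image
of prj or fixed, with at least one in the image of prj (with two or three there by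
hypothesis, with a single one by averaging).  A nonzero u in the image of prj would then have hess u = 0. *)
Lemma exists_invariant_form : prj != 0 -> exists d (f : natfun C 5) x,
  [/\ (0 < d <= 3)%N, natural f, homog f d,
      forall s, s \in S -> forall x, f E iota (x *m act s) = f E iota x
    & f C idfun (x *m prj) != 0].
Proof.
move=> nzprj; apply: contrapT => H.
have H3 x : tri (x *m prj) (x *m prj) (x *m prj) = 0.
  apply/eqP/negPn/negP => nz; case: H; exists 3, (@cubic_fun C), x; split=> //.
  - exact: cubic_fun_natural.
  - exact: cubic_fun_homog.
  - by move=> s Ss y; exact: tri_act (SG Ss) _ _ _.
have H2 w x : tri (w *m avg) (x *m prj) (x *m prj) = 0.
  apply/eqP/negPn/negP => nz; case: H; exists 2, (quadric_fun (w *m avg)), x; split=> //.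
  - exact: quadric_fun_natural.
  - exact: quadric_fun_homog.
  - move=> s Ss y; rewrite /quadric_fun -[RHS](tri_act (SG Ss)) -map_mxM -mulmxA.
    by rewrite (avg_rh r_t rhM Ss).
  - by rewrite /quadric_fun map_mx_id.
have nz2 : 2%:R != 0 :> C by exact: C0.
have nz6 : 6%:R != 0 :> C by exact: C0.
have T3 x y z : tri (x *m prj) (y *m prj) (z *m prj) = 0.
  by apply: (mulfI nz6); rewrite tri_polar3 -!mulmxDl !H3 mulr0; ring.
have T2 x y z : tri (x *m avg) (y *m prj) (z *m prj) = 0.
  by apply: (mulfI nz2); rewrite tri_polar2 -!mulmxDl !H2 mulr0; ring.
have T1 x y z : tri (x *m avg) (y *m prj) (z *m avg) = 0.
  rewrite -tri_avg -mulmxA (prj_avg C0 r_t rhM) mulmx0.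
  by rewrite triC12 triC23 /tri !mxE /tri5; ring.
have dec (y : 'rV[C]_5) : y = y *m prj + y *m avg.
  by rewrite -mulmxDr prjD_avg mulmx1.
have T u a b : tri (u *m prj) a b = 0.
  have T2' y z w : tri (y *m prj) (z *m prj) (w *m avg) = 0 by rewrite triC23 triC12 T2.
  have T2'' y z w : tri (y *m prj) (z *m avg) (w *m prj) = 0 by rewrite triC12 T2.
  have T1' y z w : tri (y *m prj) (z *m avg) (w *m avg) = 0 by rewrite triC12 T1.
  by rewrite (dec a) (dec b) triDm !triD T3 T2' T2'' T1' !addr0.
case/eqP: nzprj; apply/row_matrixP => i; rewrite row0 rowE; apply: hess_eq0.
apply/matrixP => j k; rewrite [RHS]mxE -(T (delta_mx 0 i) (delta_mx 0 j) (delta_mx 0 k)) -tri_hess.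
by rewrite trmx_delta -colE -!rowE [RHS]mxE [RHS]mxE.
Qed.

Section Coordinates.
Variable P : 'I_(\rank prj) -> 'rV[{poly M}]_5.
Hypotheses (eP : forall i, equivariant (P i)) (freeP : row_free (\matrix_i map_mx (ev 1%g) (P i)))
  (prjP : forall i, map_mx (ev 1%g) (P i) *m map_mx iota prj = map_mx (ev 1%g) (P i)).
(** The vector space over M with the equivariant vectors P as a basis, and its embedding in
E^5. *)
Definition comb (y : 'rV[M]_(\rank prj)) : 'rV[{poly M}]_5 := \sum_i (y 0 i)%:P *: P i.
Definition pt (y : 'rV[M]_(\rank prj)) : 'rV[E]_5 := map_mx v y *m \matrix_i map_mx (ev 1%g) (P i).

Lemma comb_equivariant y : equivariant (comb y). Proof. exact: equivariant_comb. Qed.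

Lemma ptE y : map_mx (ev 1%g) (comb y) = pt y.
Proof.
rewrite /comb raddf_sum /pt mulmx_sum_row; apply: eq_bigr => i _; rewrite rowK.
by apply/rowP => j; rewrite !mxE /= evM evC.
Qed.

Lemma pt_neq0 y : y != 0 -> pt y != 0.
Proof.
move=> nzy; apply: contraNneq nzy => pt0.
have : map_mx v y = 0 by apply: (row_free_inj freeP); rewrite mul0mx.
by move/eqP; rewrite map_mx_eq0.
Qed.

Lemma pt_prj y : pt y *m map_mx iota prj = pt y.
Proof.
rewrite /pt -mulmxA; congr (_ *m _); apply/row_matrixP => i.
by rewrite row_mul !rowK prjP.
Qed.

Lemma pt_no_rank2 y : y != 0 -> ~ proj_rank2 iota (pt y).
Proof.
move=> nzy H; apply: (no_rank2_vector Ecl C0 CK t_inj r_t WE rhM rh1 (comb_equivariant y)).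
- by rewrite ptE pt_prj.
- by rewrite ptE pt_neq0.
- by rewrite ptE.
Qed.

(** The values of an invariant form at equivariant vectors are in M, by descent. *)
Lemma pt_form d (f : natfun C 5) : natural f -> homog f d ->
  (forall s, s \in S -> forall x, f E iota (x *m act s) = f E iota x) ->
  exists2 g : 'rV[M]_(\rank prj) -> M, pform d g & forall y, v (g y) = f E iota (pt y).
Proof.
move=> nf hf fS; have [jC vj] : exists jC : {rmorphism C -> M}, forall c, v (jC c) = iota c.
  by apply: lift_rmorph => c; apply: subf_ex; apply: hull_base; apply: CK; exists c.
have /choice[g Hg] : forall y, exists c, v c = f E iota (pt y).
  by move=> y; rewrite -ptE; exact: (invariant_rational t_inj r_t WE vj nf (comb_equivariant y) fS).
exists g => //.
pose B := \matrix_i map_mx (ev 1%g) (P i); pose lin : {linear 'rV[E]_(\rank prj) -> 'rV[E]_5} := mulmxr B.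
have H : pform d (f E iota \o lin) := pform_comp lin (natural_pform iota nf hf).
exact: (pform_descent (hull_char0 (imC iota) HK E0) Hg H).
Qed.
End Coordinates.

Lemma prj_eq0 : prj = 0.
Proof.
apply/eqP/negPn/negP => nzprj.
have [P [eP freeP prjP]] := equivariant_basis C0 CK t_inj r_t rhM rh1.
have M6 : solvable_upto M 6 := hull_solvable Ecl E0.
have M0 : char_zero M := hull_char0 (imC iota) HK E0.
have dimU : \dim {:'rV[M]_(\rank prj)} = \rank prj by rewrite dimvf /dim /= mul1n.
have m_gt0 : (0 < \rank prj)%N by rewrite lt0n mxrank_eq0.
(* Coordinates in a basis over C of the image of prj, in which the rank is estimated. *)
have Dpt y : pt P y = (pt P y *m map_mx iota (col_base prj)) *m map_mx iota (row_base prj).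
  by rewrite -mulmxA -map_mxM mulmx_base pt_prj.
have nzu y : y != 0 -> pt P y *m map_mx iota (col_base prj) != 0.
  by move=> /(pt_neq0 freeP); apply: contraNneq => u0; rewrite Dpt u0 mul0mx.
have no_u y : y != 0 -> ~ proj_rank2 iota (pt P y *m map_mx iota (col_base prj)).
  move=> nzy H; apply: (pt_no_rank2 eP freeP prjP nzy); rewrite Dpt.
  by apply: proj_rank2_lin H _; rewrite -Dpt; exact: pt_neq0.
(* In dimension at most 3 any nonzero vector has projective rank at most 2. *)
have [le3|gt3] := leqP (\rank prj) 3.
  have nz1 : const_mx 1 != 0 :> 'rV[M]_(\rank prj).
    apply/eqP => /rowP/(_ (Ordinal m_gt0)); rewrite !mxE; apply/eqP; exact: oner_neq0.
  by apply: (no_u _ nz1); apply: proj_rank2_small => //; exact: nzu.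
have [d [f [c [/andP[d_gt0 led3] nf hf fS nzf]]]] := exists_invariant_form nzprj.
have [m4|n4] := eqVneq (\rank prj) 4.
  have [g Hg Dg] := pt_form eP nf hf fS.
  have [|y [_ nzy gy]] := form_zero M0 (solvable_upto_le (leq_trans led3 (isT : 3 <= 6)%N) M6) d_gt0 Hg (U := fullv).
    by rewrite dimU m4.
  pose f' : natfun C (\rank prj) := fun A phi x => f A phi (x *m map_mx phi (row_base prj)).
  apply: (no_u _ nzy).
  apply: (@proj_rank2_hypersurface_eq _ _ C0 _ iota d f' _ (c *m col_base prj)) m4 _ _ _ _ _.
  - move=> A B phi psi h hphi x; rewrite /f' -(nf _ _ _ _ _ hphi) map_mxM; congr (f _ _ (_ *m _)).
    by apply/matrixP => i j; rewrite !mxE.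
  - by move=> A phi s x; rewrite /f' -scalemxAl hf.
  - exact: nzu.
  - by rewrite /f' -Dpt -Dg gy rmorph0.
  - by rewrite /f' map_mx_id // -mulmxA mulmx_base.
have m5 : \rank prj = 5%N by apply/eqP; rewrite eqn_leq rank_leq_row ltn_neqAle eq_sym n4.
have [c3 Hc3 Dc3] := pt_form eP (@cubic_fun_natural C) (@cubic_fun_homog C) (fun s Ss x => tri_act (SG Ss) x x x).
have [c5 Hc5 Dc5] := pt_form eP (@quintic_fun_natural C) (@quintic_fun_homog C) (fun s Ss x => det_hess_act x (SG Ss)).
have [|y [_ nzy y3 y5]] := cubic_quintic M0 M6 Hc3 Hc5 (U := fullv); first by rewrite dimU m5.
apply: (pt_no_rank2 eP freeP prjP nzy); apply: klein_rank2.
- exact: C0.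
- exact: pt_neq0.
- have /eqP : cubic_fun iota (pt P y) = 0 by rewrite -Dc3 y3 rmorph0.
  by rewrite /cubic_fun tri_klein mulf_eq0 (negPf (E0 _)) => /eqP.
- by rewrite -det_hess -/(quintic_fun iota (pt P y)) -Dc5 y5 rmorph0.
Qed.

Lemma faithful_hull : (forall s, s \in G -> rh s = 1%:M -> s = 1%g) -> hull (imC iota) K (t 1%g).
Proof.
move=> faith; have avg1 : avg = 1%:M by rewrite -[LHS]add0r -prj_eq0 prjD_avg.
have S1 s : s \in S -> s = 1%g.
  move=> Ss; apply: faith; first exact: SG.
  by rewrite -[LHS]mul1mx -avg1 (avg_rh r_t rhM Ss).
have [c Dc] : exists c, v c = ev 1%g 'X.
  by apply: (descent t_inj r_t WE) => s /S1 ->.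
by rewrite -(evX v t) -Dc; exact: subf_valP.
Qed.
End Contradiction.

(** * The representation of PSL(2,11) and the resolvent degree *)

Local Notation SL2 := (SL_group 2 'F_11).
Local Notation Z2 := ('Z(SL2))%g.

Lemma eqmx2 (A : Type) (g h : 'M[A]_2) :
  g 0 0 = h 0 0 -> g 0 1 = h 0 1 -> g 1 0 = h 1 0 -> g 1 1 = h 1 1 -> g = h.
Proof.
have two (i : 'I_2) : i = 0 \/ i = 1.
  by case: i => [[|[|//]] ?]; [left | right]; apply: val_inj.
by move=> ? ? ? ?; apply/matrixP => i j; case: (two i) (two j) => -> [] ->.
Qed.

Lemma mulmx2 (A : comNzRingType) (g h : 'M[A]_2) i j : (g *m h) i j = g i 0 * h 0 j + g i 1 * h 1 j.
Proof. by rewrite mxE big_ord_recl big_ord1; congr (_ + g _ _ * h _ _); exact: val_inj. Qed.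

Lemma SL2P (x : {'GL_2['F_11]}) : x \in SL2 -> \det (GLval x) = 1.
Proof. by rewrite inE => /eqP. Qed.

Lemma SL2_lift (g : 'M['F_11]_2) : \det g = 1 -> exists2 x, x \in SL2 & GLval x = g.
Proof.
move=> Dg; have ug : (g : 'M['F_11]_2.-1.+1) \is a GRing.unit by rewrite -/unitmx unitmxE Dg unitr1.
by exists (FinRing.Unit ug : {'GL_2['F_11]}); rewrite // inE /= Dg.
Qed.

(** The elements of the centre commute with the two elementary unipotent matrices. *)
Lemma center_SL2 x : x \in Z2 -> exists a : F11, a * a = 1 /\ GLval x = a%:M :> 'M_2.
Proof.
move=> /centerP[Sx Cx]; have Dx := SL2P Sx; pose g : 'M['F_11]_2 := GLval x.
have comm (h : 'M['F_11]_2) : \det h = 1 -> g *m h = h *m g.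
  by move=> /SL2_lift[y Sy <-]; have := congr1 GLval (Cx y Sy); rewrite !GL_MxE.
have e1 := comm (\matrix_(i, j) (i <= j)%:R); have e2 := comm (\matrix_(i, j) (j <= i)%:R).
have {}e1 : g *m (\matrix_(i, j) (i <= j)%:R) = (\matrix_(i, j) (i <= j)%:R) *m g.
  by apply: e1; rewrite det2 !mxE; apply: val_inj.
have {}e2 : g *m (\matrix_(i, j) (j <= i)%:R) = (\matrix_(i, j) (j <= i)%:R) *m g.
  by apply: e2; rewrite det2 !mxE; apply: val_inj.
have b0 : g 0 1 = 0.
  have := congr1 (fun h : 'M_2 => h 0 0) e2; rewrite !mulmx2 !mxE /= !(mulr1, mulr0, mul1r, mul0r, addr0, add0r).
  by move/eqP; rewrite -subr_eq0 addrAC subrr add0r => /eqP.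
have c0 : g 1 0 = 0.
  have := congr1 (fun h : 'M_2 => h 0 0) e1; rewrite !mulmx2 !mxE /= !(mulr1, mulr0, mul1r, mul0r, addr0, add0r).
  by move/eqP; rewrite eq_sym -subr_eq0 addrAC subrr add0r => /eqP.
have ad : g 0 0 = g 1 1.
  have := congr1 (fun h : 'M_2 => h 0 1) e1; rewrite !mulmx2 !mxE /= !(mulr1, mulr0, mul1r, mul0r, addr0, add0r).
  by rewrite b0 addr0 add0r.
exists (g 0 0); split; first by rewrite -Dx -/g det2 b0 mul0r subr0 -ad.
by apply: eqmx2; rewrite -/g ?b0 ?c0 -?ad !mxE.
Qed.

Lemma scalar_center_SL2 x a : x \in SL2 -> GLval x = a%:M :> 'M_2 -> x \in Z2.
Proof.
move=> Sx Dx; apply/centerP; split=> // y _; apply: val_inj.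
change (GLval (x * y)%g = GLval (y * x)%g).
by rewrite !GL_MxE Dx scalar_mxC.
Qed.

Lemma SL2_norm x : x \in SL2 -> x \in 'N(Z2)%g.
Proof. exact: (fintype.subsetP (normal_norm (center_normal _))). Qed.

Section ProjectiveWeil.
Variables (F : fieldType) (F0 : char_zero F) (z : F).
Hypotheses (z11 : z ^+ 11 = 1) (z1 : z != 1).

(** The action of a representative of the coset; the centre acts trivially. *)
Definition weil (q : coset_of Z2) : 'M[F]_5 := rho z (GLval (fingroup.repr q)).

Lemma weil_coset x : x \in SL2 -> weil (coset Z2 x) = rho z (GLval x).
Proof.
move=> Sx; have Nx := SL2_norm Sx.
have : fingroup.repr (coset Z2 x) \in (Z2 :* x)%g by rewrite -val_coset // mem_repr_coset.
move=> /rcosetP[y Zy Dr]; rewrite /weil Dr GL_MxE.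
have Sy : y \in SL2 by case/centerP: Zy.
rewrite rhoM ?SL2P //; have [a [aa1 ->]] := center_SL2 Zy.
by rewrite /rho !mxE /= weil4_scalar // mul1mx.
Qed.

Lemma PSL2P q : q \in PSL 2 'F_11 -> exists2 x, x \in SL2 & q = coset Z2 x.
Proof. by case/morphimP => x Nx Sx ->; exists x. Qed.

Lemma repr_SL2 q : q \in PSL 2 'F_11 -> \det (GLval (fingroup.repr q)) = 1.
Proof.
case/PSL2P => x Sx ->; apply: SL2P.
have Nx := SL2_norm Sx.
have : fingroup.repr (coset Z2 x) \in (Z2 :* x)%g by rewrite -val_coset // mem_repr_coset.
by move=> /rcosetP[y /centerP[Sy _] ->]; rewrite groupM.
Qed.

Lemma weilM : {in PSL 2 'F_11 &, {morph weil : q u / (q * u)%g >-> q *m u}}.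
Proof.
move=> _ _ /PSL2P[x Sx ->] /PSL2P[y Sy ->].
by rewrite -morphM ?SL2_norm // !weil_coset ?groupM // GL_MxE rhoM ?SL2P.
Qed.

Lemma weil1 : weil 1%g = 1%:M.
Proof.
rewrite -(morph1 (coset_morphism Z2)) weil_coset ?group1 // GL_1E.
by rewrite /rho !mxE /= weil4_scalar // mulr1.
Qed.

Lemma weil_faithful q : q \in PSL 2 'F_11 -> weil q = 1%:M -> q = 1%g.
Proof.
case/PSL2P => x Sx ->; rewrite weil_coset // => W1.
have Dx := SL2P Sx; rewrite det2 in Dx.
have [b0 c0 ad] := weil4_faithful F0 z11 z1 Dx W1.
apply: coset_id; apply: (scalar_center_SL2 (a := GLval x 0 0)) => //.
by apply: eqmx2; rewrite ?b0 ?c0 -?ad !mxE.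
Qed.
End ProjectiveWeil.

Lemma map_rho (F E : fieldType) (h : {rmorphism F -> E}) (z : F) g :
  map_mx h (rho z g) = rho (h z) g.
Proof.
have hch x : h (echar z x) = echar (h z) x by rewrite /echar rmorphXn.
have hchi x : h (chi F x) = chi E x by rewrite /chi; case: ifP => _; rewrite ?rmorphN rmorph1.
have hgam : h (gam z) = gam (h z).
  rewrite /gam rmorphN fmorphV; congr (- _^-1); rewrite /gauss rmorph_sum.
  by apply: eq_bigr => y _; rewrite hch.
have hker a b c d x y : h (ker z a b c d x y) = ker (h z) a b c d x y.
  by rewrite /ker; case: ifP => _; rewrite !rmorphM ?hch ?hchi ?hgam ?rmorph_nat.
by apply/matrixP => i j; rewrite !mxE rmorphB /= !hker.
Qed.

Lemma exists_root_of_unity (F : closedFieldType) : char_zero F -> exists2 z : F, z ^+ 11 = 1 & z != 1.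
Proof.
move=> F0; pose p : {poly F} := \poly_(i < 11) 1.
have szp : size p = 11 by rewrite size_poly_eq // oner_neq0.
have /closed_rootP[z /rootP] : size p != 1 by rewrite szp.
rewrite horner_poly => Hz.
have {}Hz : \sum_(i < 11) z ^+ i = 0 by rewrite -[RHS]Hz; apply: eq_bigr => i _; rewrite mul1r.
exists z; first by apply/eqP; rewrite -subr_eq0 subrX1 Hz mulr0.
apply/eqP => z1; move/eqP: Hz; rewrite z1 (eq_bigr (fun=> 1)) => [|i _]; last by rewrite expr1n.
by rewrite sumr_const card_ord; apply/negP; exact: F0.
Qed.

Section GaloisResolvent.
Variables (F : fieldType) (L : splittingFieldType F).
Hypothesis galL : galois 1%VS {:L}.
Local Notation G := ('Gal({:L} / 1))%g.

Lemma exists_primitive : exists th : L, forall x, exists q : {poly F}, x = (map_poly (in_alg L) q).[th].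
Proof.
have [_ sepL _] := and3P galL.
exists (separable_generator 1 {:L}) => x.
have : x \in <<1; separable_generator 1 {:L}>>%VS.
  by rewrite -(eq_adjoin_separable_generator sepL (sub1v _)) memvf.
by case/Fadjoin_polyP => p /polyOver1P[q ->] ->; exists q.
Qed.

Lemma gal_horner s (q : {poly F}) th : s \in G ->
  s (map_poly (in_alg L) q).[th] = (map_poly (in_alg L) q).[s th].
Proof.
move=> Gs; rewrite -horner_map -map_poly_comp; congr (_.[_]); apply: eq_map_poly => c /=.
by rewrite linearZ rmorph1.
Qed.

Lemma gal_orbit_poly th : exists q : {poly F}, map_poly (in_alg L) q = \prod_(s in G) ('X - (s th)%:P).
Proof.
suff /polyOver1P[q Dq] : \prod_(s in G) ('X - (s th)%:P) \is a polyOver 1%VS by exists q.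
have fixp u : u \in G -> map_poly u (\prod_(s in G) ('X - (s th)%:P)) = \prod_(s in G) ('X - (s th)%:P).
  move=> Gu; rewrite rmorph_prod [RHS](reindex_inj (mulIg u)) /=.
  under [RHS]eq_bigl => s do rewrite groupMr //.
  by under [RHS]eq_bigr => s _ do rewrite galM ?memvf // -map_polyXsubC.
have /galois_fixedField fixG := galL.
apply/polyOverP => i; set c := _`_i.
suff : c \in fixedField G by rewrite fixG.
apply/(fixedFieldP (memvf _)) => u Gu.
by rewrite /c -coef_map fixp.
Qed.
End GaloisResolvent.

Section Resolvent.
Variables (R : realType) (K : extC R) (L : splittingFieldType K).
Hypothesis galL : galois 1%VS {:L}.
Local Notation G := ('Gal({:L} / 1))%g.
Hypothesis isoG : G \isog PSL 2 'F_11.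

(** In the notation of the descent, t s is the image in E of s(th), for a primitive element
th, and the group acts through G = PSL(2,11) and the Weil representation. *)
Lemma resolvable_PSL2_11 : resolvable_in L 2.
Proof.
have [E [g Ecl]] := exists_algebraic_closure L.
pose lam : {rmorphism K -> E} := g \o in_alg L.
pose iota : {rmorphism R[i] -> E} := lam \o embC K.
have C0 : char_zero R[i] by move=> n; rewrite Num.Theory.pnatr_eq0.
have E0 : char_zero E by move=> n; rewrite -(rmorph_nat iota) fmorph_eq0; exact: C0.
have HK : subfieldP (imC lam) := imC_subfield lam.
have CK x : imC iota x -> imC lam x by move=> [c <-]; exists (embC K c).
pose v := @subf_val E _ (hull_subfield (imC iota) HK).
have [kap vkap] : exists kap : {rmorphism K -> subf (hull_subfield (imC iota) HK)}, forall c, v (kap c) = lam c.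
  by apply: lift_rmorph => c; apply: subf_ex; apply: hull_base; exists c.
have Ekap q : map_poly v (map_poly kap q) = map_poly g (map_poly (in_alg L) q).
  by rewrite -!map_poly_comp; apply: eq_map_poly => c; exact: vkap c.
have [th thP] := exists_primitive galL.
have /choice[q Dq] := fun s : gal_of {:L} => thP (s th).
have [W DW] := gal_orbit_poly galL th.
pose t (s : gal_of {:L}) := g (s th); pose r s := map_poly kap (q s).
have t_inj : {in G &, injective t}.
  move=> s u Gs Gu /fmorph_inj Esu; apply/eqP/gal_eqP => x _.
  by have [p ->] := thP x; rewrite !gal_horner // Esu.
have r_t s u : s \in G -> u \in G -> (map_poly v (r s)).[t u] = t (s * u)%g.
  by move=> Gs Gu; rewrite Ekap horner_map -gal_horner // -Dq /t galM ?memvf.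
have WE : map_poly v (map_poly kap W) = \prod_(s in G) ('X - (t s)%:P).
  by rewrite Ekap DW rmorph_prod /=; under eq_bigr => s _ do rewrite map_polyXsubC.
have [z z11 z1] := exists_root_of_unity C0.
have [f injf fG] := isogP isoG.
have fP s : s \in G -> f s \in PSL 2 'F_11 by move=> Gs; rewrite -fG mem_morphim.
pose rh s := weil z (f s).
have rhM : {in G &, {morph rh : s u / (s * u)%g >-> s *m u}}.
  by move=> s u Gs Gu; rewrite /rh morphM // weilM ?fP.
have rh1 : rh 1%g = 1%:M by rewrite /rh morph1 weil1.
have faith s : s \in G -> rh s = 1%:M -> s = 1%g.
  move=> Gs /(weil_faithful C0 z11 z1 (fP _ Gs)) fs1.
  by apply: (injmP injf); rewrite ?group1 // fs1 morph1.
have iz11 : iota z ^+ 11 = 1 by rewrite -rmorphXn z11 rmorph1.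
have iz1 : iota z != 1 by rewrite -(rmorph1 iota) (inj_eq (fmorph_inj iota)).
have tri_act s : s \in G -> forall x u w : 'rV[E]_5,
    tri (x *m map_mx iota (rh s)) (u *m map_mx iota (rh s)) (w *m map_mx iota (rh s)) = tri x u w.
  by move=> Gs x u w; rewrite map_rho tri_rho // repr_SL2 ?fP.
have det_act s : s \in G -> \det (map_mx iota (rh s)) ^+ 2 = 1.
  by move=> Gs; rewrite map_rho det_rho // repr_SL2 ?fP.
have Mth : hull (imC iota) (imC lam) (g th).
  have := faithful_hull Ecl E0 C0 CK t_inj r_t WE rhM rh1 tri_act det_act faith.
  by rewrite /t gal_id.
apply: (resolvable_of_hull Ecl (lam := lam) (g := g)) => [c|x]; first by [].
have [p ->] := thP x; rewrite -horner_map.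
apply: (subf_horner (hull_subfield (imC iota) HK)) => // i.
by rewrite -map_poly_comp coef_map; apply: hull_base; exists p`_i.
Qed.
End Resolvent.

Theorem mainTheorem1 (R : realType) :
  (RD R (PSL_group 2 'F_11) <= 2%:R%:E)%E.
Proof.
apply: ge_ereal_sup => _ [K [L [_ galL isoG ->]]].
by apply/least_le; exists 2; last exact: resolvable_PSL2_11.
Qed.
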